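(* Let $i\in I\setminus X$ be such that $\tau(i)=i$ and let $j\in I\setminus X$ be distinct from $i$. Write $a=a_{ij}$. Then in $U_q(\mathfrak g')$ $$F_{ij}(B_i,B_j)=\sum_{m=0}^{-1-a}\ \sum_{m'=0}^{-1-a-m}\rho_{m,m'}\,\mathcal Z_i^{\frac{1-a-m-m'}{2}}B_i^mB_jB_i^{m'},$$ where $$\rho_{m,m'}=(a+m+m')_p\left(\frac{c_iq_i^2}{q_i-q_i^{-1}}\right)^{\frac{1-a-m-m'}{2}}\sum_{k=m'}^{1-a-m}\ \sum_{\boldsymbol\ell\in\mathcal L_{m,m',k}}\ \sum_{\boldsymbol s\in\mathscr S_{m,m'}}(-1)^{k+1}\begin{bmatrix}1-a\\k\end{bmatrix}_{q_i}q_i^{\theta_{\boldsymbol\ell,\boldsymbol s,k}}\prod_{r=1}^{1-a}\left(\left(\zeta^{(r-1)}_{\boldsymbol\ell,\boldsymbol s}+1\right)_{q_i^2}\right)^{(1-\ell_r)s_{r-|\boldsymbol\ell|_{1;r}}},$$ $$\theta_{\boldsymbol\ell,\boldsymbol s,k}=-a\,\zeta^{(1-a-k)}_{\boldsymbol\ell,\boldsymbol s}-2\sum_{r=1}^{1-a}\zeta^{(r-1)}_{\boldsymbol\ell,\boldsymbol s},\qquad \zeta^{(r)}_{\boldsymbol\ell,\boldsymbol s}=2|\boldsymbol s|_{1;r-|\boldsymbol\ell|_{1;r}}+|\boldsymbol\ell|_{1;r}-r,$$ $$\mathcal L_{m,m',k}=\{\boldsymbol\ell\in\{0,1\}^{1-a}:\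 |\boldsymbol\ell|_{1;1-a-k}=m,\ |\boldsymbol\ell|_{2-a-k;1-a}=m'\},$$ $$\mathscr S_{m,m'}=\{\boldsymbol s\in\{0,1\}^{1-a-m-m'}:\ |\boldsymbol s|=\tfrac{1-a-m-m'}{2},\ |\boldsymbol s|_{1;p}\ge\tfrac p2\ \forall p\in\{1,\dots,1-a-m-m'\}\}.$$ Terms with $a+m+m'$ even are zero.
   Context: General conventions: $\mathbb N=\{0,1,2,\dots\}$; empty sums are $0$, empty products are $1$, $0^0=1$. For $d\in\mathbb Z$: $d_e=\lfloor d/2\rfloor$, $d_p=d-2d_e\in\{0,1\}$. For a binary tuple $\boldsymbol\ell=(\ell_1,\dots,\ell_N)\in\{0,1\}^N$: $|\boldsymbol\ell|=\ell_1+\dots+\ell_N$, and $|\boldsymbol\ell|_{r;s}=\ell_r+\dots+\ell_s$ if $r\le s$, $0$ otherwise. Expressions $(1-\ell_r)s_{r-|\boldsymbol\ell|_{1;r}}$ are read as $0$ when $\ell_r=1$. Binary tuples $\boldsymbol s$ are unrelated to the parameter vector $\mathbf s$ below. Quantum group: $\mathbb K$ is an algebraically closed field of characteristic $0$, $q$ an indeterminate. $I=\{0,\dots,n-1\}$ and $A=(a_{ij})_{i,j\in I}$ is an indecomposable symmetrizable generalized Cartan matrix ($a_{ii}=2$; $a_{ij}\in\mathbb Z_{\le0}$ for $i\ne j$; $a_{ij}=0\Leftrightarrow a_{ji}=0$), with mutually coprime positive integers $\epsilon_i$ such that $(\epsilon_ia_{ij})$ is symmetric. $\mathfrak g=\mathfrak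 g(A)$ is the Kac–Moody algebra with simple roots $\alpha_i$, coroots $h_i$, $\alpha_j(h_i)=a_{ij}$, root lattice $Q=\bigoplus_i\mathbb Z\alpha_i$, and $(\alpha_i,\alpha_j)=\epsilon_ia_{ij}$. Put $q_i=q^{\epsilon_i}$, $[m]_{q_i}=\frac{q_i^m-q_i^{-m}}{q_i-q_i^{-1}}$, $[m]_{q_i}!=\prod_{\ell=1}^m[\ell]_{q_i}$, $\begin{bmatrix}N\\ m\end{bmatrix}_{q_i}=\frac{[N]_{q_i}!}{[m]_{q_i}![N-m]_{q_i}!}$, $(N)_{q_i^2}=\frac{1-q_i^{2N}}{1-q_i^2}$, and $F_{ij}(x,y)=\sum_{\ell=0}^{1-a_{ij}}(-1)^\ell\begin{bmatrix}1-a_{ij}\\\ell\end{bmatrix}_{q_i}x^{1-a_{ij}-\ell}yx^\ell$. $U_q(\mathfrak g')$ is the $\mathbb K(q)$-algebra generated by $E_i,F_i,K_i^{\pm1}$ ($i\in I$) with relations: $K_i^{\pm1}K_i^{\mp1}=1$, the $K_i$ commute, $K_iE_j=q_i^{a_{ij}}E_jK_i$, $K_iF_j=q_i^{-a_{ij}}F_jK_i$, $[E_i,F_j]=\delta_{ij}\frac{K_i-K_i^{-1}}{q_i-q_i^{-1}}$, $F_{ij}(E_i,E_j)=F_{ij}(F_i,F_j)=0$ ($i\ne j$). Hopf structure: $\Delta(E_i)=E_i\otimes1+K_i\otimes E_i$, $\Delta(F_i)=F_i\otimes K_i^{-1}+1\otimes F_i$, $\Delta(K_i)=K_i\otimes K_i$,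 $\epsilon(E_i)=\epsilon(F_i)=0$, $\epsilon(K_i)=1$, $S(E_i)=-K_i^{-1}E_i$, $S(F_i)=-F_iK_i$, $S(K_i)=K_i^{-1}$. The left adjoint action is $\mathrm{ad}(x)(u)=x_{(1)}uS(x_{(2)})$. For $\beta=\sum m_i\alpha_i\in Q$, $K_\beta=\prod K_i^{m_i}$. Admissible pair: $r_i$ are the fundamental reflections, $r_i(h)=h-\alpha_i(h)h_i$, $r_i(\alpha)=\alpha-\alpha(h_i)\alpha_i$. A fixed admissible pair $(X,\tau)$ consists of $X\subseteq I$ of finite type and a permutation $\tau$ of $I$ with $\tau(X)=X$, $a_{\tau(i)\tau(j)}=a_{ij}$, such that $\tau^2=\mathrm{id}$; $h_{\tau(j)}=-w_X(h_j)$ and $\alpha_{\tau(j)}=-w_X(\alpha_j)$ for $j\in X$, where $w_X$ is the longest element of $W_X=\langle r_i:i\in X\rangle$; and $\alpha_i(\rho_X^\vee)\in\mathbb Z$ for all $i\in I\setminus X$ with $\tau(i)=i$, where $\rho_X^\vee$ is half the sum of the positive coroots of the root system generated by $X$. $\tau$ acts on $Q$ by $\tau(\alpha_i)=\alpha_{\tau(i)}$. The automorphism $\theta_q=\mathrm{Ad}(s(X,\tau))\circ T_{w_X}\circ\psi\circ\tau\circ\omega$ of $U_q(\mathfrak g')$: $\omega(E_i)=-F_i$, $\omega(F_i)=-E_i$, $\omega(K_i)=K_i^{-1}$; $\tau(E_i)=E_{\tau(i)}$, $\tau(F_i)=F_{\tau(i)}$, $\tau(K_i)=K_{\tau(i)}$;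 $\psi(E_i)=E_iK_i$, $\psi(F_i)=K_i^{-1}F_i$, $\psi(K_i)=K_i$; $T_{w_X}=T_{i_1}\cdots T_{i_k}$ for a reduced expression $w_X=r_{i_1}\cdots r_{i_k}$, $T_i$ being Lusztig's automorphism $T''_{i,1}$ ($T_i(E_i)=-F_iK_i$, $T_i(F_i)=-K_i^{-1}E_i$, $T_i(K_\beta)=K_{r_i(\beta)}$, and for $j\neq i$ $T_i(E_j)=\sum_{r+s=-a_{ij}}(-1)^rq_i^{-r}E_i^{(s)}E_jE_i^{(r)}$, $T_i(F_j)=\sum_{r+s=-a_{ij}}(-1)^rq_i^{r}F_i^{(r)}F_jF_i^{(s)}$ with $x^{(r)}=x^r/[r]_{q_i}!$); $\mathrm{Ad}(s(X,\tau))$ multiplies elements of weight $\alpha\in Q$ by $s(X,\tau)(\alpha)$, where $s(X,\tau):Q\to\mathbb K^\times$ is the group morphism with $s(X,\tau)(\alpha_j)=1$ if $j\in X$ or $\tau(j)=j$, $(\sqrt{-1})^{\alpha_j(2\rho_X^\vee)}$ if $j\notin X$ and $\tau(j)>j$, $(-\sqrt{-1})^{\alpha_j(2\rho_X^\vee)}$ if $j\notin X$ and $\tau(j)<j$. Parameters and generators: $\mathbf c=(c_i)\in(\mathbb K(q)^\times)^{I\setminus X}$ with $c_i=c_{\tau(i)}$ whenever $\tau(i)\neq i$ and $(\alpha_i,-w_X\tau(\alpha_i))=0$; $\mathbf s=(s_i)\in\mathbb K(q)^{I\setminus X}$ such that $s_i\ne0$ implies $i\in I_{ns}$ and $a_{ji}\in-2\mathbb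 N\setminus\{0\}$ for all $j\in I_{ns}\setminus\{i\}$, where $I_{ns}=\{i\in I\setminus X:\tau(i)=i,\ a_{ij}=0\ \forall j\in X\}$. For $i\in I\setminus X$, $B_i=F_i+c_i\theta_q(F_iK_i)K_i^{-1}+s_iK_i^{-1}$; for $i\in X$, $B_i=F_i$. (The quantum symmetric pair coideal subalgebra $B_{\mathbf c,\mathbf s}$ is generated by all $B_i$, by $E_i,K_i^{\pm1}$ with $i\in X$, and by $K_\beta$ with $-w_X\tau(\beta)=\beta$.) $\mathcal M_X^+$ is the subalgebra generated by $E_i$, $i\in X$. Definition of $\mathcal Z_i$: by a result of Kolb, for each $i\in I\setminus X$ there are a monomial $Z_i^+=E_{j_1}\cdots E_{j_r}$ ($j_1,\dots,j_r\in X$) and $a_i\in\mathbb K(q)$ with $T_{w_X}(E_i)=a_i\,\mathrm{ad}(Z_i^+)(E_i)$, and $v_i\in\mathbb K(q)^\times$ with $\theta_q(F_iK_i)=-v_i\,\mathrm{ad}(Z^+_{\tau(i)})(E_{\tau(i)})$. Then $\mathcal Z_i=-v_i\,\mathrm{ad}(Z^+_{\tau(i)})(K_{\tau(i)}^2)K_{\tau(i)}^{-1}K_i^{-1}$. *)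

(* Defs.v *)
From HB Require Import structures.
From mathcomp Require Import all_boot all_order all_fingroup all_algebra.
From mathcomp Require Import generic_quotient ring_quotient fraction.
From mathcomp Require Import boolp classical_sets functions cardinality fsbigop.
From mathcomp Require Import monalg.

Set Implicit Arguments.
Unset Strict Implicit.
Unset Printing Implicit Defensive.

Import GRing.Theory Num.Theory.
Local Open Scope quotient_scope.
Local Open Scope ring_scope.

Section QuotientAlgebra.
Variables (F : fieldType) (A : lalgType F) (S : A -> Prop).

Inductive ideal_span : A -> Prop :=
| ideal_span0 : ideal_span 0
| ideal_spanD x a s b : ideal_span x -> S s -> ideal_span (x + a * s * b).

Definition ideal_of : {pred A} := fun x => `[< ideal_span x >].

Lemma ideal_ofP x : reflect (ideal_span x) (x \in ideal_of).
Proof. exact: asboolP. Qed.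

Lemma ideal_spanDr x y : ideal_span x -> ideal_span y -> ideal_span (x + y).
Proof.
move=> hx; elim=> [|z a s b _ ih Ss]; first by rewrite addr0.
by rewrite addrA; apply: ideal_spanD.
Qed.

Lemma ideal_spanMl c x : ideal_span x -> ideal_span (c * x).
Proof.
elim=> [|z a s b _ ih Ss]; first by rewrite mulr0; apply: ideal_span0.
by rewrite mulrDr !mulrA; apply: ideal_spanD.
Qed.

Lemma ideal_spanMr c x : ideal_span x -> ideal_span (x * c).
Proof.
elim=> [|z a s b _ ih Ss]; first by rewrite mul0r; apply: ideal_span0.
by rewrite mulrDl -(mulrA _ b); apply: ideal_spanD.
Qed.

Lemma ideal_of_zmod_closed : zmod_closed ideal_of.
Proof.
split=> [|x y /ideal_ofP hx /ideal_ofP hy]; apply/ideal_ofP.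
  exact: ideal_span0.
by apply: ideal_spanDr => //; rewrite -mulN1r; apply: ideal_spanMl.
Qed.

HB.instance Definition _ :=
  GRing.isZmodClosed.Build A ideal_of ideal_of_zmod_closed.

Definition quot_alg of (forall (k : F) (x y : A), k *: (x * y) = x * (k *: y))
  & ~ ideal_span 1 := {ideal_quot ideal_of}.

Variable scalerAr : forall (k : F) (x y : A), k *: (x * y) = x * (k *: y).
Variable proper : ~ ideal_span 1.
Local Notation Q := (quot_alg scalerAr proper).

HB.instance Definition _ := GRing.Zmodule.on Q.
HB.instance Definition _ := EqQuotient.on Q.

Definition quot_one : Q := \pi_Q 1.
Definition quot_mul (x y : Q) : Q := \pi_Q (repr x * repr y).
Definition quot_scale (k : F) (x : Q) : Q := \pi_Q (k *: repr x).

Lemma quot_eqP (x y : A) : reflect (\pi_Q x = \pi_Q y) (x - y \in ideal_of).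
Proof. by rewrite Quotient.idealrBE; apply: eqP. Qed.

Lemma repr_piB (x : A) : ideal_span (repr (\pi_Q x) - x).
Proof. by apply/ideal_ofP/quot_eqP; rewrite reprK. Qed.

Lemma quot_piM x y : quot_mul (\pi_Q x) (\pi_Q y) = \pi_Q (x * y).
Proof.
apply/quot_eqP/ideal_ofP; set x' := repr _; set y' := repr _.
have -> : x' * y' - x * y = (x' - x) * y' + x * (y' - y).
  by rewrite mulrBl mulrBr addrA subrK.
by apply: ideal_spanDr; [apply: ideal_spanMr|apply: ideal_spanMl];
  apply: repr_piB.
Qed.

Lemma quot_piZ k x : quot_scale k (\pi_Q x) = \pi_Q (k *: x).
Proof.
apply/quot_eqP/ideal_ofP; rewrite -scalerBr -[_ - x]mul1r scalerAl.
exact/ideal_spanMl/repr_piB.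
Qed.

Lemma quot_piD x y : \pi_Q x + \pi_Q y = \pi_Q (x + y).
Proof. by rewrite raddfD. Qed.

Lemma quot_ind (P : Q -> Prop) : (forall x, P (\pi_Q x)) -> forall x, P x.
Proof. by move=> h x; rewrite -[x]reprK. Qed.

Lemma quot_mulA : associative quot_mul.
Proof.
by elim/quot_ind=> x; elim/quot_ind=> y; elim/quot_ind=> z;
  rewrite !quot_piM mulrA.
Qed.

Lemma quot_mul1 : left_id quot_one quot_mul.
Proof. by elim/quot_ind=> x; rewrite quot_piM mul1r. Qed.

Lemma quot_mulr1 : right_id quot_one quot_mul.
Proof. by elim/quot_ind=> x; rewrite quot_piM mulr1. Qed.

Lemma quot_mulDl : left_distributive quot_mul +%R.
Proof.
by elim/quot_ind=> x; elim/quot_ind=> y; elim/quot_ind=> z;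
  rewrite ?(quot_piD, quot_piM) mulrDl.
Qed.

Lemma quot_mulDr : right_distributive quot_mul +%R.
Proof.
by elim/quot_ind=> x; elim/quot_ind=> y; elim/quot_ind=> z;
  rewrite ?(quot_piD, quot_piM) mulrDr.
Qed.

Lemma quot_one_neq0 : quot_one != 0.
Proof.
rewrite -(raddf0 \pi_Q); apply/negP => /eqP/quot_eqP/ideal_ofP.
by rewrite subr0.
Qed.

HB.instance Definition _ := GRing.Zmodule_isNzRing.Build Q
  quot_mulA quot_mul1 quot_mulr1 quot_mulDl quot_mulDr quot_one_neq0.

Lemma quot_scalerA a b x :
  quot_scale a (quot_scale b x) = quot_scale (a * b) x.
Proof. by elim/quot_ind: x => x; rewrite !quot_piZ scalerA. Qed.

Lemma quot_scale1r : left_id 1 quot_scale.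
Proof. by elim/quot_ind=> x; rewrite quot_piZ scale1r. Qed.

Lemma quot_scalerDr : right_distributive quot_scale +%R.
Proof.
by move=> k; elim/quot_ind=> x; elim/quot_ind=> y;
  rewrite ?(quot_piD, quot_piZ) scalerDr.
Qed.

Lemma quot_scalerDl x : {morph quot_scale^~ x : a b / a + b}.
Proof.
by elim/quot_ind: x => x a b; rewrite ?(quot_piD, quot_piZ) scalerDl.
Qed.

HB.instance Definition _ := GRing.Zmodule_isLmodule.Build F Q
  quot_scalerA quot_scale1r quot_scalerDr quot_scalerDl.

Lemma quot_piME (x y : A) : (\pi_Q x : Q) * \pi_Q y = \pi_Q (x * y).
Proof. exact: quot_piM. Qed.

Lemma quot_piZE k (x : A) : k *: (\pi_Q x : Q) = \pi_Q (k *: x).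
Proof. exact: quot_piZ. Qed.

Lemma quot_scalerAl k (x y : Q) : k *: (x * y) = (k *: x) * y.
Proof.
elim/quot_ind: x => x; elim/quot_ind: y => y.
by rewrite !(quot_piME, quot_piZE) scalerAl.
Qed.

HB.instance Definition _ :=
  GRing.Lmodule_isLalgebra.Build F Q quot_scalerAl.

Lemma quot_scalerAr k (x y : Q) : k *: (x * y) = x * (k *: y).
Proof.
elim/quot_ind: x => x; elim/quot_ind: y => y.
by rewrite !(quot_piME, quot_piZE) scalerAr.
Qed.

HB.instance Definition _ :=
  GRing.Lalgebra_isAlgebra.Build F Q quot_scalerAr.

Definition quot_pi (x : A) : Q := \pi_Q x.

Lemma quot_pi_is_zmod_morphism : zmod_morphism quot_pi.
Proof. by move=> x y; rewrite /quot_pi raddfB. Qed.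

Lemma quot_pi_is_monoid_morphism : monoid_morphism quot_pi.
Proof. by split=> // x y; rewrite [RHS]quot_piME. Qed.

Lemma quot_pi_is_scalable : scalable quot_pi.
Proof. by move=> k x; rewrite [RHS]quot_piZE. Qed.

HB.instance Definition _ :=
  GRing.isZmodMorphism.Build A Q quot_pi quot_pi_is_zmod_morphism.
HB.instance Definition _ :=
  GRing.isMonoidMorphism.Build A Q quot_pi quot_pi_is_monoid_morphism.
HB.instance Definition _ :=
  GRing.isScalable.Build F A Q *:%R quot_pi quot_pi_is_scalable.

End QuotientAlgebra.

Lemma ideal_span_proper (F : fieldType) (A : lalgType F) (S : A -> Prop)
    (f : {rmorphism A -> F}) :
  (forall x, S x -> f x = 0) -> ~ ideal_span S 1.
Proof.
move=> fS; suff fI x : ideal_span S x -> f x = 0.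
  by move/fI/eqP; rewrite rmorph1 oner_eq0.
elim=> [|{}x a s b _ fx Ss]; first exact: rmorph0.
by rewrite rmorphD !rmorphM fx (fS _ Ss) mulr0 mul0r addr0.
Qed.

Lemma scalerAr_central (F : fieldType) (A : lalgType F) :
    (forall k (x : A), k%:A * x = x * k%:A) ->
  forall k (x y : A), k *: (x * y) = x * (k *: y).
Proof. by move=> C k x y; rewrite scalerAl -mulr_algl C -mulrA mulr_algl. Qed.

(* Free algebras are the monoid algebras of free monoids. *)

Definition free_gen (F : fieldType) (I : choiceType) (g : I) :
  {malg F[{fmonom I}]} := << fmu g >>%R.

Lemma free_alg_scalerAr (F : fieldType) (I : choiceType) (k : F)
    (x y : {malg F[{fmonom I}]}) :
  k *: (x * y) = x * (k *: y).
Proof.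
apply: scalerAr_central => {}k {}x.
rewrite -mul_malgC mulr1 !malgM_def fgmulUg fgmulgU; apply: eq_bigr => m _.
by rewrite mul1m mulm1 mulrC.
Qed.

Section FreeEval.
Variables (F : fieldType) (I : choiceType) (f : I -> F).

Definition fmonom_eval (m : {fmonom I}) : F := \prod_(g <- (m : seq I)) f g.

Lemma fmonom_eval_mmorphism : mmorphism fmonom_eval.
Proof.
split=> [m m'|]; first by rewrite /fmonom_eval fmM big_cat.
by rewrite /fmonom_eval fm1 big_nil.
Qed.

HB.instance Definition _ :=
  monalg.isMultiplicative.Build {fmonom I} F fmonom_eval fmonom_eval_mmorphism.

Definition free_eval : {rmorphism {malg F[{fmonom I}]} -> F} :=
  mmap idfun fmonom_eval.

Lemma free_eval_gen g : free_eval (free_gen F g) = f g.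
Proof.
by rewrite /free_eval /free_gen /= mmapU mul1r /fmonom_eval fmU big_seq1.
Qed.

Lemma free_evalZ k x : free_eval (k *: x) = k * free_eval x.
Proof. exact: mmapZ. Qed.

End FreeEval.

Section QInt.
Variable F : fieldType.

(* Here x stands for q_i. *)
Definition qint (x : F) (m : nat) : F := (x ^+ m - x ^- m) / (x - x^-1).
Definition qfact (x : F) (m : nat) : F := \prod_(1 <= l < m.+1) qint x l.
Definition qbinom (x : F) (N m : nat) : F :=
  qfact x N / (qfact x m * qfact x (N - m)).

(* (N)_{x^2} = (1 - x^{2N}) / (1 - x^2) *)
Definition qpar (x : F) (N : int) : F := (1 - x ^ (2 * N)) / (1 - x ^+ 2).

(* The quantum Serre polynomial F_{ij}, with N = 1 - a_{ij}. *)
Definition qserre (B : lalgType F) (x : F) (N : nat) (u v : B) : B :=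
  \sum_(l < N.+1) ((-1) ^+ l * qbinom x N l) *: (u ^+ (N - l) * v * u ^+ l).

Lemma qserre_eval0 (B : lalgType F) (f : {rmorphism B -> F})
    (fZ : forall k x, f (k *: x) = k * f x) x N u v :
  f v = 0 -> f (qserre x N u v) = 0.
Proof.
move=> v0; rewrite rmorph_sum big1 // => l _.
by rewrite fZ !rmorphM v0 mulr0 mul0r mulr0.
Qed.

Definition divpow (B : lalgType F) (x : F) (u : B) (m : nat) : B :=
  (qfact x m)^-1 *: u ^+ m.

End QInt.

Inductive gen (n : nat) :=
  GE of 'I_n | GF of 'I_n | GK of 'I_n | GKV of 'I_n.

Section GenChoice.
Variable n : nat.
Definition gen_encode (g : gen n) : ('I_n + 'I_n) + ('I_n + 'I_n) :=
  match g with
  | GE i => inl (inl i) | GF i => inl (inr i)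
  | GK i => inr (inl i) | GKV i => inr (inr i)
  end.
Definition gen_decode (s : ('I_n + 'I_n) + ('I_n + 'I_n)) : gen n :=
  match s with
  | inl (inl i) => GE i | inl (inr i) => GF i
  | inr (inl i) => GK i | inr (inr i) => GKV i
  end.
Lemma gen_encodeK : cancel gen_encode gen_decode.
Proof. by case. Qed.
HB.instance Definition _ := Choice.copy (gen n) (can_type gen_encodeK).
End GenChoice.

Section QuantumGroup.
Variables (F : fieldType) (q : F) (n : nat).
Variables (A : 'M[int]_n) (eps : 'I_n -> nat).

Definition qi (i : 'I_n) : F := q ^+ eps i.

(* Each element r of [Uq_rel x] stands for the relation r = 0 between the     *)
(* elements x of an algebra B indexed by the generators.                      *)
Inductive Uq_rel (B : lalgType F) (x : gen n -> B) : B -> Prop :=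
| rel_KKV i : Uq_rel x (x (GK i) * x (GKV i) - 1)
| rel_KVK i : Uq_rel x (x (GKV i) * x (GK i) - 1)
| rel_KK i j : Uq_rel x (x (GK i) * x (GK j) - x (GK j) * x (GK i))
| rel_KE i j :
    Uq_rel x (x (GK i) * x (GE j) - qi i ^ A i j *: (x (GE j) * x (GK i)))
| rel_KF i j :
    Uq_rel x (x (GK i) * x (GF j) - qi i ^ (- A i j) *: (x (GF j) * x (GK i)))
| rel_EF i j :
    Uq_rel x (x (GE i) * x (GF j) - x (GF j) * x (GE i)
              - ((i == j)%:R / (qi i - (qi i)^-1)) *: (x (GK i) - x (GKV i)))
| rel_SerreE i j of i != j :
    Uq_rel x (qserre (qi i) `|1 - A i j|%N (x (GE i)) (x (GE j)))
| rel_SerreF i j of i != j :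
    Uq_rel x (qserre (qi i) `|1 - A i j|%N (x (GF i)) (x (GF j))).

Definition counit_gen (g : gen n) : F :=
  match g with GE _ | GF _ => 0 | GK _ | GKV _ => 1 end.

Lemma Uq_rel_counit (B : lalgType F) (x : gen n -> B) (f : {rmorphism B -> F}) :
    (forall k u, f (k *: u) = k * f u) -> (forall g, f (x g) = counit_gen g) ->
  forall r, Uq_rel x r -> f r = 0.
Proof.
move=> fZ fx r; case=> [i|i|i j|i j|i j|i j|i j _|i j _].
- by rewrite rmorphB rmorphM rmorph1 !fx mulr1 subrr.
- by rewrite rmorphB rmorphM rmorph1 !fx mulr1 subrr.
- by rewrite rmorphB !rmorphM !fx subrr.
- by rewrite rmorphB rmorphM fZ rmorphM !fx mulr0 mul0r mulr0 subrr.
- by rewrite rmorphB rmorphM fZ rmorphM !fx mulr0 mul0r mulr0 subrr.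
- by rewrite !rmorphB !rmorphM fZ rmorphB !fx mulr0 !subrr mulr0 subrr.
- by apply: (qserre_eval0 fZ); rewrite fx.
- by apply: (qserre_eval0 fZ); rewrite fx.
Qed.

Lemma Uq_proper : ~ ideal_span (Uq_rel (@free_gen F (gen n))) 1.
Proof.
apply: (@ideal_span_proper _ _ _ (free_eval counit_gen)).
by apply: Uq_rel_counit; [apply: free_evalZ|apply: free_eval_gen].
Qed.

End QuantumGroup.

(* U_q(g') with the images of its generators, locked to keep unification from *)
(* unfolding the quotient.                                                    *)
HB.lock Definition Uq_presentation (F : fieldType) (q : F) (n : nat)
    (A : 'M[int]_n) (eps : 'I_n -> nat) : {B : algType F & gen n -> B} :=
  existT (fun B : algType F => gen n -> B)
    (quot_alg (@free_alg_scalerAr F (gen n)) (@Uq_proper F q n A eps))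
    (fun g => quot_pi (@free_alg_scalerAr F (gen n)) (@Uq_proper F q n A eps)
                (free_gen F g)).

Definition Uq (F : fieldType) (q : F) (n : nat) (A : 'M[int]_n)
    (eps : 'I_n -> nat) : algType F :=
  projT1 (Uq_presentation q A eps).

Definition Ugen (F : fieldType) (q : F) (n : nat) (A : 'M[int]_n)
    (eps : 'I_n -> nat) : gen n -> Uq q A eps :=
  projT2 (Uq_presentation q A eps).

Lemma Uq_rel_preim (F : fieldType) (q : F) (n : nat) (A : 'M[int]_n)
    (eps : 'I_n -> nat) (B C : lalgType F) (f : {rmorphism B -> C})
    (fZ : forall k u, f (k *: u) = k *: f u) (x : gen n -> B) (r : C) :
  Uq_rel q A eps (f \o x) r -> exists2 r', Uq_rel q A eps x r' & r = f r'.
Proof.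
have fs y N u v : f (qserre y N u v) = qserre y N (f u) (f v).
  rewrite /qserre rmorph_sum; apply: eq_bigr => l _.
  by rewrite fZ !rmorphM !rmorphXn.
case=> [i|i|i j|i j|i j|i j|i j ij|i j ij].
- by eexists; [apply: (rel_KKV _ _ _ _ i)|rewrite rmorphB rmorphM rmorph1].
- by eexists; [apply: (rel_KVK _ _ _ _ i)|rewrite rmorphB rmorphM rmorph1].
- by eexists; [apply: (rel_KK _ _ _ _ i j)|rewrite rmorphB !rmorphM].
- by eexists; [apply: (rel_KE _ _ _ _ i j)|rewrite rmorphB fZ !rmorphM].
- by eexists; [apply: (rel_KF _ _ _ _ i j)|rewrite rmorphB fZ !rmorphM].
- by eexists; [apply: (rel_EF _ _ _ _ i j)
              |rewrite !rmorphB fZ !rmorphM rmorphB].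
- by eexists; [apply: (rel_SerreE _ _ _ _ ij)|rewrite fs].
- by eexists; [apply: (rel_SerreF _ _ _ _ ij)|rewrite fs].
Qed.

Lemma quot_pi_ideal0 (F : fieldType) (A : lalgType F) (S : A -> Prop)
    scA prS (r : A) : S r -> @quot_pi F A S scA prS r = 0.
Proof.
move=> Sr; rewrite -(rmorph0 (quot_pi scA prS)).
apply/quot_eqP/ideal_ofP; rewrite subr0.
by have := ideal_spanD 1 1 (ideal_span0 S) Sr; rewrite add0r mul1r mulr1.
Qed.

Lemma Uq_relations (F : fieldType) (q : F) (n : nat) (A : 'M[int]_n)
    (eps : 'I_n -> nat) (r : Uq q A eps) :
  Uq_rel q A eps (@Ugen F q n A eps) r -> r = 0.
Proof.
move: r; rewrite /Ugen /Uq Uq_presentation.unlock => r /= h.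
have [|r' rel_r' ->] := Uq_rel_preim
    (f := quot_pi (@free_alg_scalerAr F (gen n)) (@Uq_proper F q n A eps))
    _ h; first exact: quot_pi_is_scalable.
exact: quot_pi_ideal0.
Qed.

(* Root data of g(A): 'rV[int]_n stands for the root lattice (basis alpha_i)  *)
(* and for the coroot lattice (basis h_i), with alpha_j(h_i) = A i j.         *)

Section RootData.
Variables (n : nat) (A : 'M[int]_n) (eps : 'I_n -> nat).
Local Notation Q := 'rV[int]_n.

Record symmetrizable_GCM : Prop := {
  gcm_diag : forall i, A i i = 2;
  gcm_offdiag : forall i j, i != j -> A i j <= 0;
  gcm_zero : forall i j, A i j = 0 <-> A j i = 0;
  gcm_indecomposable : forall J : {set 'I_n}, J != finset.set0 ->
    J != finset.setT -> exists i j, [/\ i \in J, j \notin J & A i j != 0];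
  gcm_eps_gt0 : forall i, (0 < eps i)%N;
  gcm_eps_coprime : \big[gcdn/0%N]_i eps i = 1%N;
  gcm_sym : forall i j, (eps i)%:Z * A i j = (eps j)%:Z * A j i
}.

Definition simple (i : 'I_n) : Q := delta_mx 0 i.

(* the value of the root lattice element beta at the coroot lattice element h *)
Definition pairing (h beta : Q) : int :=
  \sum_i \sum_j h 0 i * beta 0 j * A i j.

Definition refl (i : 'I_n) (beta : Q) : Q :=
  beta - pairing (simple i) beta *: simple i.
Definition corefl (i : 'I_n) (h : Q) : Q :=
  h - pairing h (simple i) *: simple i.

(* (beta, gamma), determined by (alpha_i, alpha_j) = eps_i a_{ij} *)
Definition root_form (beta gamma : Q) : int :=
  \sum_i \sum_j beta 0 i * gamma 0 j * ((eps i)%:Z * A i j).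

(* A word [:: i_1; ...; i_k] stands for the product r_{i_1} ... r_{i_k}. *)
Definition wact (w : seq 'I_n) (beta : Q) : Q := foldr refl beta w.
Definition wcoact (w : seq 'I_n) (h : Q) : Q := foldr corefl h w.

Variable X : {set 'I_n}.

Definition word_in (w : seq 'I_n) : Prop := {subset w <= X}.

Definition weyl : set (Q -> Q) :=
  [set f | exists2 w, word_in w & f = wact w]%classic.

Definition finite_type : Prop := finite_set weyl.

Definition reduced_word (w : seq 'I_n) : Prop :=
  word_in w /\
  forall w', word_in w' -> wact w' = wact w -> (size w <= size w')%N.

(* w is a reduced expression of the longest element of W_X *)
Definition longest_word (w : seq 'I_n) : Prop :=
  reduced_word w /\ forall w', reduced_word w' -> (size w' <= size w)%N.

Definition pos_coroot : set Q :=
  [set h | (exists w j, [/\ word_in w, j \in X & h = wcoact w (simple j)])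
           /\ forall k, 0 <= h 0 k]%classic.

(* 2 rho_X^vee *)
Definition two_rho : Q := \sum_(h \in pos_coroot) h.

Variables (tau : 'S_n) (w : seq 'I_n).

Definition tau_root (beta : Q) : Q := \sum_j beta 0 j *: simple (tau j).

(* (X, tau) is an admissible pair; w is an expression of w_X. *)
Record admissible_pair : Prop := {
  adm_finite : finite_type;
  adm_stable : [set tau x | x in X]%SET = X;
  adm_diagram : forall i j, A (tau i) (tau j) = A i j;
  adm_invol : forall i, tau (tau i) = i;
  adm_coroot : forall j, j \in X -> simple (tau j) = - wcoact w (simple j);
  adm_root : forall j, j \in X -> simple (tau j) = - wact w (simple j);
  adm_rho : forall i, i \notin X -> tau i = i ->
    exists z : int, pairing two_rho (simple i) = 2 * z
}.

Definition I_ns : {set 'I_n} :=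
  [set i | [&& i \notin X, tau i == i & [forall j in X, A i j == 0]]]%SET.

End RootData.

Definition q_indet (K : fieldType) : {fraction {poly K}} := tofrac 'X.

Definition ratfun_const (K : fieldType) : {rmorphism K -> {fraction {poly K}}} :=
  @tofrac {poly K} \o polyC.

Section Automorphisms.
Variables (K F : fieldType) (cst : {rmorphism K -> F}) (q : F) (n : nat).
Variables (A : 'M[int]_n) (eps : 'I_n -> nat).
Local Notation U := (Uq q A eps).
Local Notation qi := (qi q eps).

Definition UE i : U := Ugen q A eps (GE i).
Definition UF i : U := Ugen q A eps (GF i).
Definition UK i : U := Ugen q A eps (GK i).
Definition UKV i : U := Ugen q A eps (GKV i).

(* K_i^m for an integer m *)
Definition UKpow i (m : int) : U :=
  match m with Posz k => UK i ^+ k | Negz k => UKV i ^+ k.+1 end.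
Definition UKroot (beta : 'rV[int]_n) : U := \prod_i UKpow i (beta 0 i).

(* f is the automorphism of U_q(g') with the given values on E_i, F_i, K_i. *)
Definition auto_on_gens (f : {lrmorphism U -> U}) (e d k : 'I_n -> U) : Prop :=
  bijective f /\ forall i, [/\ f (UE i) = e i, f (UF i) = d i & f (UK i) = k i].

Definition is_omega (f : {lrmorphism U -> U}) : Prop :=
  auto_on_gens f (fun i => - UF i) (fun i => - UE i) UKV.

Definition is_psi (f : {lrmorphism U -> U}) : Prop :=
  auto_on_gens f (fun i => UE i * UK i) (fun i => UKV i * UF i) UK.

Definition is_diagram_auto (tau : 'S_n) (f : {lrmorphism U -> U}) : Prop :=
  auto_on_gens f (fun i => UE (tau i)) (fun i => UF (tau i))
    (fun i => UK (tau i)).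

(* Lusztig's automorphism T_i = T''_{i,1} *)
Definition is_lusztig (i : 'I_n) (f : {lrmorphism U -> U}) : Prop :=
  auto_on_gens f
    (fun j => if j == i then - (UF i * UK i) else
       \sum_(r < `|A i j|.+1) ((-1) ^+ r * qi i ^- r) *:
         (divpow (qi i) (UE i) (`|A i j| - r) * UE j * divpow (qi i) (UE i) r))
    (fun j => if j == i then - (UKV i * UE i) else
       \sum_(r < `|A i j|.+1) ((-1) ^+ r * qi i ^+ r) *:
         (divpow (qi i) (UF i) r * UF j * divpow (qi i) (UF i) (`|A i j| - r)))
    (fun j => UKroot (refl A i (simple j))).

(* T_{i_1} ... T_{i_k} for the word w *)
Definition T_word (T : 'I_n -> {lrmorphism U -> U}) (w : seq 'I_n) (u : U) : U :=
  foldr (fun i => T i) u w.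

(* s(X,tau) : Q -> K^x; sqrtm1 is the chosen square root of -1. *)
Definition s_simple (X : {set 'I_n}) (tau : 'S_n) (sqrtm1 : K) (j : 'I_n) : K :=
  if (j \in X) || (tau j == j) then 1
  else (if (j < tau j)%N then sqrtm1 else - sqrtm1)
         ^ pairing A (two_rho A X) (simple j).

Definition s_root X tau sqrtm1 (beta : 'rV[int]_n) : K :=
  \prod_j s_simple X tau sqrtm1 j ^ beta 0 j.

(* Ad(s(X,tau)): E_i, F_i, K_i have weights alpha_i, -alpha_i, 0. *)
Definition is_Ad_s X tau sqrtm1 (f : {lrmorphism U -> U}) : Prop :=
  auto_on_gens f
    (fun i => cst (s_root X tau sqrtm1 (simple i)) *: UE i)
    (fun i => cst (s_root X tau sqrtm1 (- simple i)) *: UF i)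
    (fun i => cst (s_root X tau sqrtm1 0) *: UK i).

(* theta_q = Ad(s(X,tau)) o T_{w_X} o psi o tau o omega *)
Definition theta_q (Ad_s : U -> U) (T : 'I_n -> {lrmorphism U -> U})
    (w : seq 'I_n) (psi tauU omega : U -> U) : U -> U :=
  fun u => Ad_s (T_word T w (psi (tauU (omega u)))).

(* The Hopf structure on words in the generators: [coproduct w] lists the     *)
(* pairs (x_(1), x_(2)) whose tensors sum to Delta(w).                        *)
Definition word (w : seq (gen n)) : U := \prod_(g <- w) Ugen q A eps g.

Definition coproduct_gen (g : gen n) : seq (seq (gen n) * seq (gen n)) :=
  match g with
  | GE i => [:: ([:: GE i], [::]); ([:: GK i], [:: GE i])]
  | GF i => [:: ([:: GF i], [:: GKV i]); ([::], [:: GF i])]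
  | GK i => [:: ([:: GK i], [:: GK i])]
  | GKV i => [:: ([:: GKV i], [:: GKV i])]
  end.

Fixpoint coproduct (w : seq (gen n)) : seq (seq (gen n) * seq (gen n)) :=
  if w is g :: w' then
    [seq (p.1 ++ p'.1, p.2 ++ p'.2) | p <- coproduct_gen g, p' <- coproduct w']
  else [:: ([::], [::])].

Definition antipode_gen (g : gen n) : U :=
  match g with
  | GE i => - (UKV i * UE i)
  | GF i => - (UF i * UK i)
  | GK i => UKV i
  | GKV i => UK i
  end.

Definition antipode (w : seq (gen n)) : U :=
  \prod_(g <- rev w) antipode_gen g.

(* ad(x)(u) = x_(1) u S(x_(2)) for the word x *)
Definition ad (x : seq (gen n)) (u : U) : U :=
  \sum_(p <- coproduct x) word p.1 * u * antipode p.2.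

(* The data supplied by Kolb's result: Zp i is the index sequence of Z_i^+.   *)
Record kolb_data (X : {set 'I_n}) (tau : 'S_n) (Tw theta : U -> U)
    (Zp : 'I_n -> seq 'I_n) (a v : 'I_n -> F) : Prop := {
  kolb_in : forall i, i \notin X -> {subset Zp i <= X};
  kolb_T : forall i, i \notin X ->
    Tw (UE i) = a i *: ad (map (@GE n) (Zp i)) (UE i);
  kolb_v_neq0 : forall i, i \notin X -> v i != 0;
  kolb_theta : forall i, i \notin X ->
    theta (UF i * UK i) = - (v i *: ad (map (@GE n) (Zp (tau i))) (UE (tau i)))
}.

Definition calZ (tau : 'S_n) (Zp : 'I_n -> seq 'I_n) (v : 'I_n -> F)
    (i : 'I_n) : U :=
  - (v i *: (ad (map (@GE n) (Zp (tau i))) (UK (tau i) ^+ 2)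
              * UKV (tau i) * UKV i)).

(* The entries of c and s at indices in X are irrelevant. *)
Record qsp_parameters (X : {set 'I_n}) (tau : 'S_n) (w : seq 'I_n)
    (c s : 'I_n -> F) : Prop := {
  par_c_neq0 : forall i, i \notin X -> c i != 0;
  par_c_tau : forall i, i \notin X -> tau i != i ->
    root_form A eps (simple i) (- wact A w (tau_root tau (simple i))) = 0 ->
    c i = c (tau i);
  par_s : forall i, i \notin X -> s i != 0 ->
    i \in I_ns A X tau /\
    forall j, j \in I_ns A X tau -> j != i ->
      exists k : nat, A j i = - (2 * k.+1%:Z)
}.

Definition Bgen (X : {set 'I_n}) (theta : U -> U) (c s : 'I_n -> F)
    (i : 'I_n) : U :=
  if i \in X then UF i
  else UF i + c i *: (theta (UF i * UK i) * UKV i) + s i *: UKV i.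

End Automorphisms.

(* Binary tuples are indexed from 1. *)

Definition bit (l : seq bool) (r : nat) : nat := nth false l r.-1.

(* |l|_{r;s} *)
Definition bsum (l : seq bool) (r s : nat) : nat :=
  \sum_(r <= t < s.+1) bit l t.

(* zeta^{(r)}_{l,s} *)
Definition zeta (l s : seq bool) (r : nat) : int :=
  2 * (bsum s 1 (r - bsum l 1 r))%:Z + (bsum l 1 r)%:Z - r%:Z.

Section Rho.
Variables (F : fieldType) (qi ci : F) (a : int).

(* N = 1 - a *)
Local Notation N := `|1 - a|%N.

Definition in_L (m m' k : nat) (l : seq bool) : bool :=
  (bsum l 1 (N - k) == m) && (bsum l (N.+1 - k) N == m').

(* The conditions |s| = p/2 and |s|_{1;p} >= p/2 are stated doubled. *)
Definition in_S (m m' : nat) (s : seq bool) : bool :=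
  (2 * bsum s 1 (N - m - m') == N - m - m')%N &&
  all (fun p => p <= 2 * bsum s 1 p)%N (iota 1 (N - m - m')).

Definition theta_exp (l s : seq bool) (k : nat) : int :=
  - a * zeta l s (N - k) - 2 * \sum_(1 <= r < N.+1) zeta l s r.-1.

(* The halved exponent is exact whenever the parity factor is nonzero. *)
Definition rho (m m' : nat) : F :=
  ((a + m%:Z + m'%:Z) %% 2)%Z%:~R
  * (ci * qi ^+ 2 / (qi - qi^-1)) ^+ (N - m - m')./2
  * \sum_(m' <= k < (N - m).+1)
      \sum_(l : N.-tuple bool | in_L m m' k l)
        \sum_(s : (N - m - m').-tuple bool | in_S m m' s)
          (-1) ^+ k.+1 * qbinom qi N k * qi ^ theta_exp l s k
          * \prod_(1 <= r < N.+1)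
              qpar qi (zeta l s r.-1 + 1)
                ^+ ((1 - bit l r) * bit s (r - bsum l 1 r)).

End Rho.

(* Main.v *)
(** Write B_i = F_i + Y_i + s_i K_i^-1 with Y_i = c_i theta_q(F_i K_i) K_i^-1,
    N = 1 - a and u = q_i^2. Left and right multiplication by B_i commute, and
    with them F_ij(B_i, V) minus the right-hand side becomes P(L, R) V for a
    polynomial P with coefficients in K(q)[calZ_i]. Reading the sums over l and s as sums
    over Motzkin paths identifies P with the N-th Al-Salam-Chihara polynomial,
    given by a three-term recurrence that breaks off at N; consequently P is
    symmetric up to sign. Both sides are linear in B_j, so it remains to show
    P(L, R) V = 0 for V = F_j, Y_j and (if s_j <> 0) K_j^-1.

    One has Y_i F_i - u F_i Y_i = (c_i u / (q_i - q_i^-1)) calZ_i + kappa K_i^-2,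
    where calZ_i commutes with F_i, F_j, Y_i, Y_j, and kappa = 0 unless Z_i^+ = 1.
    With it the recurrence turns P_m(L, R) F_j into the iterated q-commutators of
    F_i with F_j, and P_N(L, R) F_j = 0 is the Serre relation of F_i and F_j. For
    V = Y_j the same argument runs in the opposite algebra, the Serre relation of
    Y_i and Y_j being the image under T_(w_X) of that of E_i and E_tau(j). For
    V = K_j^-1 the Serre relation of F_i with V is trivial if kappa = 0; otherwise
    i and j lie in I_ns, a is even, and one factors P and uses a Casimir element.

    The commutation of calZ_i with Y_j amounts to ad(E_k)(T_(w_X)(E_i)) = 0 for k
    in X. This follows from the W_X-invariance of the weights of the integrable
    module ad(U_q(X)^+)(E_i), and T_(w_X)(E_i) having an extremal weight in it. *)

Require Import Defs.
From HB Require Import structures.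
From mathcomp Require Import all_boot all_order all_fingroup all_algebra.
From mathcomp Require Import fraction.
From mathcomp Require Import boolp functions cardinality.
From mathcomp Require Import monalg.
From mathcomp Require Import ring zify.

Set Implicit Arguments.
Unset Strict Implicit.
Unset Printing Implicit Defensive.

Import GRing.Theory Num.Theory.
Local Open Scope ring_scope.

(** * Linear endomorphisms *)

(** The tuples encode a path: [l_r = 1] is a level step, [l_r = 0] a step up or down read off from
    [s], and [zeta^(r)] is the height after r steps. The first N - k steps carry L, the last k carry
    R, and the exponent -a zeta^(N-k) is a diagonal twist at the junction. Hence the binomial sum
    over k is an N-fold twisted commutator of this diagonal operator with the transfer operators for
    L and R. Its normal form has no down-steps, so its value at height 0 is one coefficient, which
    satisfies the recurrence. With t = q_i^a the recurrence contains 1 - t^2 u^n, which vanishes at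
    n = -a; this is why it breaks off. On the algebra side Y_i lowers the ladder of q-commutators of
    F_i with the same coefficients. Two obstacles shape the rest. The K_k see a weight only through
    its values on coroots, so for singular A weights are identified only when their difference is
    supported on X, where finiteness of W_X makes the pairing nondegenerate. And T_(w_X)(E_i) has to
    be nonzero, which rests on E_i <> 0 and is shown by an explicit module. *)

Section LinearEndomorphisms.
Variables (F : fieldType) (W : lmodType F) (w0 : W).

(** The witness [w0_neq0] is a parameter of the type because the ring structure demands 1 <> 0. *)
Record lend (w0_neq0 : w0 != 0) := Lend {
  lend_app :> W -> W;
  lend_linear : linear lend_app
}.

Variable w0_neq0 : w0 != 0.
Local Notation E := (lend w0_neq0).
Implicit Types f g h : E.

HB.instance Definition _ := gen_eqMixin E.
HB.instance Definition _ := gen_choiceMixin E.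

Lemma lendP f g : f =1 g -> f = g.
Proof.
case: f g => f hf [g hg] /= /funext fg; rewrite fg in hf *.
by congr Lend; apply: Prop_irrelevance.
Qed.

Lemma lendD f : {morph f : x y / x + y}.
Proof. by move=> x y; rewrite -[x in LHS]scale1r lend_linear scale1r. Qed.

Lemma lend0 f : f 0 = 0.
Proof. by apply: (addrI (f 0)); rewrite -lendD !addr0. Qed.

Lemma lendZ f c : {morph f : x / c *: x}.
Proof. by move=> x; rewrite -[c *: x in LHS]addr0 lend_linear lend0 addr0. Qed.

Fact lend_zero_linear : linear (fun _ : W => 0 : W).
Proof. by move=> c x y; rewrite scaler0 addr0. Qed.

Fact lend_add_linear f g : linear (fun x => f x + g x).
Proof. by move=> c x y; rewrite !lend_linear scalerDr addrACA. Qed.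

Fact lend_opp_linear f : linear (fun x => - f x).
Proof. by move=> c x y; rewrite lend_linear scalerN opprD. Qed.

Fact lend_id_linear : linear (fun x : W => x).
Proof. by []. Qed.

Fact lend_comp_linear f g : linear (fun x => f (g x)).
Proof. by move=> c x y; rewrite !lend_linear. Qed.

Fact lend_scale_linear a f : linear (fun x => a *: f x).
Proof.
by move=> c x y; rewrite lend_linear scalerDr !scalerA mulrC.
Qed.

Definition lend_add f g : E := Lend _ (lend_add_linear f g).
Definition lend_opp f : E := Lend _ (lend_opp_linear f).
Definition lend_zero : E := Lend _ lend_zero_linear.
Definition lend_one : E := Lend _ lend_id_linear.
Definition lend_comp f g : E := Lend _ (lend_comp_linear f g).
Definition lend_scale a f : E := Lend _ (lend_scale_linear a f).

Fact lend_addA : associative lend_add.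
Proof. by move=> f g h; apply: lendP => x; apply: addrA. Qed.
Fact lend_addC : commutative lend_add.
Proof. by move=> f g; apply: lendP => x; apply: addrC. Qed.
Fact lend_add0 : left_id lend_zero lend_add.
Proof. by move=> f; apply: lendP => x; apply: add0r. Qed.
Fact lend_addN : left_inverse lend_zero lend_opp lend_add.
Proof. by move=> f; apply: lendP => x; apply: addNr. Qed.

HB.instance Definition _ :=
  GRing.isZmodule.Build E lend_addA lend_addC lend_add0 lend_addN.

Fact lend_compA : associative lend_comp.
Proof. by move=> f g h; apply: lendP. Qed.
Fact lend_comp1 : left_id lend_one lend_comp.
Proof. by move=> f; apply: lendP. Qed.
Fact lend_compr1 : right_id lend_one lend_comp.
Proof. by move=> f; apply: lendP. Qed.
Fact lend_compDl : left_distributive lend_comp +%R.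
Proof. by move=> f g h; apply: lendP. Qed.
Fact lend_compDr : right_distributive lend_comp +%R.
Proof. by move=> f g h; apply: lendP => x; apply: lendD. Qed.
Fact lend_one_neq0 : lend_one != 0.
Proof.
by apply/negP => /eqP/(congr1 (fun f : E => f w0))/eqP; apply/negP.
Qed.

HB.instance Definition _ := GRing.Zmodule_isNzRing.Build E
  lend_compA lend_comp1 lend_compr1 lend_compDl lend_compDr lend_one_neq0.

Fact lend_scaleA a b f : lend_scale a (lend_scale b f) = lend_scale (a * b) f.
Proof. by apply: lendP => x; apply: scalerA. Qed.
Fact lend_scale1 : left_id 1 lend_scale.
Proof. by move=> f; apply: lendP => x; apply: scale1r. Qed.
Fact lend_scaleDr : right_distributive lend_scale +%R.
Proof. by move=> a f g; apply: lendP => x; apply: scalerDr. Qed.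
Fact lend_scaleDl f : {morph lend_scale^~ f : a b / a + b}.
Proof. by move=> a b; apply: lendP => x; apply: scalerDl. Qed.

HB.instance Definition _ := GRing.Zmodule_isLmodule.Build F E
  lend_scaleA lend_scale1 lend_scaleDr lend_scaleDl.

Fact lend_scaleAl a f g : a *: (f * g) = (a *: f) * g.
Proof. by apply: lendP. Qed.

HB.instance Definition _ := GRing.Lmodule_isLalgebra.Build F E lend_scaleAl.

Fact lend_scaleAr a f g : a *: (f * g) = f * (a *: g).
Proof. by apply: lendP => x; rewrite [RHS]lendZ. Qed.

HB.instance Definition _ := GRing.Lalgebra_isAlgebra.Build F E lend_scaleAr.

Lemma lend_appM f g x : (f * g) x = f (g x). Proof. by []. Qed.
Lemma lend_appD f g x : (f + g) x = f x + g x. Proof. by []. Qed.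
Lemma lend_appN f x : (- f) x = - f x. Proof. by []. Qed.
Lemma lend_appZ a f x : (a *: f) x = a *: f x. Proof. by []. Qed.
Lemma lend_app1 x : (1 : E) x = x. Proof. by []. Qed.

Lemma lend_app_sum I (r : seq I) (P : pred I) (f : I -> E) x :
  (\sum_(i <- r | P i) f i) x = \sum_(i <- r | P i) f i x.
Proof. exact: (big_morph (fun f : E => f x) (fun _ _ => erefl) erefl). Qed.

End LinearEndomorphisms.


(** * Gaussian binomials and quantum integers *)

Section GaussianBinomials.
Variables (R : comNzRingType) (q q' : R).
Hypothesis qK : q * q' = 1.

Lemma exprVK k : q ^+ k * q' ^+ k = 1.
Proof. by rewrite -exprMn qK expr1n. Qed.

(* The balanced Gaussian binomials, as a Pascal triangle vanishing for l > n. *)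
Fixpoint gauss (n l : nat) : R :=
  match n, l with
  | _, 0 => 1
  | 0, _.+1 => 0
  | n'.+1, l'.+1 => q' ^+ l * gauss n' l + q ^+ (n' - l') * gauss n' l'
  end.

Lemma gauss0 n : gauss n 0 = 1. Proof. by case: n. Qed.

Lemma gaussS n l :
  gauss n.+1 l.+1 = q' ^+ l.+1 * gauss n l.+1 + q ^+ (n - l) * gauss n l.
Proof. by []. Qed.

Lemma gauss_small n l : (n < l)%N -> gauss n l = 0.
Proof.
elim: n l => [|n IHn] [|l] //; rewrite ltnS => nl.
by rewrite gaussS !IHn ?mulr0 ?addr0 // ltnW.
Qed.

Variables (W : lmodType R) (t : R).

(* For X i j = L^i (R^j v) with commuting L and R, this is the array of the   *)
(* L^i (R^j (prod_(r < n) (L - t q^(2r) R) v)).                               *)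
Fixpoint ladder (X : nat -> nat -> W) (n i j : nat) : W :=
  if n is n'.+1 then
    ladder X n' i.+1 j - (t * q ^+ (2 * n')) *: ladder X n' i j.+1
  else X i j.

(** The q-binomial theorem for commuting L and R; [t * q' * q ^+ n] is t q^(n-1). For t = q^(1-n)
    these powers are 1 and the sum is the quantum Serre polynomial, which thereby splits into linear
    factors. *)
Lemma ladderE X n i j :
  ladder X n i j =
  \sum_(l < n.+1) ((-1) ^+ l * gauss n l * (t * q' * q ^+ n) ^+ l) *:
     X (i + (n - l))%N (j + l)%N.
Proof.
elim: n i j => [|n IHn] i j.
  by rewrite big_ord1 /= !expr0 !mulr1 scale1r !addn0.
pose s m : R := t * q' * q ^+ m; rewrite -/(s _).
have sS : s n.+1 = t * q ^+ n.
  by rewrite /s exprS mulrA -[t * q' * q]mulrA [q' * q]mulrC qK mulr1.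
have s1 : s n.+1 = s n * q by rewrite /s exprSr mulrA.
have sV l : s n.+1 ^+ l * q' ^+ l = s n ^+ l.
  by rewrite s1 exprMn -mulrA exprVK mulr1.
rewrite [LHS]/= !IHn big_ord_recl [RHS]big_ord_recl.
rewrite !gauss0 !expr0 !mulr1 !scale1r !subn0 addSnnS -addrA; congr (_ + _).
(* Matches the second term of the Pascal rule with the new factor t q^(2n). *)
have step l : (l <= n)%N ->
    s n.+1 ^+ l.+1 * q ^+ (n - l) = t * q ^+ (2 * n) * s n ^+ l.
  move=> ln; rewrite exprSr {1}s1 exprMn sS mulnC exprM expr2.
  by rewrite -{4}(subnK ln) exprD; ring.
rewrite [RHS]big_ord_recr [in X in _ - X]big_ord_recr [RHS]/= [in X in _ - X]/=.
rewrite scalerDr opprD addrA; congr (_ + _).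
- rewrite scaler_sumr -sumrB; apply: eq_bigr => l _.
  have ln : (l < n)%N by [].
  rewrite (_ : (i.+1 + (n - bump 0 l) = i + (n.+1 - l.+1)))%N; last first.
    by rewrite /bump; lia.
  rewrite (_ : bump 0 l = l.+1)%N //.
  rewrite (_ : (i + (n - l) = i + (n.+1 - l.+1)))%N; last lia.
  rewrite addSnnS scalerA -scalerBl; congr (_ *: _).
  rewrite -/(gauss n.+1 l.+1) gaussS mulrDr mulrDl.
  rewrite mulrACA -mulrA -(sV l.+1) mulrA; congr (_ + _); first ring.
  transitivity ((-1) ^+ l.+1 * gauss n l * (s n.+1 ^+ l.+1 * q ^+ (n - l))).
    by rewrite step 1?ltnW // exprS; ring.
  by ring.
- rewrite scalerA -scaleNr add0n (_ : bump 0 n = n.+1)%N //.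
  rewrite !subnn addSnnS; congr (_ *: _).
  rewrite (@gauss_small n n.+1) // mulr0 add0r -/(s n).
  transitivity ((-1) ^+ n.+1 * gauss n n * (s n.+1 ^+ n.+1 * q ^+ (n - n))).
    by rewrite step // exprS; ring.
  by rewrite subnn expr0; ring.
Qed.
End GaussianBinomials.

Section QuantumIntegers.
Variables (F : fieldType) (q : F).
Hypothesis q_neq0 : q != 0.
Hypothesis q_nroot : forall n, (0 < n)%N -> q ^+ n != 1.

Lemma qB_neq0 : q - q^-1 != 0.
Proof.
apply: contraNneq (@q_nroot 2 isT) => /eqP.
by rewrite subr_eq0 => /eqP h; rewrite expr2 {2}h divff.
Qed.

Lemma qint_neq0 n : (0 < n)%N -> qint q n != 0.
Proof.
move=> n0; rewrite mulf_neq0 ?invr_eq0 ?qB_neq0 // subr_eq0.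
apply: contraNneq (@q_nroot (n + n) _) => [h|]; last by rewrite addn_gt0 n0.
by rewrite exprD {2}h divff // expf_neq0.
Qed.

Lemma qfactS n : qfact q n.+1 = qfact q n * qint q n.+1.
Proof. by rewrite /qfact big_nat_recr. Qed.

Lemma qfact0 : qfact q 0 = 1.
Proof. by rewrite /qfact big_geq. Qed.

Lemma qfact_neq0 n : qfact q n != 0.
Proof.
elim: n => [|n IHn]; first by rewrite qfact0 oner_neq0.
by rewrite qfactS mulf_neq0 // qint_neq0.
Qed.

Lemma qintD m n : qint q (m + n) = q ^+ m * qint q n + q ^- n * qint q m.
Proof.
rewrite /qint !exprD invfM; have := qB_neq0; set d := q - _ => d0.
by have := expf_neq0 m q_neq0; have := expf_neq0 n q_neq0 => a b; field; rewrite d0 a b.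
Qed.

(** The factorial quotient obeys the Pascal rule by [qintD]. The recursive form makes sense over
    commutative rings and is preserved by ring morphisms. *)
Lemma qbinom_gauss n l : (l <= n)%N -> qbinom q n l = gauss q q^-1 n l.
Proof.
elim: n l => [|n IHn] [|l] //.
- by move=> _; rewrite /qbinom subn0 gauss0 qfact0 !mul1r invr1.
- by move=> _; rewrite /qbinom subn0 gauss0 qfact0 mul1r divff // qfact_neq0.
rewrite ltnS => ln; rewrite gaussS -(IHn l ln).
move: (ln); rewrite leq_eqVlt => /orP[/eqP ->|lltn].
  rewrite (gauss_small _ _ (ltnSn n)) mulr0 add0r subnn expr0 mul1r /qbinom !subnn qfact0.
  by rewrite !mulr1 !divff // qfact_neq0.
rewrite -IHn // /qbinom subSS.
have [k ->] : exists k, n = (l.+1 + k)%N by exists (n - l.+1)%N; lia.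
rewrite addKn (_ : (l.+1 + k - l = k.+1)%N); last lia.
rewrite (_ : (l.+1 + k).+1 = (k.+1 + l.+1)%N); last lia.
rewrite [in LHS]addSn qfactS -[in LHS]addSn qintD (addnC k) !qfactS exprVn.
have := qfact_neq0 l; have := qfact_neq0 k.
have := @qint_neq0 l.+1 isT; have := @qint_neq0 k.+1 isT => a b c d.
by have := expf_neq0 l.+1 q_neq0 => e; field; rewrite a b c d e.
Qed.

End QuantumIntegers.

(** * Al-Salam-Chihara polynomials and Motzkin paths *)

Section ContinuantPolynomials.
Variables (R : comNzRingType) (u d : R).
Implicit Types t x y : R.

(* Al-Salam-Chihara polynomials: with x = z + 1/z and y = w + 1/w (d = 1),    *)
(* these are the polynomials in x with parameters t w and t / w in base u.    *)
Fixpoint asc t x y (n : nat) : R :=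
  if n is n'.+1 then
    (x - t * u ^+ n' * y) * asc t x y n'
    - (if n' is n''.+1 then
         (1 - u ^+ n') * (1 - t ^+ 2 * u ^+ n'') * d * asc t x y n''
       else 0)
  else 1.

Lemma asc1 t x y : asc t x y 1 = x - t * y.
Proof. by rewrite /= expr0 !mulr1 subr0. Qed.

Lemma ascS t x y n : asc t x y n.+2 =
  (x - t * u ^+ n.+1 * y) * asc t x y n.+1
  - (1 - u ^+ n.+1) * (1 - t ^+ 2 * u ^+ n) * d * asc t x y n.
Proof. by []. Qed.

(** Contiguity under t -> t u. The recurrence has order two, so the induction carries two
    consecutive indices. *)
Lemma asc_contiguous t x y n : asc t x y n.+2 =
  asc (t * u) x y n.+2 - t * (1 - u ^+ n.+2) * y * asc (t * u) x y n.+1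
  + t ^+ 2 * (1 - u ^+ n.+2) * (1 - u ^+ n.+1) * d * asc (t * u) x y n.
Proof.
suff: asc t x y n.+1 = asc (t * u) x y n.+1
        - t * (1 - u ^+ n.+1) * y * asc (t * u) x y n
        + (if n is n'.+1 then
             t ^+ 2 * (1 - u ^+ n.+1) * (1 - u ^+ n) * d * asc (t * u) x y n'
           else 0) /\
      asc t x y n.+2 = asc (t * u) x y n.+2
        - t * (1 - u ^+ n.+2) * y * asc (t * u) x y n.+1
        + t ^+ 2 * (1 - u ^+ n.+2) * (1 - u ^+ n.+1) * d * asc (t * u) x y n.
  by case.
elim: n => [|n [IH1 IH2]].
  by rewrite !ascS !asc1 /=; split; ring.
split=> //; rewrite ascS IH2 IH1 [asc (t * u) x y n.+3]ascS.
case: n {IH1 IH2} => [|n]; first by rewrite !ascS !asc1 /=; ring.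
by rewrite [asc (t * u) x y n.+3]ascS [asc (t * u) x y n.+2]ascS !exprS; ring.
Qed.

(* The recurrence for t u breaks off at m, so asc t has asc (t u) as a factor. *)
Lemma asc_factor t x y m : t ^+ 2 * u ^+ m.+1 = 1 ->
  asc t x y m.+2 =
  (x ^+ 2 - (t + t * u ^+ m.+1) * x * y + y ^+ 2
   + (t - t * u ^+ m.+1) ^+ 2 * d) * asc (t * u) x y m.
Proof.
move=> tu; rewrite asc_contiguous ascS.
have -> : asc (t * u) x y m.+1 = (x - t * u * u ^+ m * y) * asc (t * u) x y m.
  case: m tu => [|m] tu; first by rewrite asc1 /= expr0 !mulr1.
  rewrite ascS (_ : (t * u) ^+ 2 * u ^+ m = 1) ?subrr ?mulr0 ?mul0r ?subr0 //.
  by rewrite -[RHS]tu !exprS; ring.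
move: tu; rewrite !exprS; set v := u ^+ m => tu.
ring: tu.
Qed.
End ContinuantPolynomials.

Section TerminatingContinuants.
Variables (R : comNzRingType) (q q' d : R).
Hypothesis qK : q * q' = 1.
Local Notation u := (q ^+ 2).

Lemma asc_term t m : t * q ^+ m.+2 = q -> t * q ^+ m.+1 = 1.
Proof.
move=> h; transitivity (t * q ^+ m.+2 * q'); last by rewrite h.
by rewrite [q ^+ m.+2]exprSr -!mulrA qK mulr1.
Qed.

Lemma asc_factorq t x y m : t * q ^+ m.+2 = q ->
  asc u d t x y m.+2 =
  (x ^+ 2 - (t + q ^+ m.+1) * x * y + y ^+ 2 + (t - q ^+ m.+1) ^+ 2 * d)
  * asc u d (t * u) x y m.
Proof.
move=> /asc_term h.
have e : t * u ^+ m.+1 = q ^+ m.+1.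
  by rewrite -exprM mul2n -addnn exprD mulrA h mul1r.
rewrite asc_factor ?e //.
by rewrite expr2 -mulrA e.
Qed.

(** Each use of [asc_factorq] splits off a quadratic factor symmetric in x and y, lowers n by 2 and
    replaces t by t u, which preserves the hypothesis. Odd degrees end at x - y, whence the sign. *)
Lemma asc_sym t x y n : t * q ^+ n = q ->
  asc u d t x y n = (-1) ^+ n * asc u d t y x n.
Proof.
elim/ltn_ind: n t => -[|[|n]] IHn t h; first by rewrite mul1r.
  rewrite !asc1; have -> : t = 1.
    by rewrite -[LHS]mulr1 -{1}qK mulrA -[q]expr1 h.
  by ring.
rewrite !asc_factorq // (IHn n) //; last first.
  by rewrite -[RHS]h -mulrA -exprD.
by rewrite -[n.+2]addn2 exprD; ring.
Qed.
End TerminatingContinuants.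

(** * Transfer operators of weighted Motzkin paths *)

Section PathSums.
Variables (R : comNzRingType) (u v g s t : R).
Hypotheses (uK : u * v = 1) (tK : t * s = 1).

Definition geosum (w : R) (n : nat) : R := \sum_(r < n) w ^+ r.

Lemma geosum0 w : geosum w 0 = 0. Proof. exact: big_ord0. Qed.

Lemma geosumS w n : geosum w n.+1 = 1 + w * geosum w n.
Proof.
rewrite /geosum big_ord_recl mulr_sumr expr0; congr (_ + _).
by apply: eq_bigr => r _; rewrite -exprS.
Qed.

Lemma geosumD w m n : geosum w (m + n) = geosum w m + w ^+ m * geosum w n.
Proof.
rewrite /geosum big_split_ord mulr_sumr; congr (_ + _).
by apply: eq_bigr => r _; rewrite -exprD.
Qed.

Lemma geosumE w n : (1 - w) * geosum w n = 1 - w ^+ n.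
Proof.
elim: n => [|n IHn]; first by rewrite geosum0 mulr0 subrr.
rewrite geosumS mulrDr mulrCA IHn exprS; ring.
Qed.

Implicit Types (x y : R) (c : nat -> R).

Definition below c h : R := if h is h'.+1 then c h' else 0.

(* One step of a weighted Motzkin path at height h: every step has weight     *)
(* v^h, times geosum u h.+1 (up), x (level) or g (down).                      *)
Definition motzkin x c h : R :=
  v ^+ h * (geosum u h.+1 * c h.+1 + x * c h + g * below c h).

(** The diagonal operator between the steps weighted by x and those weighted by y; with s = q^p it
    yields the factor q^(-a zeta) of rho. *)
Definition tilt c h : R := s ^+ h * c h.

Fixpoint twisted_serre x y n c : nat -> R :=
  if n is n'.+1 then
    fun h => motzkin x (twisted_serre x y n' c) h
             - t * u ^+ n' * twisted_serre x y n' (motzkin y c) h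
  else tilt c.

(* [shiftw i m h] is the coefficient of c (h + m) in the operator that tilts, *)
(* takes i level steps and then m up-steps.                                   *)
Definition shiftw (i m h : nat) : R :=
  s ^+ h * v ^+ (i * h) * \prod_(r < m) (v ^+ (h + r) * geosum u (h + r).+1).

Definition shiftop i m c h : R := shiftw i m h * c (h + m)%N.

Lemma shiftwSl i m h : shiftw i.+1 m h = v ^+ h * shiftw i m h.
Proof. by rewrite /shiftw mulSn exprD; ring. Qed.

Lemma shiftwSr i m h :
  shiftw i m.+1 h = shiftw i m h * (v ^+ (h + m) * geosum u (h + m).+1).
Proof. by rewrite /shiftw big_ord_recr /= mulrA. Qed.

Lemma shiftwS i m h :
  v ^+ h * geosum u h.+1 * shiftw i m h.+1 = s * v ^+ i * shiftw i m.+1 h.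
Proof.
rewrite /shiftw big_ord_recl /= addn0 mulnS exprD exprS.
have -> : \prod_(r < m) (v ^+ (h + bump 0 r) * geosum u (h + bump 0 r).+1)
        = \prod_(r < m) (v ^+ (h.+1 + r) * geosum u (h.+1 + r).+1).
  by apply: eq_bigr => r _; rewrite addSnnS.
by ring.
Qed.

(** The factor t u^(i+m) is chosen so that the down-steps coming from the two sides cancel, up to a
    term with one up-step fewer. Hence the span of the [shiftop] is stable under the twisted
    commutators. *)
Lemma shiftop_step x y i m c h :
  motzkin x (shiftop i m c) h - t * u ^+ (i + m) * shiftop i m (motzkin y c) h
  = (x - t * u ^+ i * y) * shiftop i.+1 m c h
    + (s * v ^+ i - t * u ^+ (i + m)) * shiftop i m.+1 c h
    - (if m is m'.+1 then
         t * u ^+ i * g * v ^+ m' * geosum u m * shiftop i.+2 m' c h else 0).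
Proof.
have uv k : u ^+ k * v ^+ k = 1 by rewrite -exprMn uK expr1n.
rewrite /motzkin /shiftop addSnnS.
have e1 : v ^+ h * (geosum u h.+1 * (shiftw i m h.+1 * c (h + m.+1)%N))
          = s * v ^+ i * (shiftw i m.+1 h * c (h + m.+1)%N).
  by rewrite [RHS]mulrA -shiftwS; ring.
have e2 : shiftw i m h * (v ^+ (h + m) * (geosum u (h + m).+1 * c (h + m).+1))
          = shiftw i m.+1 h * c (h + m.+1)%N.
  by rewrite shiftwSr -addnS; ring.
have e3 : u ^+ (i + m) * v ^+ (h + m) = u ^+ i * v ^+ h.
  by rewrite !exprD mulrACA uv mulr1.
rewrite shiftwSl.
case: m e1 e2 e3 => [|m] e1 e2 e3.
  rewrite !addn0 in e1 e2 e3 *.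
  have e4 : below (fun h => shiftw i 0 h * c (h + 0)%N) h
     = t * u ^+ i * shiftw i 0 h * below c h.
    case: h {e1 e2 e3} => [|h]; first by rewrite /= mulr0.
    rewrite /= /shiftw !big_ord0 addn0 mulnS exprS exprD !mulr1.
    transitivity (t * s * (u ^+ i * v ^+ i) * (s ^+ h * v ^+ (i * h)) * c h).
      by rewrite tK uv; ring.
    by ring.
  rewrite e4.
  transitivity (
    v ^+ h * (geosum u h.+1 * (shiftw i 0 h.+1 * c (h + 1)%N))
    - t * u ^+ i * (shiftw i 0 h * (v ^+ h * (geosum u h.+1 * c h.+1)))
    + (x - t * u ^+ i * y) * (v ^+ h * shiftw i 0 h * c h)); first by ring.
  by rewrite e1 e2; ring.
(* The down-steps of both sides. Splitting [geosum u (h.+1 + m).+1] into two ranges leaves only the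
   factor [geosum u m.+1]. *)
have e4 : v ^+ h * (g * below (fun h => shiftw i m.+1 h * c (h + m.+1)%N) h)
   - t * u ^+ i * v ^+ h * shiftw i m.+1 h * (g * c (h + m)%N)
   = - (t * u ^+ i * g * v ^+ m * geosum u m.+1 * (shiftw i.+2 m h * c (h + m)%N)).
  rewrite !shiftwSl; case: h {e1 e2 e3} => [|h].
    by rewrite shiftwSr !add0n !expr0 /=; ring.
  have e : shiftw i m.+1 h = t * u ^+ i * (v ^+ h * geosum u h.+1 * shiftw i m h.+1).
    rewrite shiftwS; transitivity (t * s * (u ^+ i * v ^+ i) * shiftw i m.+1 h).
      by rewrite tK uv !mul1r.
    by ring.
  have eG : geosum u (h.+1 + m).+1 = geosum u m.+1 + u ^+ m.+1 * geosum u h.+1.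
    by rewrite -geosumD; congr geosum; lia.
  have ev : v ^+ (h + m.+1) * u ^+ m.+1 = v ^+ h.
    by rewrite exprD -mulrA [v ^+ m.+1 * _]mulrC uv mulr1.
  rewrite /= e shiftwSr eG addSnnS.
  transitivity (v ^+ h.+1 * t * u ^+ i * shiftw i m h.+1 * g * c (h + m.+1)%N
    * (v ^+ h * geosum u h.+1 - v ^+ (h + m.+1) * u ^+ m.+1 * geosum u h.+1
       - v ^+ (h + m.+1) * geosum u m.+1)); first by ring.
  by rewrite ev [v ^+ (h + m.+1)]exprD !exprS; ring.
transitivity (v ^+ h * (geosum u h.+1 * (shiftw i m.+1 h.+1 * c (h + m.+2)%N))
  - t * u ^+ (i + m.+1) * (shiftw i m.+1 h *
      (v ^+ (h + m.+1) * (geosum u (h + m.+1).+1 * c (h + m.+1).+1)))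
  + x * v ^+ h * shiftw i m.+1 h * c (h + m.+1)%N
  - t * (u ^+ (i + m.+1) * v ^+ (h + m.+1)) * y * shiftw i m.+1 h * c (h + m.+1)%N
  + (v ^+ h * (g * below (fun h => shiftw i m.+1 h * c (h + m.+1)%N) h)
     - t * (u ^+ (i + m.+1) * v ^+ (h + m.+1)) * shiftw i m.+1 h
       * (g * below c (h + m.+1)))).
  by ring.
rewrite e1 e2 e3.
transitivity ((x - t * u ^+ i * y) * (v ^+ h * shiftw i m.+1 h * c (h + m.+1)%N) +
  (s * v ^+ i - t * u ^+ (i + m.+1)) * (shiftw i m.+2 h * c (h + m.+2)%N)
  + (v ^+ h * (g * below (fun h => shiftw i m.+1 h * c (h + m.+1)%N) h)
     - t * u ^+ i * v ^+ h * shiftw i m.+1 h * (g * below c (h + m.+1)))).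
  by ring.
by rewrite [in below c _]addnS /= e4.
Qed.
Lemma motzkin_sum x n (a : 'I_n -> R) (f : 'I_n -> nat -> R) h :
  motzkin x (fun h => \sum_(m < n) a m * f m h) h
  = \sum_(m < n) a m * motzkin x (f m) h.
Proof.
have e : below (fun h => \sum_(m < n) a m * f m h) h
       = \sum_(m < n) a m * below (f m) h.
  by case: h => //=; rewrite big1 // => m _; rewrite mulr0.
rewrite /motzkin e !mulr_sumr -!big_split mulr_sumr; apply: eq_bigr => m _ /=.
by ring.
Qed.

(** The part of the normal-form coefficients that is free of x and y: the last up-step contributes s
    v^j - t u^(m'+j), where j is the number of level steps made before it. *)
Fixpoint shift_coef (m k : nat) : R :=
  if m is m'.+1 then
    \sum_(j < k.+1) (s * v ^+ j - t * u ^+ (m' + j)) * shift_coef m' j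
  else 1.

Lemma shift_coef0 m : shift_coef m.+1 0 = (s - t * u ^+ m) * shift_coef m 0.
Proof. by rewrite /= big_ord1 expr0 mulr1 addn0. Qed.

Lemma shift_coefS m k : shift_coef m.+1 k.+1 =
  shift_coef m.+1 k + (s * v ^+ k.+1 - t * u ^+ (m + k.+1)) * shift_coef m k.+1.
Proof. by rewrite /= big_ord_recr. Qed.

(** Stated without division because R is only a commutative ring. It turns the term that loses an
    up-step into the middle term of the recurrence of [asc], so that the coefficients factor as in
    [serre_coef]. *)
Lemma shift_coef_ratio m k :
  shift_coef m k.+1 * (1 - u ^+ k.+1) * (1 - t ^+ 2 * u ^+ k)
  = t * u ^+ k * v ^+ m * (1 - u ^+ m.+1) * shift_coef m.+1 k.
Proof.
have uv j : u ^+ j * v ^+ j = 1 by rewrite -exprMn uK expr1n.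
elim: m k => [|m IHm] k.
  elim: k => [|k IHk].
    rewrite shift_coef0 /= !expr0 !mulr1 !mul1r.
    transitivity ((1 - u) * (t * s - t * t)); last by ring.
    by rewrite tK expr1; ring.
  rewrite shift_coefS mulrDr.
  transitivity (u * ((1 - u ^+ k.+1) * (1 - t ^+ 2 * u ^+ k))
    + (1 - u) * (t * s * (u ^+ k.+1 * v ^+ k.+1) - t ^+ 2 * (u ^+ k.+1) ^+ 2)).
    by rewrite tK uv /= !exprS; ring.
  have -> : (1 - u ^+ k.+1) * (1 - t ^+ 2 * u ^+ k)
           = t * u ^+ k * v ^+ 0 * (1 - u ^+ 1) * shift_coef 1 k.
    by rewrite -IHk /= !mul1r.
  by rewrite /= expr0 expr1 add0n [u ^+ k.+1]exprS; ring.
elim: k => [|k IHk].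
  rewrite shift_coef0 shift_coefS !mulrDl.
  have := IHm 0; rewrite !expr0 !addn1 !expr1 => e.
  transitivity (shift_coef m.+1 0 * (1 - u) * (1 - t ^+ 2)
     + (s * v - t * u ^+ m.+1) * (shift_coef m 1 * (1 - u) * (1 - t ^+ 2 * 1))).
    by ring.
  rewrite e.
  transitivity (shift_coef m.+1 0 * ((1 - u) * (1 - t ^+ 2)
     + (t * s * v ^+ m.+1 - t ^+ 2 * (u * (u ^+ m * v ^+ m))) * (1 - u ^+ m.+1))).
    by rewrite !exprS; ring.
  transitivity (shift_coef m.+1 0 * ((t * s - t ^+ 2 * u ^+ m.+1)
      * v ^+ m.+1 * (1 - u ^+ m.+2))); last by rewrite !exprS; ring.
  congr (_ * _); rewrite tK uv mulr1 [u ^+ m.+2]exprS.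
  have := uv m.+1; set b := u ^+ m.+1; set a := v ^+ m.+1 => ab.
  transitivity (1 - u - t ^+ 2 + a - b * a + t ^+ 2 * u * b); first by ring.
  transitivity (a - t ^+ 2 * (b * a) - u * (b * a) + t ^+ 2 * u * b * (b * a)).
    by rewrite ab; ring.
  by ring.
rewrite [in LHS]shift_coefS [in RHS]shift_coefS mulrDr !mulrDl.
transitivity (shift_coef m.+1 k.+1 * (1 - u ^+ k.+2) * (1 - t ^+ 2 * u ^+ k.+1)
   + (s * v ^+ k.+2 - t * u ^+ (m + k.+2))
     * (shift_coef m k.+2 * (1 - u ^+ k.+2) * (1 - t ^+ 2 * u ^+ k.+1))).
  by ring.
rewrite IHm.
transitivity (u * (t * u ^+ k * v ^+ m.+1 * (1 - u ^+ m.+2) * shift_coef m.+2 k)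
   + t * u ^+ k.+1 * v ^+ m.+1 * (1 - u ^+ m.+2) *
     ((s * v ^+ k.+1 - t * u ^+ (m.+1 + k.+1)) * shift_coef m.+1 k.+1)).
  rewrite -IHk.
  transitivity (shift_coef m.+1 k.+1 * ((1 - u ^+ k.+2) * (1 - t ^+ 2 * u ^+ k.+1)
    + (t * s * v ^+ m.+1 * (u ^+ k.+1 * v ^+ k.+1)
       - t ^+ 2 * (u ^+ k.+1) ^+ 2 * u * (u ^+ m * v ^+ m)) * (1 - u ^+ m.+1))).
    by rewrite exprD !exprS; ring.
  transitivity (shift_coef m.+1 k.+1 * (u * ((1 - u ^+ k.+1) * (1 - t ^+ 2 * u ^+ k))
    + (t * s * v ^+ m.+1 * (u ^+ k.+1 * v ^+ k.+1)
       - t ^+ 2 * (u ^+ k.+1) ^+ 2 * (u ^+ m.+1 * v ^+ m.+1)) * (1 - u ^+ m.+2))).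
    congr (_ * _); rewrite tK !uv; have := uv m.+1.
    set a := v ^+ m.+1; set b := u ^+ k => ua.
    rewrite [u ^+ k.+2]exprS [u ^+ m.+2]exprS [u ^+ k.+1]exprS -/b.
    transitivity (1 - u * (u * b) - t ^+ 2 * (u * b) + a - u ^+ m.+1 * a
      + t ^+ 2 * (u * b) ^+ 2 * u * u ^+ m.+1); first by ring.
    rewrite ua; transitivity (u - u * (u * b) - t ^+ 2 * (u * b) + a - u * (u ^+ m.+1 * a)
      + t ^+ 2 * (u * b) ^+ 2 * u * u ^+ m.+1); last by ring.
    by rewrite ua; ring.
  by rewrite exprD !exprS; ring.
by rewrite !exprS; ring.
Qed.

Variable d : R.
Hypothesis gE : g = (1 - u) * d.

(** The coefficient of [shiftop (n - m) m] in [twisted_serre x y n]; the factorization is an ansatz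
    confirmed by [serre_coefS]. *)
Definition serre_coef x y n m : R :=
  if (m <= n)%N then shift_coef m (n - m) * asc u d t x y (n - m) else 0.

Lemma serre_coefS x y n m : (m <= n.+1)%N ->
  serre_coef x y n.+1 m =
    serre_coef x y n m * (x - t * u ^+ (n - m) * y)
    + (if m is m'.+1 then
         serre_coef x y n m' * (s * v ^+ (n - m') - t * u ^+ n) else 0)
    - serre_coef x y n m.+1
      * (t * u ^+ (n - m.+1) * g * v ^+ m * geosum u m.+1).
Proof.
rewrite leq_eqVlt => /orP[/eqP ->|].
  rewrite /serre_coef leqnn ltnn leqnn ltnNge leqnSn /= subnn.
  by rewrite -/(shift_coef n.+1 0) shift_coef0 subnn /= expr0; ring.
rewrite ltnS => mn.
have [k ->] : exists k, n = (m + k)%N by exists (n - m)%N; lia.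
rewrite /serre_coef !leqW ?leq_addr // addKn -addnS addKn.
have e3 : (if (m < m + k)%N then
        shift_coef m.+1 (m + k - m.+1) * asc u d t x y (m + k - m.+1) else 0)
    * (t * u ^+ (m + k - m.+1) * g * v ^+ m * geosum u m.+1)
    = shift_coef m k * ((x - t * u ^+ k * y) * asc u d t x y k - asc u d t x y k.+1).
  case: k {mn} => [|k]; first by rewrite addn0 ltnn asc1 /= expr0; ring.
  rewrite addnS ltnS leq_addr subSS addKn ascS.
  transitivity (t * u ^+ k * v ^+ m * (((1 - u) * geosum u m.+1) * shift_coef m.+1 k)
     * d * asc u d t x y k); first by rewrite gE; ring.
  by rewrite geosumE !mulrA -shift_coef_ratio; ring.
rewrite e3; case: m {mn e3} => [|m]; first by rewrite /= addr0; ring.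
rewrite addSnnS leq_addr addKn shift_coefS; ring.
Qed.

Lemma twisted_serreE x y n c h :
  twisted_serre x y n c h =
  \sum_(m < n.+1) serre_coef x y n m * shiftop (n - m) m c h.
Proof.
elim: n c h => [|n IHn] c h.
  rewrite big_ord1 /serre_coef /= !mul1r /shiftop /shiftw big_ord0 addn0.
  by rewrite mul0n expr0 !mulr1.
have -> : twisted_serre x y n.+1 c h =
  motzkin x (twisted_serre x y n c) h - t * u ^+ n * twisted_serre x y n (motzkin y c) h.
  by [].
rewrite (funext (IHn c)) IHn motzkin_sum mulr_sumr -sumrB.
pose f m := shiftop (n.+1 - m) m c h.
pose third m := serre_coef x y n m.+1
      * (t * u ^+ (n - m.+1) * g * v ^+ m * geosum u m.+1) * f m.
pose second m := serre_coef x y n m * (s * v ^+ (n - m) - t * u ^+ n) * f m.+1.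
pose first m := serre_coef x y n m * (x - t * u ^+ (n - m) * y) * f m.
transitivity (\sum_(m < n.+1) (first m + second m
                - if (m : nat) is m'.+1 then third m' else 0)).
  apply: eq_bigr => m _; have mn : (m <= n)%N by rewrite -ltnS.
  have := shiftop_step x y (n - m) m c h; rewrite subnK // => e.
  transitivity (serre_coef x y n m * (motzkin x (shiftop (n - m) m c) h
     - t * u ^+ n * shiftop (n - m) m (motzkin y c) h)); first by ring.
  rewrite e /first /second /third /f; case: (m : nat) mn => [|m'] mn.
    by rewrite !subn0 subSS subn0; ring.
  by rewrite !subSS (subSn (ltnW mn)) (subnSK mn); ring.
(* Collects the level, up and down contributions by the resulting operator, so that all three
   multiply [f m]. *)
transitivity (\sum_(m < n.+2) (first m + (if (m : nat) is m'.+1 then second m' else 0)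
                 - third m)); last first.
  apply: eq_bigr => m _; rewrite serre_coefS; last by rewrite -ltnS.
  rewrite /first /second /third /f.
  by case: (m : nat) => [|m']; ring.
rewrite !sumrB !big_split /= -!addrA; congr (_ + _).
  rewrite [RHS]big_ord_recr /= [first n.+1]/first /serre_coef ltnn.
  by rewrite !mul0r addr0.
congr (_ + - _).
  by rewrite [RHS]big_ord_recl add0r.
rewrite big_ord_recl add0r [RHS]big_ord_recr [X in _ = X + _]big_ord_recr /=.
rewrite [third n.+1]/third [third n]/third /serre_coef !ltnn ltnNge leqnSn.
by rewrite !mul0r !addr0.
Qed.

(** From height 0 only the term without up-steps meets the indicator of height 0, and its
    coefficient [serre_coef x y n 0] is [asc]. *)
Lemma twisted_serre_asc x y n :
  twisted_serre x y n (fun h => (h == 0%N)%:R) 0 = asc u d t x y n.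
Proof.
rewrite twisted_serreE big_ord_recl big1 => [|m _].
  by rewrite /serre_coef /shiftop /shiftw /= big_ord0 muln0 !expr0 subn0 /=; ring.
by rewrite /shiftop add0n !lift0 /= !mulr0.
Qed.
End PathSums.

(** * Binary words as codes of lattice paths *)

Section BinaryWords.

(** Words replace tuples so that sums over them unfold letter by letter, in step with the path. *)
Fixpoint bwords (n : nat) : seq (seq bool) :=
  if n is n'.+1 then map (cons true) (bwords n') ++ map (cons false) (bwords n')
  else [:: [::]].

Lemma mem_bwords n l : (l \in bwords n) = (size l == n).
Proof.
elim: n l => [|n IHn] [|b l] //=.
  by rewrite mem_cat; apply/negbTE/negP => /orP[] /mapP[].
rewrite mem_cat eqSS -IHn; case: b.
  rewrite (mem_map (f := cons true)) => [|? ? []//].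
  by rewrite orbC; case: mapP => [[]|].
rewrite (mem_map (f := cons false)) => [|? ? []//].
by case: mapP => [[]|].
Qed.

Lemma bwords_uniq n : uniq (bwords n).
Proof.
elim: n => //= n IHn; rewrite cat_uniq !map_inj_uniq ?IHn => [|? ? []//|? ? []//].
by rewrite andbT; apply/hasPn => _ /mapP[l _ ->]; apply/mapP => -[].
Qed.

Variable V : nmodType.

Lemma big_tuple_bwords n (P : pred (seq bool)) (f : seq bool -> V) :
  \sum_(l : n.-tuple bool | P l) f l = \sum_(l <- bwords n | P l) f l.
Proof.
rewrite -(big_map (@tval n bool) P f); apply: perm_big.
apply: uniq_perm; rewrite ?bwords_uniq //.
  by rewrite map_inj_uniq ?index_enum_uniq //; apply: val_inj.
move=> l; rewrite mem_bwords; apply/mapP/eqP => [[t _ ->]|ln].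
  by rewrite size_tuple.
by exists (tcast ln (in_tuple l)); rewrite ?mem_index_enum //= val_tcast.
Qed.

Lemma big_bwordsS n (f : seq bool -> V) :
  \sum_(l <- bwords n.+1) f l
  = \sum_(l <- bwords n) f (true :: l) + \sum_(l <- bwords n) f (false :: l).
Proof. by rewrite /= big_cat !big_map. Qed.

Lemma big_bwords_true n (f : seq bool -> V) :
  \sum_(l <- bwords n | all id l) f l = f (nseq n true).
Proof.
rewrite -big_filter (_ : [seq l <- bwords n | all id l] = [:: nseq n true]).
  by rewrite big_seq1.
elim: n => //= n IHn; rewrite filter_cat !filter_map /preim /= IHn.
by rewrite filter_pred0.
Qed.
End BinaryWords.

Section Bits.
Implicit Types l s : seq bool.

Lemma bsum_cons b l r : bsum (b :: l) 1 r.+1 = (b + bsum l 1 r)%N.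
Proof.
rewrite /bsum big_nat_recl //; congr (_ + _)%N; rewrite !big_add1.
by apply: eq_big_nat => i _.
Qed.

Lemma bsum0 l : bsum l 1 0 = 0%N. Proof. exact: big_geq. Qed.

Lemma bsum_nil r k : bsum [::] r k = 0%N.
Proof. by rewrite /bsum big1 // => i _; rewrite /bit nth_nil. Qed.

Lemma bsum_leq l r : (bsum l 1 r <= r)%N.
Proof.
elim: r l => [|r IHr] [|b l]; rewrite ?bsum0 ?bsum_nil //.
by rewrite bsum_cons; case: b; rewrite ?add1n ?add0n ?ltnS ?IHr // ltnW ?ltnS.
Qed.

Lemma bsum_size l : bsum l 1 (size l) = count id l.
Proof. by elim: l => [|b l IHl]; rewrite ?bsum0 //= bsum_cons IHl. Qed.

Lemma zeta0 l s : zeta l s 0 = 0.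
Proof. by rewrite /zeta sub0n !bsum0 mulr0. Qed.

Lemma zeta_true l s r : zeta (true :: l) s r.+1 = zeta l s r.
Proof. by rewrite /zeta bsum_cons subSS; lia. Qed.

(** With [zeta_true], this identifies [zeta] as a height: a bit of [s] is consumed only at the
    non-level steps. *)
Lemma zeta_false l b s r :
  zeta (false :: l) (b :: s) r.+1 = (if b then 1 else -1) + zeta l s r.
Proof.
rewrite /zeta bsum_cons add0n subSn ?bsum_leq // bsum_cons.
by case: b; lia.
Qed.
End Bits.

Section Paths.
Variables (R : comNzRingType) (g : R) (w : nat -> int -> R) (X : nat -> R).
Variable (G : int -> R).
Implicit Types (l s : seq bool) (h r : nat) (c : nat -> R).

Definition wstep r c h : R :=
  w r h%:Z * (G (h%:Z + 1) * c h.+1 + X r * c h + g * below c h).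

Fixpoint wrun r n c : nat -> R :=
  if n is n'.+1 then wstep r (wrun r.+1 n' c) else c.

(** The weights depend on the time r because the twist and the change from x to y sit at a fixed
    step. An [s] whose length is not the number of non-level steps gets weight 0. *)
Fixpoint wpath r l s h : R :=
  match l, s with
  | [::], [::] => (h == 0%N)%:R
  | true :: l, _ => w r h%:Z * (X r * wpath r.+1 l s h)
  | false :: l, true :: s => w r h%:Z * (G (h%:Z + 1) * wpath r.+1 l s h.+1)
  | false :: l, false :: s => w r h%:Z * (g * below (wpath r.+1 l s) h)
  | _, _ => 0
  end.

Lemma wpath_sum r n h :
  \sum_(l <- bwords n) \sum_(s <- bwords (count negb l)) wpath r l s h
  = wrun r n (fun h => (h == 0%N)%:R) h.
Proof.
elim: n r h => [|n IHn] r h; first by rewrite !big_seq1.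
rewrite big_bwordsS /= /wstep -!IHn.
have -> : \sum_(l <- bwords n) \sum_(s <- bwords (count negb (false :: l)))
    wpath r (false :: l) s h
  = \sum_(l <- bwords n) \sum_(s <- bwords (count negb l))
      (w r h%:Z * (G (h%:Z + 1) * wpath r.+1 l s h.+1)
       + w r h%:Z * (g * below (wpath r.+1 l s) h)).
  by apply: eq_bigr => l _; rewrite /= big_cat !big_map big_split.
have -> : below (wrun r.+1 n (fun h => (h == 0%N)%:R)) h =
   \sum_(l <- bwords n) \sum_(s <- bwords (count negb l)) below (wpath r.+1 l s) h.
  case: h => [|h] /=; first by rewrite big1 // => l _; rewrite big1.
  by rewrite IHn.
rewrite !mulrDr !mulr_sumr -!big_split; apply: eq_bigr => l _ /=.
rewrite !mulr_sumr -!big_split; apply: eq_bigr => s _ /=.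
by rewrite addrCA addrA.
Qed.

(** The ballot condition for a path from height h down to 0; for h = 0 it is [in_S]. *)
Definition dyck h s : bool :=
  (h + 2 * bsum s 1 (size s) == size s)%N
  && all (fun p => p <= h + 2 * bsum s 1 p)%N (iota 1 (size s)).

Lemma dyck_cons h b s :
  dyck h (b :: s) = if b then dyck h.+1 s else (0 < h)%N && dyck h.-1 s.
Proof.
rewrite /dyck [size _]/= bsum_cons [iota _ _]/= /= bsum_cons bsum0 addn0.
rewrite -[2%N]/(1 + 1)%N iotaDl all_map.
have -> : all (preim (addn 1) (fun p => p <= h + (1 + 1) * bsum (b :: s) 1 p)%N)
    (iota 1 (size s))
  = all (fun p => p.+1 <= h + (1 + 1) * (b + bsum s 1 p))%N (iota 1 (size s)).
  by apply: eq_all => p /=; rewrite add1n bsum_cons.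
case: b.
  rewrite !mulnDr !addnA !addn1 addn2 ltnS eqSS /=; congr (_ && _).
  by apply: eq_all => p; rewrite mulnDr addnA addn2 ltnS.
case: h => [|h] /=; first by rewrite !andbF.
by rewrite addSn eqSS.
Qed.

(** An arbitrary starting height is needed for the induction. The last exponent counts the
    down-steps, each of weight g. *)
Lemma wpathE r l s h : size s = count negb l ->
  wpath r l s h =
  (dyck h s)%:R
  * \prod_(i < size l) w (r + i) (h%:Z + zeta l s i)
  * \prod_(i < size l) X (r + i) ^+ bit l i.+1
  * \prod_(i < size l) G (h%:Z + zeta l s i + 1)
      ^+ ((1 - bit l i.+1) * bit s (i.+1 - bsum l 1 i.+1))
  * g ^+ (size s - count id s).
Proof.
elim: l r s h => [|[] l IHl] r s h /=.
- case: s => // _; rewrite !big_ord0 /dyck /= bsum0 expr0 !mulr1 andbT.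
  by rewrite muln0 addn0; case: (h == 0%N).
- move=> sl; rewrite IHl // !big_ord_recl /= !addn0 zeta0 addr0 mul0n expr0 expr1.
  rewrite mul1r.
  have e1 : \prod_(i < size l) w (r + bump 0 i) (h%:Z + zeta (true :: l) s (bump 0 i))
     = \prod_(i < size l) w (r.+1 + i) (h%:Z + zeta l s i).
    by apply: eq_bigr => i _; rewrite zeta_true addSnnS.
  have e2 : \prod_(i < size l) X (r + bump 0 i) ^+ bit (true :: l) (bump 0 i).+1
    = \prod_(i < size l) X (r.+1 + i) ^+ bit l i.+1.
    by apply: eq_bigr => i _; rewrite addSnnS.
  have e3 : \prod_(i < size l) G (h%:Z + zeta (true :: l) s (bump 0 i) + 1)
       ^+ ((1 - bit (true :: l) (bump 0 i).+1)
           * bit s ((bump 0 i).+1 - bsum (true :: l) 1 (bump 0 i).+1))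
    = \prod_(i < size l) G (h%:Z + zeta l s i + 1)
      ^+ ((1 - bit l i.+1) * bit s (i.+1 - bsum l 1 i.+1)).
    by apply: eq_bigr => i _; rewrite zeta_true bsum_cons add1n subSS.
  by rewrite e1 e2 e3; ring.
- case: s => // b s [sl].
  rewrite !big_ord_recl /= !addn0 zeta0 addr0 expr0 mul1r bsum_cons bsum0 /= mul1n.
  pose h' : int := h%:Z + (if b then 1 else -1).
  have e1 : \prod_(i < size l) w (r + bump 0 i)
        (h%:Z + zeta (false :: l) (b :: s) (bump 0 i))
     = \prod_(i < size l) w (r.+1 + i) (h' + zeta l s i).
    by apply: eq_bigr => i _; rewrite zeta_false addSnnS addrA.
  have e2 : \prod_(i < size l) X (r + bump 0 i) ^+ bit (false :: l) (bump 0 i).+1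
    = \prod_(i < size l) X (r.+1 + i) ^+ bit l i.+1.
    by apply: eq_bigr => i _; rewrite addSnnS.
  have e3 : \prod_(i < size l) G (h%:Z + zeta (false :: l) (b :: s) (bump 0 i) + 1)
       ^+ ((1 - bit (false :: l) (bump 0 i).+1)
           * bit (b :: s) ((bump 0 i).+1 - bsum (false :: l) 1 (bump 0 i).+1))
    = \prod_(i < size l) G (h' + zeta l s i + 1)
      ^+ ((1 - bit l i.+1) * bit s (i.+1 - bsum l 1 i.+1)).
    apply: eq_bigr => i _; rewrite zeta_false [h%:Z + (_ + _)]addrA -/h' bsum_cons add0n.
    rewrite (subSn (bsum_leq _ _)); congr (_ ^+ _).
    rewrite (_ : bit (false :: l) (bump 0 i).+1 = bit l i.+1) //.
    have : bsum l 1 i.+1 = (bsum l 1 i + bit l i.+1)%N.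
      by rewrite /bsum big_nat_recr.
    (* At a non-level step the index into [b :: s] is one more than that into [s]; at a level step
       the exponent is 0 whatever the index. *)
    have [->|->] : bit l i.+1 = 0%N \/ bit l i.+1 = 1%N.
    + by rewrite /bit; case: nth; [right|left].
    + by rewrite addn0 => ->; rewrite (subSn (bsum_leq _ _)).
    + by rewrite !mul0n.
  rewrite e1 e2 e3 dyck_cons; case: b @h' {e1 e2 e3} => h'.
    rewrite IHl //; have -> : h.+1%:Z = h' by rewrite /h'; lia.
    by rewrite expr1 /= add1n subSS; ring.
  rewrite expr0 /=; case: h @h' => [|h] h' /=; first by rewrite !mulr0 !mul0r.
  rewrite IHl //; have -> : h%:Z = h' by rewrite /h'; lia.
  rewrite add0n subSn ?exprS; last by rewrite count_size.
  by clearbody h'; ring.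
Qed.
End Paths.

(** * The coefficients rho as path sums *)

Lemma rmorph_gauss (R S : comNzRingType) (f : {rmorphism R -> S}) q q' n l :
  f (gauss q q' n l) = gauss (f q) (f q') n l.
Proof.
elim: n l => [|n IHn] [|l]; rewrite /= ?rmorph0 ?rmorph1 //.
by rewrite rmorphD !rmorphM !rmorphXn !IHn.
Qed.

Section RhoFormula.
Variables (F : fieldType) (q c : F) (p : nat).
Hypothesis q_neq0 : q != 0.
Hypothesis q_nroot : forall n, (0 < n)%N -> q ^+ n != 1.
Variables (R : comNzRingType) (iota : {rmorphism F -> R}) (x y z : R).
Local Notation N := p.+1.
Let gam : F := c * q ^+ 2 / (q - q^-1).
Let u := iota (q ^+ 2).
Let v := iota (q ^- 2).
Let t := iota (q ^- p).
Let s0 := iota (q ^+ p).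
Let g := iota gam * z.
Let d := iota (gam / (1 - q ^+ 2)) * z.

Fact uK : u * v = 1.
Proof. by rewrite -rmorphM divff ?rmorph1 // expf_neq0. Qed.

Fact tK : t * s0 = 1.
Proof. by rewrite -rmorphM mulVf ?rmorph1 // expf_neq0. Qed.

Fact sqB1_neq0 : 1 - q ^+ 2 != 0.
Proof. by rewrite subr_eq0 eq_sym q_nroot. Qed.

Fact gE : g = (1 - u) * d.
Proof.
rewrite /g /d /u -(rmorph1 iota) -rmorphB mulrA -rmorphM.
by rewrite [_ * (_ / _)]mulrC divfK ?sqB1_neq0.
Qed.

Lemma geosum_qpar n : geosum u n = iota (qpar q n%:Z).
Proof.
have -> : geosum u n = iota (geosum (q ^+ 2) n).
  by rewrite rmorph_sum; apply: eq_bigr => i _; rewrite rmorphXn.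
congr (iota _); apply: (mulfI sqB1_neq0).
rewrite geosumE /qpar mulrC divfK ?sqB1_neq0 //.
by rewrite (_ : 2 * n%:Z = (2 * n)%N%:Z) ?PoszM // -exprnP exprM.
Qed.

Local Notation eps := (fun h : nat => (h == 0%N)%:R : R).

(** [theta_exp] distributed over the steps: -2H at each of them, and pH = -aH at step j = N - k, the
    first of the last k. *)
Definition rho_weight (j r : nat) (H : int) : R :=
  iota (q ^ (- (2 * H)) * (if r == j then q ^ (p%:Z * H) else 1)).

Definition rho_var (j r : nat) : R := if (r < j)%N then x else y.

Local Notation run j := (wrun g (rho_weight j) (rho_var j)
  (fun H => iota (qpar q H))).

Lemma motzkin_run X w h k :
  w = iota (q ^ (- (2 * h%:Z)) * k) ->
  forall cc, w * (iota (qpar q (h%:Z + 1)) * cc h.+1 + X * cc h + g * below cc h)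
  = iota k * motzkin u v g X cc h.
Proof.
move=> -> cc; rewrite /motzkin rmorphM geosum_qpar.
rewrite (_ : h%:Z + 1 = h.+1%:Z); last by lia.
have -> : iota (q ^ (- (2 * h%:Z))) = v ^+ h.
  by rewrite -exprz_inv -PoszM -exprnP exprM exprVn rmorphXn.
by ring.
Qed.

Lemma run_tail j r n cc : (j < r)%N -> run j r n cc = iter n (motzkin u v g y) cc.
Proof.
elim: n r => //= n IHn r jr; apply/funext => h.
rewrite /wstep IHn; last exact: leqW.
rewrite (@motzkin_run _ _ _ 1); last first.
  by rewrite /rho_weight gtn_eqF.
by rewrite rmorph1 mul1r /rho_var ltnNge (ltnW jr).
Qed.

Lemma run_mid j n : run j j n eps = tilt s0 (iter n (motzkin u v g y) eps).
Proof.
(* For n = 0 no step is left to carry the twist, but [tilt] is trivial on the indicator of height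
   0. *)
case: n => [|n]; apply/funext => h /=.
  by rewrite /tilt; case: h => [|h]; rewrite ?mulr0 // expr0 mul1r.
rewrite /wstep run_tail // (@motzkin_run _ _ _ (q ^ (p%:Z * h%:Z))); last first.
  by rewrite /rho_weight eqxx.
by rewrite /tilt /rho_var ltnn -PoszM -exprnP exprM rmorphXn.
Qed.

Lemma run_head i j n : (i <= j)%N ->
  run j (j - i) (i + n) eps = iter i (motzkin u v g x) (run j j n eps).
Proof.
elim: i => [|i IHi] ij; first by rewrite subn0.
rewrite addSn /= subnSK // IHi ?(ltnW ij) //; apply/funext => h.
rewrite /wstep (@motzkin_run _ _ _ 1); last first.
  by rewrite /rho_weight ltn_eqF // subnS; lia.
by rewrite rmorph1 mul1r /rho_var (_ : (j - i.+1 < j)%N) //; lia.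
Qed.

Definition path_sum k : R :=
  iter (N - k) (motzkin u v g x) (tilt s0 (iter k (motzkin u v g y) eps)) 0%N.

Lemma path_sum_words k : (k <= N)%N -> path_sum k =
  \sum_(l <- bwords N) \sum_(s <- bwords (count negb l))
     wpath g (rho_weight (N - k)) (rho_var (N - k))
       (fun H => iota (qpar q H)) 0 l s 0.
Proof.
move=> kN; rewrite wpath_sum /path_sum -(run_mid (N - k)) -run_head //.
by rewrite subnn subnK.
Qed.

(** [ladderE] assembles the path sums into [twisted_serre]; its weight t q^-1 q^N is 1 here. *)
Lemma serre_path_sums :
  \sum_(k < N.+1) iota ((-1) ^+ k * qbinom q N k) * path_sum k
  = asc u d t x y N.
Proof.
rewrite -(@twisted_serre_asc _ u v g s0 t uK tK d gE x y N).
pose X i j := iter i (motzkin u v g x) (tilt s0 (iter j (motzkin u v g y) eps)) 0%N : R^o.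
have lin a f1 f2 i : iter i (motzkin u v g x) (fun h => f1 h - a * f2 h)
    = (fun h => iter i (motzkin u v g x) f1 h - a * iter i (motzkin u v g x) f2 h).
  elim: i => //= i ->; apply/funext => -[|h]; rewrite /motzkin /=; ring.
have lad n i j : ladder (iota q) t X n i j
  = iter i (motzkin u v g x) (twisted_serre u v g s0 t x y n (iter j (motzkin u v g y) eps)) 0%N.
  elim: n i j => //= n IHn i j; rewrite !IHn lin -iterSr.
  by rewrite exprM /u rmorphXn.
have qK : iota q * iota q^-1 = 1 by rewrite -rmorphM divff ?rmorph1.
have := lad N 0%N 0%N; rewrite (ladderE qK) /= => <-.
apply: eq_bigr => k _; rewrite !add0n -/(path_sum k).
have kN : (k <= N)%N by rewrite -ltnS.
have -> : t * iota q^-1 * iota q ^+ N = 1.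
  rewrite -rmorphXn -!rmorphM exprSr -mulrA [q^-1 * _]mulrC mulfK //.
  by rewrite mulVf ?rmorph1 // expf_neq0.
rewrite expr1n mulr1 (qbinom_gauss q_neq0 q_nroot) // rmorphM rmorphXn rmorphN1.
congr (_ * _ * _).
exact: rmorph_gauss.
Qed.


Definition path_coef k (l s : seq bool) : F :=
  q ^ theta_exp (- p%:Z) l s k
  * \prod_(1 <= r < N.+1)
      qpar q (zeta l s r.-1 + 1) ^+ ((1 - bit l r) * bit s (r - bsum l 1 r)).

Lemma in_S_dyck m m' (s : seq bool) :
  size s = (N - m - m')%N -> in_S (- p%:Z) m m' s = dyck 0 s.
Proof.
move=> ss; rewrite /in_S /dyck (_ : `|1 - - p%:Z|%N = N); last by lia.
by rewrite ss add0n.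
Qed.

Lemma expz_sum I (r : seq I) (f : I -> int) :
  q ^ (\sum_(i <- r) f i) = \prod_(i <- r) q ^ f i.
Proof.
by apply: (big_morph _ _ (expr0z q)) => a b; rewrite expfzDr.
Qed.

Lemma bsum_split (l : seq bool) k : (k <= N)%N ->
  bsum l 1 N = (bsum l 1 (N - k) + bsum l (N.+1 - k) N)%N.
Proof.
move=> kN; rewrite /bsum (subSn kN) -big_cat_nat //.
by rewrite ltnS leq_subr.
Qed.

Lemma wpath_path_coef k m m' (l s : seq bool) :
  (k <= N)%N -> size l = N -> size s = count negb l ->
  in_L (- p%:Z) m m' k l ->
  wpath g (rho_weight (N - k)) (rho_var (N - k)) (fun H => iota (qpar q H)) 0 l s 0
  = (dyck 0 s)%:R * iota (path_coef k l s) * (x ^+ m * y ^+ m')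
    * g ^+ (N - m - m')./2.
Proof.
move=> kN sl ss /andP[]; rewrite (_ : `|1 - - p%:Z|%N = N); last by lia.
move=> /eqP lm /eqP lm'; rewrite wpathE // sl.
have [hd|_] := boolP (dyck 0 s); last by rewrite !mul0r.
have sN : size s = (N - m - m')%N.
  have := bsum_split l kN; rewrite lm lm' -sl bsum_size => e.
  by have := count_predC id l; rewrite sl ss; have : count negb l = count (predC id) l
    by []; lia.
have cs : (2 * count id s = size s)%N.
  by case/andP: hd => /eqP; rewrite add0n bsum_size.
have zN : zeta l s N = 0.
  rewrite /zeta (bsum_split l kN) lm lm' subnDA -sN bsum_size.
  have := bsum_split l kN; rewrite lm lm' => e; have := bsum_leq l N.
  by rewrite e; lia.
have -> : (size s - count id s = (N - m - m')./2)%N by rewrite -sN; lia.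
rewrite !mul1r -!mulrA mulrCA; rewrite !mulrA.
have e1 : \prod_(i < N) rho_weight (N - k) (0 + i) (0%:Z + zeta l s i)
          = iota (q ^ theta_exp (- p%:Z) l s k).
  rewrite /rho_weight -rmorph_prod; congr (iota _).
  rewrite big_split /= /theta_exp (_ : `|1 - - p%:Z|%N = N); last by lia.
  rewrite expfzDr // mulrC; congr (_ * _).
    rewrite opprK.
    (* For k = 0 the index N - k lies beyond the last step, and the twist is trivial because the
       path ends at height 0. *)
    have [k0|k0] := posnP k.
      rewrite k0 subn0 zN mulr0 expr0z big1 // => i _.
      by rewrite add0n ltn_eqF.
    have jN : (N - k < N)%N by lia.
    rewrite (bigD1 (Ordinal jN)) //= big1 ?mulr1 => [|i /negbTE ij].
      by rewrite add0r eqxx.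
    rewrite add0n; case: eqP => // e.
    by move: ij; rewrite -val_eqE /= e eqxx.
  rewrite big_add1 /= big_mkord mulr_sumr -sumrN expz_sum.
  by apply: eq_bigr => i _; rewrite add0r.
have e2 : \prod_(i < N) rho_var (N - k) (0 + i) ^+ bit l i.+1 = x ^+ m * y ^+ m'.
  rewrite -(big_mkord xpredT (fun i => rho_var (N - k) (0 + i) ^+ bit l i.+1)).
  rewrite (big_cat_nat (n := (N - k)%N)) ?leq_subr //=.
  rewrite -lm -lm' /bsum (subSn kN) !big_add1 /= !expr_sum.
  by congr (_ * _); rewrite !big_nat; apply: eq_bigr => i /andP[h1 h2];
    rewrite add0n /rho_var ?h2 // ltnNge h1.
have e3 : \prod_(i < N) iota (qpar q (0%:Z + zeta l s i + 1))
      ^+ ((1 - bit l i.+1) * bit s (i.+1 - bsum l 1 i.+1))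
   = iota (\prod_(1 <= r < N.+1) qpar q (zeta l s r.-1 + 1)
       ^+ ((1 - bit l r) * bit s (r - bsum l 1 r))).
  rewrite big_add1 /= big_mkord rmorph_prod; apply: eq_bigr => i _.
  by rewrite add0r rmorphXn.
by rewrite e1 e2 e3 /path_coef rmorphM; ring.
Qed.

(** A word lies in exactly one class, given by its numbers of level steps among the first N - k and
    the last k positions. *)
Lemma sum_in_L k (l : seq bool) (f : nat -> nat -> R) : (k <= N)%N -> size l = N ->
  \sum_(0 <= m < p) \sum_(0 <= m' < p - m)
     (if in_L (- p%:Z) m m' k l then f m m' else 0)
  = (if (count id l < p)%N
     then f (bsum l 1 (N - k)) (bsum l (N.+1 - k) N) else 0).
Proof.
move=> kN sl; have e := bsum_split l kN; rewrite -{1}sl bsum_size in e.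
rewrite e /in_L (_ : `|1 - - p%:Z|%N = N); last by lia.
set m0 := bsum l 1 _; set m1 := bsum l _ N.
have one n j (h : nat -> R) :
    \sum_(0 <= i < n) (if j == i then h i else 0) = if (j < n)%N then h j else 0.
  rewrite big_mkord -big_mkcond /=; case: ltnP => jn.
    by rewrite (big_pred1 (Ordinal jn)).
  by rewrite big_pred0 // => i; apply/negbTE; rewrite neq_ltn orbC (leq_trans _ jn).
transitivity (\sum_(0 <= m < p) (if m0 == m then
   if (m1 < p - m)%N then f m m1 else 0 else 0)).
  apply: eq_bigr => m _; rewrite -one; case: (m0 == m) => //=.
  by rewrite big1.
rewrite one; case: ltnP => h; last by rewrite ifF //; apply/negbTE; lia.
by congr (if _ then _ else _); lia.
Qed.

Definition words_sum k (l : seq bool) : R :=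
  \sum_(s <- bwords (count negb l))
     wpath g (rho_weight (N - k)) (rho_var (N - k)) (fun H => iota (qpar q H)) 0 l s 0.

Lemma words_sumE k m m' (l : seq bool) : (k <= N)%N -> size l = N ->
  in_L (- p%:Z) m m' k l ->
  words_sum k l =
  iota (\sum_(s <- bwords (N - m - m') | dyck 0 s) path_coef k l s)
  * (x ^+ m * y ^+ m') * g ^+ (N - m - m')./2.
Proof.
move=> kN sl lL; have cl : count negb l = (N - m - m')%N.
  have := bsum_split l kN; case/andP: lL; rewrite (_ : `|1 - - p%:Z|%N = N); last by lia.
  move=> /eqP -> /eqP ->; rewrite -{1}sl bsum_size.
  have := count_predC id l; have : count negb l = count (predC id) l by [].
  by rewrite sl; lia.
rewrite /words_sum cl rmorph_sum !mulr_suml [RHS]big_mkcond big_seq [RHS]big_seq.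
apply: eq_bigr => s; rewrite mem_bwords => /eqP ss.
rewrite (wpath_path_coef kN sl (etrans ss (esym cl)) lL); case: (dyck 0 s) => /=; last by rewrite !mul0r.
by rewrite mulr1n mul1r.
Qed.

Lemma in_L_refl k (l : seq bool) :
  in_L (- p%:Z) (bsum l 1 (N - k)) (bsum l (N.+1 - k) N) k l.
Proof. by rewrite /in_L (_ : `|1 - - p%:Z|%N = N) ?eqxx //; lia. Qed.

Lemma words_sum_true k : (k <= N)%N ->
  words_sum k (nseq N true) = x ^+ (N - k) * y ^+ k.
Proof.
move=> kN; set l := nseq N true.
have bl r : (r <= N)%N -> bsum l 1 r = r.
  rewrite /l; elim: (N) r => [|n IHn] [|r] //; rewrite ?bsum0 //.
  by move=> rn; rewrite bsum_cons IHn.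
have sl : size l = N by rewrite size_nseq.
have e : bsum l (N.+1 - k) N = k.
  by have := bsum_split l kN; rewrite !bl ?leq_subr //; lia.
have := in_L_refl k l; rewrite e bl ?leq_subr // => lL.
rewrite (words_sumE kN sl lL) (_ : (N - (N - k) - k = 0)%N); last by lia.
rewrite big_mkcond big_seq1 /= mulr1.
have z0 r : (r <= N)%N -> zeta l [::] r = 0.
  by move=> rN; rewrite /zeta bsum_nil bl // mulr0 add0r subrr.
rewrite /path_coef /theta_exp (_ : `|1 - - p%:Z|%N = N); last by lia.
have S0 : \sum_(1 <= r < N.+1) zeta l [::] r.-1 = 0.
  rewrite big_nat big1 // => r /andP[_ rN].
  by rewrite z0 // -ltnS (leq_trans _ rN) // ltnS leq_pred.
rewrite S0 z0 ?leq_subr // mulr0.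
rewrite mulr0 subrr expr0z mul1r big1 => [|r _]; last first.
  by rewrite /bit nth_nil muln0 expr0.
by rewrite /dyck /= bsum0 /= rmorph1 mul1r.
Qed.

(** A single non-level step cannot lead back to height 0. This accounts for the diagonal m + m' =
    -a, absent from the double sum. *)
Lemma words_sum_single k (l : seq bool) : (k <= N)%N -> size l = N ->
  count id l = p -> words_sum k l = 0.
Proof.
move=> kN sl cl; have bl : bsum l 1 N = p by rewrite -sl bsum_size.
rewrite (words_sumE kN sl (in_L_refl k l)) -subnDA -bsum_split // bl subSnn.
rewrite big_mkcond.
by rewrite /= big_cons big_seq1 /dyck /= !bsum_cons !bsum0 /= addr0 rmorph0 !mul0r.
Qed.

(** Paths sorted by their number of level steps: N of them give the Serre monomial, N - 1 give
    nothing, fewer give the terms with rho. *)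
Lemma path_sumE k : (k <= N)%N -> path_sum k = x ^+ (N - k) * y ^+ k
  + \sum_(0 <= m < p) \sum_(0 <= m' < p - m)
       \sum_(l <- bwords N | in_L (- p%:Z) m m' k l) words_sum k l.
Proof.
move=> kN; rewrite path_sum_words // -[LHS]/(\sum_(l <- bwords N) words_sum k l).
rewrite -words_sum_true // -[in RHS](big_bwords_true N (words_sum k)).
have -> : \sum_(0 <= m < p) \sum_(0 <= m' < p - m)
       \sum_(l <- bwords N | in_L (- p%:Z) m m' k l) words_sum k l
  = \sum_(l <- bwords N) (if (count id l < p)%N then words_sum k l else 0).
  transitivity (\sum_(l <- bwords N) \sum_(0 <= m < p) \sum_(0 <= m' < p - m)
      (if in_L (- p%:Z) m m' k l then words_sum k l else 0)).
    rewrite exchange_big; apply: eq_bigr => m _.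
    rewrite exchange_big; apply: eq_bigr => m' _.
    by rewrite -big_mkcond.
  rewrite big_seq [RHS]big_seq; apply: eq_bigr => l; rewrite mem_bwords => /eqP sl.
  exact: (@sum_in_L k l (fun _ _ => words_sum k l) kN sl).
rewrite [X in _ = X + _]big_mkcond -big_split big_seq [RHS]big_seq.
apply: eq_bigr => l; rewrite mem_bwords => /eqP sl /=.
have [al|al] := boolP (all id l).
  by move: al; rewrite all_count sl => /eqP ->; rewrite ltnNge leqnSn addr0.
rewrite add0r; case: ltnP => // cl; apply: words_sum_single => //.
by apply/eqP; rewrite eqn_leq cl andbT -ltnS -sl ltn_neqAle count_size -all_count al.
Qed.

Lemma rho_words_sum m m' : (m + m' <= N)%N ->
  iota (rho q c (- p%:Z) m m') * (z ^+ (N - m - m')./2 * x ^+ m * y ^+ m')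
  = - \sum_(k < N.+1) iota ((-1) ^+ k * qbinom q N k)
      * \sum_(l <- bwords N | in_L (- p%:Z) m m' k l) words_sum k l.
Proof.
move=> mN; set M := (N - m - m')%N.
pose D k := \sum_(l <- bwords N | in_L (- p%:Z) m m' k l)
  \sum_(s <- bwords M | dyck 0 s) path_coef k l s.
have e k : (k < N.+1)%N ->
    \sum_(l <- bwords N | in_L (- p%:Z) m m' k l) words_sum k l
    = iota (D k) * (x ^+ m * y ^+ m') * g ^+ M./2.
  rewrite ltnS => kN; rewrite rmorph_sum !mulr_suml big_seq_cond [RHS]big_seq_cond.
  apply: eq_bigr => l; rewrite mem_bwords => /andP[/eqP sl lL].
  by rewrite (words_sumE kN sl lL).
under eq_bigr => k _ do rewrite e //.
have rhoE : rho q c (- p%:Z) m m' =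
    ((- p%:Z + m%:Z + m'%:Z) %% 2)%Z%:~R * gam ^+ M./2 *
    - \sum_(k < N.+1) ((-1) ^+ k * qbinom q N k) * D k.
  rewrite /rho (_ : `|1 - - p%:Z|%N = N); last by lia.
  rewrite -/M -/gam; congr (_ * _).
  rewrite -sumrN -(big_mkord xpredT (fun k => - ((-1) ^+ k * qbinom q N k * D k))).
  (* The range of k extends to 0..N: outside m' <= k <= N - m one of the two blocks would need more
     level steps than it has positions. *)
  have D0 k l : (k < m')%N \/ (N - m < k)%N /\ (k <= N)%N ->
      in_L (- p%:Z) m m' k l = false.
    move=> kk; apply/negbTE/negP => /andP[]; rewrite (_ : `|1 - - p%:Z|%N = N); last by lia.
    move=> /eqP e1 /eqP e2; have := bsum_leq l (N - k).
    have : (bsum l (N.+1 - k) N <= N.+1 - (N.+1 - k))%N.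
      rewrite /bsum -[X in (_ <= X)%N]muln1 -sum_nat_const_nat.
      by apply: leq_sum => i _; rewrite /bit; case: nth.
    by rewrite e1 e2; lia.
  have h0 k : (k < m')%N \/ (N - m < k)%N /\ (k <= N)%N ->
      - ((-1) ^+ k * qbinom q N k * D k) = 0.
    by move=> kk; rewrite /D big_pred0 ?mulr0 ?oppr0 // => l; apply: D0.
  rewrite [RHS](big_cat_nat (n := m')) /=; [|lia..].
  rewrite [X in _ = X + _]big_nat [X in _ = X + _]big1 ?add0r; last first.
    by move=> k /andP[_ km]; apply: h0; left.
  rewrite [RHS](big_cat_nat (n := (N - m).+1)) /=; [|lia..].
  rewrite [X in _ = _ + X]big_nat [X in _ = _ + X]big1 ?addr0; last first.
    by move=> k /andP[k1 k2]; apply: h0; right; lia.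
  apply: eq_bigr => k _.
  rewrite (big_tuple_bwords N (in_L (- p%:Z) m m' k) (fun l =>
    \sum_(s : M.-tuple bool | in_S (- p%:Z) m m' s)
      (-1) ^+ k.+1 * qbinom q N k * q ^ theta_exp (- p%:Z) l s k
      * \prod_(1 <= r < N.+1) qpar q (zeta l s r.-1 + 1)
             ^+ ((1 - bit l r) * bit s (r - bsum l 1 r)))).
  rewrite /D !mulr_sumr -sumrN; apply: eq_bigr => l _.
  rewrite (big_tuple_bwords M (in_S (- p%:Z) m m') (fun s =>
      (-1) ^+ k.+1 * qbinom q N k * q ^ theta_exp (- p%:Z) l s k
      * \prod_(1 <= r < N.+1) qpar q (zeta l s r.-1 + 1)
             ^+ ((1 - bit l r) * bit s (r - bsum l 1 r)))).
  rewrite mulr_sumr -sumrN big_seq_cond [RHS]big_seq_cond.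
  apply: eq_big => [s|s _].
    by have [|//] := boolP (s \in bwords M); rewrite mem_bwords => /eqP /in_S_dyck ->.
  by rewrite exprS mulN1r /path_coef; ring.
(* For odd N - m - m' there is no balanced [s] and both sides vanish; otherwise the parity factor is
   1. *)
have [odM|evM] := boolP (odd M).
  have D0 k : D k = 0.
    rewrite /D big1 // => l _; rewrite big_seq_cond big1 // => s.
    by rewrite mem_bwords => /andP[/eqP ss /andP[/eqP]]; rewrite ss; lia.
  rewrite rhoE big1 => [|k _]; last by rewrite D0 mulr0.
  rewrite oppr0 mulr0 rmorph0 mul0r big1 ?oppr0 // => k _.
  by rewrite D0 rmorph0 !mul0r mulr0.
have -> : rho q c (- p%:Z) m m' =
    gam ^+ M./2 * - \sum_(k < N.+1) ((-1) ^+ k * qbinom q N k) * D k.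
  rewrite rhoE (_ : ((- p%:Z + m%:Z + m'%:Z) %% 2)%Z = 1) ?mul1r //.
  by move: evM; rewrite /M; lia.
rewrite mulrN rmorphN mulNr rmorphM rmorph_sum; congr (- _).
rewrite -mulrA mulrC !mulr_suml; apply: eq_bigr => k _.
have -> : g ^+ M./2 = iota (gam ^+ M./2) * z ^+ M./2.
  by rewrite (rmorphXn iota) -exprMn.
by rewrite (rmorphM iota (_ * qbinom q N k) (D k)); ring.
Qed.

(** The explicit formula for rho enters the later arguments through this identity, by way of
    [rho_relation_asc]. *)
Lemma rho_serre :
  \sum_(k < N.+1) iota ((-1) ^+ k * qbinom q N k) * (x ^+ (N - k) * y ^+ k)
  - \sum_(0 <= m < p) \sum_(0 <= m' < p - m)
       iota (rho q c (- p%:Z) m m') * (z ^+ (N - m - m')./2 * x ^+ m * y ^+ m')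
  = asc u d t x y N.
Proof.
rewrite -serre_path_sums.
have -> : \sum_(0 <= m < p) \sum_(0 <= m' < p - m)
    iota (rho q c (- p%:Z) m m') * (z ^+ (N - m - m')./2 * x ^+ m * y ^+ m')
  = - \sum_(k < N.+1) iota ((-1) ^+ k * qbinom q N k) *
      \sum_(0 <= m < p) \sum_(0 <= m' < p - m)
       \sum_(l <- bwords N | in_L (- p%:Z) m m' k l) words_sum k l.
  under [in RHS]eq_bigr => k _.
    rewrite mulr_sumr; under eq_bigr => m _ do rewrite mulr_sumr.
    over.
  rewrite exchange_big -sumrN; apply: eq_big_nat => m /andP[_ mp].
  rewrite exchange_big -sumrN; apply: eq_big_nat => m' /andP[_ mp'].
  by rewrite rho_words_sum //; lia.
rewrite opprK -big_split; apply: eq_bigr => k _ /=.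
by rewrite path_sumE ?mulrDr // -ltnS.
Qed.
End RhoFormula.

(** * Ladders of q-commutators *)

(* The square-zero extension F + W of F by a vector space W: a commutative    *)
(* ring in which the identities between linear combinations in W become ring  *)
(* identities, hence accessible to the ring tactic.                           *)
Section SquareZeroExtension.
Variables (F : fieldType) (W : lmodType F).

Definition sqzext := (F * W)%type.

HB.instance Definition _ := GRing.Zmodule.on sqzext.

Implicit Types x y : sqzext.

Definition sqz_one : sqzext := (1, 0).
Definition sqz_mul x y : sqzext := (x.1 * y.1, x.1 *: y.2 + y.1 *: x.2).

Fact sqz_mulA : associative sqz_mul.
Proof.
move=> x y w; rewrite /sqz_mul /= mulrA !scalerDr !scalerA -addrA [w.1 * y.1]mulrC.
by rewrite [x.1 * w.1]mulrC [w.1 * x.1]mulrC.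
Qed.
Fact sqz_mulC : commutative sqz_mul.
Proof. by move=> x y; rewrite /sqz_mul mulrC addrC. Qed.
Fact sqz_mul1 : left_id sqz_one sqz_mul.
Proof. by case=> a v; rewrite /sqz_mul /= mul1r scale1r scaler0 addr0. Qed.
Fact sqz_mulDl : left_distributive sqz_mul +%R.
Proof.
move=> [a v] [b w] [c x]; rewrite /sqz_mul /= mulrDl scalerDl scalerDr.
by rewrite addrACA.
Qed.
Fact sqz_one_neq0 : sqz_one != 0.
Proof. by apply/eqP => -[] /eqP; rewrite oner_eq0. Qed.

HB.instance Definition _ := GRing.Zmodule_isComNzRing.Build sqzext
  sqz_mulA sqz_mulC sqz_mul1 sqz_mulDl sqz_one_neq0.

Definition sqzC (c : F) : sqzext := (c, 0).
Definition sqzV (v : W) : sqzext := (0, v).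

Fact sqzC_zmod : zmod_morphism sqzC.
Proof. by move=> a b; congr pair; rewrite subr0. Qed.
Fact sqzC_monoid : monoid_morphism sqzC.
Proof. by split=> // a b; congr pair; rewrite /= !scaler0 addr0. Qed.
HB.instance Definition _ := GRing.isZmodMorphism.Build F sqzext sqzC sqzC_zmod.
HB.instance Definition _ := GRing.isMonoidMorphism.Build F sqzext sqzC sqzC_monoid.

Lemma sqzCM a b : sqzC (a * b) = sqzC a * sqzC b.
Proof. exact: rmorphM. Qed.

Lemma sqzVD v w : sqzV (v + w) = sqzV v + sqzV w.
Proof. by congr pair; rewrite addr0. Qed.
Lemma sqzVN v : sqzV (- v) = - sqzV v.
Proof. by congr pair; rewrite oppr0. Qed.
Lemma sqzV0 : sqzV 0 = 0.
Proof. by []. Qed.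
Lemma sqzVZ c v : sqzV (c *: v) = sqzC c * sqzV v.
Proof. by congr pair; rewrite /= ?mulr0 // scale0r addr0. Qed.

Lemma sqzV_inj : injective sqzV. Proof. by move=> v w []. Qed.
End SquareZeroExtension.

Ltac lmod_ring := apply: sqzV_inj; rewrite !(sqzV0, sqzVD, sqzVN, sqzVZ); ring.

Section TrivariateEvaluation.
Variables (F : fieldType) (E : algType F).

Definition poly3C : {rmorphism F -> {poly {poly {poly F}}}} :=
  polyC \o (polyC \o polyC).

Lemma commr_rmorph_poly (A : nzRingType) (f : {rmorphism A -> E}) (G T : E)
    (cfG : commr_rmorph f G) :
  commr_rmorph f T -> GRing.comm T G -> commr_rmorph (horner_morph cfG) T.
Proof.
move=> fT TG; elim/poly_ind => [|p c IHp].
  by rewrite rmorph0; apply: commr0.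
rewrite rmorphD rmorphM /= horner_morphX horner_morphC.
by apply: commrD; [apply: commrM|apply: fT].
Qed.

Lemma poly3_eval (L R G : E) :
  GRing.comm L R -> GRing.comm L G -> GRing.comm R G ->
  exists phi : {rmorphism {poly {poly {poly F}}} -> E},
    [/\ forall c, phi (poly3C c) = c%:A,
        phi 'X = L, phi ('X)%:P = R, phi (('X)%:P)%:P = G &
        forall T, GRing.comm T L -> GRing.comm T R -> GRing.comm T G ->
          forall p, GRing.comm T (phi p)].
Proof.
move=> LR LG RG.
have alg T : commr_rmorph (in_alg E) T.
  by move=> c; rewrite /GRing.comm /= mulr_algl mulr_algr.
pose f1 := horner_morph (alg G).
have c1 T : GRing.comm T G -> commr_rmorph f1 T.
  by move=> TG; apply: commr_rmorph_poly.
pose f2 := horner_morph (c1 R RG).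
have c2 T : GRing.comm T G -> GRing.comm T R -> commr_rmorph f2 T.
  by move=> TG TR; apply: commr_rmorph_poly => //; apply: (c1).
pose f3 := horner_morph (c2 L LG LR).
have h1 := horner_morphC (alg G); have h2 := horner_morphC (c1 R RG).
have h3 := horner_morphC (c2 L LG LR).
exists f3; split=> [c||||T TL TR TG].
- exact: (etrans (h3 _) (etrans (h2 _) (h1 c))).
- exact: horner_morphX.
- exact: (etrans (h3 _) (horner_morphX _)).
- exact: (etrans (h3 _) (etrans (h2 _) (horner_morphX _))).
- by apply: commr_rmorph_poly => //; apply: (c2).
Qed.
End TrivariateEvaluation.

Section OperatorLadder.
Variables (F : fieldType) (W : lmodType F) (w0 : W) (w0_neq0 : w0 != 0).
Local Notation E := (lend w0_neq0).
Variables (u t : F) (Lf Lg Rf Rg KL KR GL GR : E) (V : W).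
Hypothesis u_neq1 : 1 - u != 0.
Hypothesis Lgf : Lg * Lf = u *: (Lf * Lg) + GL + KL.
Hypothesis Rfg : Rf * Rg = u *: (Rg * Rf) + GR + KR.
Hypotheses (LgRf : GRing.comm Lg Rf) (RgLf : GRing.comm Rg Lf).
Hypotheses (GLf : GRing.comm GL Lf) (GLrf : GRing.comm GL Rf).
Hypotheses (GRf : GRing.comm GR Lf) (GRrf : GRing.comm GR Rf).
Hypotheses (KLf : KL * Lf = u ^+ 2 *: (Lf * KL)) (KLrf : GRing.comm KL Rf).
Hypotheses (KRf : Rf * KR = u ^+ 2 *: (KR * Rf)) (KRlf : GRing.comm KR Lf).
Hypotheses (LgV : Lg V = t *: Rg V) (GV : GL V = GR V) (KV : KL V = t ^+ 2 *: KR V).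

(** Abstract operators cover at once the multiplications by f on the two sides and, with the sides
    exchanged, the opposite algebra. *)
Fixpoint op_ladder (n : nat) : W :=
  if n is n'.+1 then Lf (op_ladder n') - (t * u ^+ n') *: Rf (op_ladder n')
  else V.

Lemma lend_comm (f g : E) x : GRing.comm f g -> f (g x) = g (f x).
Proof. by move=> fg; rewrite -lend_appM fg. Qed.

Lemma lendB (f : E) : {morph f : x y / x - y}.
Proof. by move=> x y; rewrite lendD -[- y]scaleN1r lendZ scaleN1r. Qed.

Lemma op_ladder_G n : GL (op_ladder n) = GR (op_ladder n).
Proof.
elim: n => [|n IHn]; first exact: GV.
rewrite /= !lendB !lendZ (lend_comm _ GLf) (lend_comm _ GRf).
by rewrite (lend_comm _ GLrf) (lend_comm _ GRrf) IHn.
Qed.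

(** With exactly this factor the terms KL and KR produced by [Lgf] and [Rfg] cancel in
    [op_ladder_g]. *)
Lemma op_ladder_K n :
  KL (op_ladder n) = (t * u ^+ n) ^+ 2 *: KR (op_ladder n).
Proof.
elim: n => [|n IHn]; first by rewrite expr0 mulr1; apply: KV.
rewrite /= !lendB !lendZ -lend_appM KLf lend_appZ lend_appM (lend_comm _ KLrf).
rewrite IHn !lendZ (lend_comm _ KRlf).
rewrite -[Rf (KR _)]lend_appM KRf lend_appZ lend_appM.
rewrite [u ^+ n.+1]exprS; lmod_ring.
Qed.

Definition ladder_coef n : F :=
  if n is n'.+1 then (1 - u ^+ n) * (1 - t ^+ 2 * u ^+ n') / (1 - u) else 0.

Lemma ladder_coefS n :
  ladder_coef n.+1 = u * ladder_coef n + (1 - (t * u ^+ n) ^+ 2).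
Proof.
case: n => [|n] /=; first by rewrite !expr0 expr1 mulr0 !mulr1 add0r; field.
by rewrite !exprS; field.
Qed.

(** Up to the twisted term in Rg, the operator Lg lowers the ladder; its coefficients are those of
    the recurrence of [asc] for d = G / (1 - u). *)
Lemma op_ladder_g n :
  Lg (op_ladder n) = (t * u ^+ n) *: Rg (op_ladder n)
                     + ladder_coef n *: GL (op_ladder n.-1).
Proof.
elim: n => [|n IHn]; first by rewrite expr0 mulr1 scale0r addr0; apply: LgV.
have -> : op_ladder n.+1 = Lf (op_ladder n) - (t * u ^+ n) *: Rf (op_ladder n) by [].
rewrite [n.+1.-1]/= ladder_coefS !lendB !lendZ.
have -> : Lg (Lf (op_ladder n)) = u *: Lf (Lg (op_ladder n))
    + GL (op_ladder n) + KL (op_ladder n) by rewrite -lend_appM Lgf.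
rewrite (lend_comm _ LgRf) (lend_comm _ RgLf) IHn !lendD !lendZ op_ladder_K.
have -> : Rf (Rg (op_ladder n)) = u *: Rg (Rf (op_ladder n)) + GL (op_ladder n)
    + KR (op_ladder n) by rewrite -lend_appM Rfg op_ladder_G.
rewrite -(lend_comm _ GLf) -(lend_comm _ GLrf) (lend_comm _ (esym RgLf)).
have main : ladder_coef n *: (u *: GL (Lf (op_ladder n.-1))
       - (t * u ^+ n) *: GL (Rf (op_ladder n.-1)))
     = (u * ladder_coef n) *: GL (op_ladder n).
  case: n {IHn} => [|n]; first by rewrite /= mulr0 !scale0r.
  have -> : op_ladder n.+1 = Lf (op_ladder n) - (t * u ^+ n) *: Rf (op_ladder n) by [].
  rewrite [n.+1.-1]/= lendB lendZ exprS; set e := ladder_coef _; lmod_ring.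
rewrite scalerDl -main [u ^+ n.+1]exprS; set e := ladder_coef _. lmod_ring.
Qed.

Lemma op_ladder_step n :
  (Lf + Lg) (op_ladder n) - (t * u ^+ n) *: (Rf + Rg) (op_ladder n)
  = op_ladder n.+1 + ladder_coef n *: GL (op_ladder n.-1).
Proof. by rewrite !lend_appD op_ladder_g; set e := ladder_coef n; lmod_ring. Qed.

(** The condition on d concerns ladder vectors only: in [rho_relation_right], phi d is a left
    multiplication whereas GL is a right one. *)
Lemma op_ladder_asc (S : comNzRingType) (ic : {rmorphism F -> S})
    (phi : {rmorphism S -> E}) (x y d : S) n :
  (forall c, phi (ic c) = c%:A) -> phi x = Lf + Lg -> phi y = Rf + Rg ->
  (forall k, phi d (op_ladder k) = (1 - u)^-1 *: GL (op_ladder k)) ->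
  phi (asc (ic u) d (ic t) x y n) V = op_ladder n.
Proof.
move=> phiC px py pd.
have step k (w : S) : phi ((x - ic t * ic u ^+ k * y) * w) V
    = (Lf + Lg) (phi w V) - (t * u ^+ k) *: (Rf + Rg) (phi w V).
  rewrite rmorphM rmorphB rmorphM px py -rmorphXn -rmorphM phiC mulr_algl.
  by rewrite mulrBl lend_appD.
suff: phi (asc (ic u) d (ic t) x y n) V = op_ladder n /\
      phi (asc (ic u) d (ic t) x y n.+1) V = op_ladder n.+1 by case.
elim: n => [|n [IH1 IH2]].
  rewrite asc1 [asc _ _ _ _ _ 0]/= rmorph1 lend_app1; split=> //.
  have := step 0%N 1; rewrite expr0 !mulr1 rmorph1 lend_app1 => ->.
  by have := op_ladder_step 0; rewrite expr0 mulr1 scale0r addr0.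
split=> //; rewrite ascS rmorphB lend_appD step IH2 op_ladder_step.
have -> : (1 - ic u ^+ n.+1) * (1 - ic t ^+ 2 * ic u ^+ n) * d
    * asc (ic u) d (ic t) x y n
  = ic ((1 - u ^+ n.+1) * (1 - t ^+ 2 * u ^+ n)) * (d * asc (ic u) d (ic t) x y n).
  by rewrite !(rmorphM, rmorphB, rmorph1, rmorphXn) mulrA.
rewrite rmorphM phiC mulr_algl rmorphM lend_appN lend_appZ lend_appM.
rewrite IH1 pd scalerA [_.+1.-1]/=.
by rewrite -[_ * (1 - u)^-1]/(ladder_coef n.+1) addrK.
Qed.
End OperatorLadder.

Section AlgebraLadder.
Variables (F : fieldType) (B : algType F).

Local Notation E := (lend (oner_neq0 B)).

Fact lmul_linear (b : B) : linear (fun x : B => b * x).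
Proof. by move=> c x y; rewrite mulrDr scalerAr. Qed.
Fact rmul_linear (b : B) : linear (fun x : B => x * b).
Proof. by move=> c x y; rewrite mulrDl scalerAl. Qed.

Definition lmul b : E := Lend _ (lmul_linear b).
Definition rmul b : E := Lend _ (rmul_linear b).

Lemma lmulE a x : lmul a x = a * x. Proof. by []. Qed.
Lemma rmulE a x : rmul a x = x * a. Proof. by []. Qed.

Lemma lmulM a b : lmul (a * b) = lmul a * lmul b.
Proof. by apply: lendP => x; rewrite /= -mulrA. Qed.
Lemma rmulM a b : rmul (a * b) = rmul b * rmul a.
Proof. by apply: lendP => x; rewrite /= mulrA. Qed.
Lemma lmulD a b : lmul (a + b) = lmul a + lmul b.
Proof. by apply: lendP => x; rewrite /= mulrDl. Qed.
Lemma rmulD a b : rmul (a + b) = rmul a + rmul b.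
Proof. by apply: lendP => x; rewrite /= mulrDr. Qed.
Lemma lmulZ c b : lmul (c *: b) = c *: lmul b.
Proof. by apply: lendP => x; rewrite /= scalerAl. Qed.
Lemma rmulZ c b : rmul (c *: b) = c *: rmul b.
Proof. by apply: lendP => x; rewrite /= scalerAr. Qed.
Lemma lmul_rmulC a b : GRing.comm (lmul a) (rmul b).
Proof. by apply: lendP => x; rewrite /= mulrA. Qed.
Lemma lmulC a b : GRing.comm a b -> GRing.comm (lmul a) (lmul b).
Proof. by move=> ab; rewrite /GRing.comm -!lmulM ab. Qed.
Lemma rmulC a b : GRing.comm a b -> GRing.comm (rmul a) (rmul b).
Proof. by move=> ab; rewrite /GRing.comm -!rmulM ab. Qed.
Lemma lmul1 : lmul 1 = 1.
Proof. by apply: lendP => x; rewrite /= mul1r. Qed.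

Lemma lmulX b n : lmul b ^+ n = lmul (b ^+ n).
Proof. by elim: n => [|n IHn]; rewrite ?lmul1 // !exprS IHn lmulM. Qed.
Lemma rmulX b n x : (rmul b ^+ n) x = x * b ^+ n.
Proof.
elim: n x => [|n IHn] x; first by rewrite !expr0 mulr1.
by rewrite exprSr lend_appM IHn /= -mulrA -exprS.
Qed.

Fixpoint qad (u t : F) (f V : B) (n : nat) : B :=
  if n is n'.+1 then f * qad u t f V n' - (t * u ^+ n') *: (qad u t f V n' * f)
  else V.

Variables (q : F) (p : nat).
Hypothesis q_neq0 : q != 0.
Hypothesis q_nroot : forall n, (0 < n)%N -> q ^+ n != 1.
Local Notation N := p.+1.
Local Notation u := (q ^+ 2).
Local Notation t := (q ^- p).

Lemma qserre_qad f V : qserre q N f V = qad u t f V N.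
Proof.
have lad n i j : ladder q t (fun i j => f ^+ i * V * f ^+ j) n i j
    = f ^+ i * qad u t f V n * f ^+ j.
  elim: n i j => //= n IHn i j; rewrite !IHn mulrBr mulrBl exprM.
  by rewrite -scalerAr -scalerAl [f ^+ i.+1]exprSr [f ^+ j.+1]exprS !mulrA.
have := lad N 0%N 0%N; rewrite expr0 mul1r mulr1 => <-.
rewrite (@ladderE F q q^-1) ?divff //; apply: eq_bigr => l _.
rewrite !add0n (qbinom_gauss q_neq0 q_nroot) -1?ltnS //; congr (_ *: _).
have -> : t * q^-1 * q ^+ N = 1.
  by rewrite exprSr -mulrA [q^-1 * _]mulrC mulfK // mulVf // expf_neq0.
by rewrite expr1n mulr1.
Qed.

Lemma op_ladder_lmul (f V : B) n : op_ladder u t (lmul f) (rmul f) V n = qad u t f V n.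
Proof. by elim: n => //= n ->. Qed.

Variable c : F.
Let gam : F := c * q ^+ 2 / (q - q^-1).

(** The relation of the theorem for p = -a, as a condition linear in V, so that B_j can be replaced
    by its summands. *)
Definition rho_relation (b Z V : B) : Prop :=
  qserre q N b V = \sum_(0 <= m < p) \sum_(0 <= m' < p - m)
    rho q c (- p%:Z) m m' *: (Z ^+ (N - m - m')./2 * b ^+ m * V * b ^+ m').

Local Notation S := {poly {poly {poly F}}}.
Local Notation PC := (poly3C F).

Definition asc3 (x y : S) : S :=
  asc (PC (q ^+ 2)) (PC (gam / (1 - q ^+ 2)) * ('X%:P)%:P) (PC (q ^- p)) x y N.

Lemma rho_relation_asc (b Z V : B) : GRing.comm Z b ->
  (forall phi : {rmorphism S -> E},
     (forall a, phi (PC a) = a%:A) -> phi 'X = lmul b -> phi 'X%:P = rmul b ->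
     phi ('X%:P)%:P = lmul Z ->
     (forall T, GRing.comm T (lmul b) -> GRing.comm T (rmul b) ->
        GRing.comm T (lmul Z) -> forall p, GRing.comm T (phi p)) ->
     phi (asc3 'X 'X%:P) V = 0) ->
  rho_relation b Z V.
Proof.
move=> Zb hV; have [phi [pC pX pY pZ pT]] := poly3_eval (lmul_rmulC b b)
  (lmulC (commr_sym Zb)) (commr_sym (lmul_rmulC Z b)).
have := hV phi pC pX pY pZ pT; rewrite /asc3 -(rho_serre c p q_neq0 q_nroot).
rewrite rmorphB lend_appD lend_appN => /subr0_eq.
rewrite !rmorph_sum !lend_app_sum => e; rewrite /rho_relation /qserre.
rewrite -[LHS]/(\sum_(l < N.+1) ((-1) ^+ l * qbinom q N l) *: (b ^+ (N - l) * V * b ^+ l)).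
transitivity (\sum_(k < N.+1)
   (phi (PC ((-1) ^+ k * qbinom q N k) * ('X ^+ (N - k) * 'X%:P ^+ k))) V).
  apply: eq_bigr => l _; rewrite rmorphM pC mulr_algl lend_appZ rmorphM.
  rewrite !rmorphXn pX pY lend_appM rmulX lmulX /= mulrA; congr (_ *: _).
  by rewrite mulrA.
rewrite e; apply: eq_bigr => m _; rewrite rmorph_sum lend_app_sum.
apply: eq_bigr => m' _; rewrite rmorphM pC mulr_algl lend_appZ; congr (_ *: _).
by rewrite !rmorphM !rmorphXn pX pY pZ !lend_appM rmulX !lmulX /= !mulrA.
Qed.
End AlgebraLadder.


(** * Sufficient conditions for the relation *)

(** The comparison of coefficients behind [torus_quad]. The unknowns alpha and beta solve a 2 by 2
    system of determinant D = (l^2 - U^2) / (l U). *)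
Lemma torus_scalars (F : fieldType) (gma s U l l' : F) :
  U != 0 -> U - 1 != 0 -> l * l' = 1 -> (l == U) || (l ^+ 2 != U ^+ 2) ->
  exists A alpha beta Bc, (l = U -> Bc = 0) /\ [/\
    l * l' + U * l' * l - (l' + l) * (l + U * l') + (1 + U) = A,
    l * s + U * s * l - (l' + l) * (l * s + U * s) + (s + U * s) = alpha * l + U * beta,
    l' * s + U^-1 * s * l' - (l' + l) * (l' * s + U^-1 * s) + (s + U^-1 * s)
      = alpha * l' + U^-1 * beta,
    s * s - gma * l' * l - (l' + l) * (s * s - gma * l') + (s * s - gma)
      = A * (gma * (U - 1)^-1 * U^-1) + Bc + alpha * s + beta * s &
    gma * l' * l - (l' + l) * (gma * l') + gma + (l' - l) ^+ 2 * (gma / (1 - U))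
      = A * (gma * (U - 1)^-1)].
Proof.
move=> u0 u1 ll hl.
have l0 : l != 0 by apply: contra_eq_neq ll => ->; rewrite mul0r eq_sym oner_neq0.
have l'E : l' = l^-1 by rewrite -[l']mul1r -(mulVf l0) -mulrA ll mulr1.
have u1' : 1 - U != 0 by rewrite -opprB oppr_eq0.
pose A := 1 + U - l ^+ 2 - U * l' ^+ 2.
pose c1 := l * (1 + U) - (l + l') * (l + U) + 1 + U.
pose c2 := l' * (1 + U^-1) - (l + l') * (l' + U^-1) + 1 + U^-1.
pose D := l * U^-1 - U * l'.
have [alpha [beta [e1 e2 e3]]] : exists alpha beta,
    [/\ c1 = alpha * l + U * beta, c2 = alpha * l' + U^-1 * beta &
        l = U -> 2 - l - l' - alpha - beta = 0].
  case/orP: hl => [/eqP lu|lu].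
    (* At l = U the system is degenerate and fixes only alpha + beta. This sum equals 2 - l - l',
       which is what makes Bc vanish. *)
    exists 0, (- (U - 1) ^+ 2 / U); rewrite /c1 /c2 l'E lu.
    by split=> [||_]; field.
  have DE : D * (l * U) = l ^+ 2 - U ^+ 2 by rewrite /D l'E; field; rewrite u0 l0.
  have D0 : D != 0.
    by apply: contra_neq lu => D0; apply/eqP; rewrite -subr_eq0 -DE D0 mul0r.
  pose x1 := c1 * U^-1 - U * c2; pose x2 := l * c2 - l' * c1.
  exists (x1 / D), (x2 / D); split=> [||lu']; last by rewrite lu' eqxx in lu.
    apply: (mulIf D0); transitivity (x1 * l + U * x2).
      by rewrite /x1 /x2 /D; ring.
    by rewrite -{1}[x1](divfK D0) -{1}[x2](divfK D0); ring.
  apply: (mulIf D0); transitivity (x1 * l' + U^-1 * x2).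
    by rewrite /x1 /x2 /D; ring.
  by rewrite -{1}[x1](divfK D0) -{1}[x2](divfK D0); ring.
pose delta := 2 - l - l' - alpha - beta.
exists A, (s * alpha), (s * beta),
  (- gma * (1 - l' ^+ 2) - A * gma * (U - 1)^-1 * U^-1 + s ^+ 2 * delta).
split=> [lu|].
  rewrite /delta (e3 lu) mulr0 addr0 /A l'E lu; field.
  by rewrite u0 u1.
split.
- by rewrite /A l'E; field; rewrite l0.
- transitivity (s * c1); first by rewrite /c1; ring.
  by rewrite e1; ring.
- transitivity (s * c2); first by rewrite /c2; ring.
  by rewrite e2; ring.
- by rewrite /delta /A l'E; field; rewrite l0 u0 u1.
- by rewrite /A l'E; field; rewrite l0 u1 u1'.
Qed.

Lemma eval_quadric (F : fieldType) (B : algType F) (S : comNzRingType)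
    (ic : {rmorphism F -> S}) (phi : {rmorphism S -> lend (oner_neq0 B)})
    (x y z : S) (e1 e2 e3 z0 : F) (b V : B) :
  (forall a, phi (ic a) = a%:A) -> phi x = lmul b -> phi y = rmul b ->
  phi z = lmul z0%:A ->
  phi (x ^+ 2 - (ic e1 + ic e2) * x * y + y ^+ 2 + (ic e1 - ic e2) ^+ 2 * (ic e3 * z)) V
  = b * (b * V) - (e1 + e2) *: (b * V * b) + V * b * b
    + ((e1 - e2) ^+ 2 * (e3 * z0)) *: V.
Proof.
move=> pC px py pz.
have -> : x ^+ 2 - (ic e1 + ic e2) * x * y + y ^+ 2 + (ic e1 - ic e2) ^+ 2 * (ic e3 * z)
  = x ^+ 2 - ic (e1 + e2) * (x * y) + y ^+ 2 + ic ((e1 - e2) ^+ 2 * e3) * z by ring.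
rewrite !(rmorphD phi) (rmorphN phi) !(rmorphM phi) !pC px py pz !mulr_algl.
rewrite !lend_appD lend_appN !lend_appZ !lend_appM !lmulE !rmulE.
by rewrite mulr_algl scalerA !mulrA.
Qed.

Lemma quadric_intertwine (F : fieldType) (B : algType F) (b b1 V : B) (e k : F) :
  b * V = V * b1 ->
  b * (b * V) - e *: (b * V * b) + V * b * b + k *: V
  = V * (b1 * b1 - e *: (b1 * b) + b * b + k *: 1).
Proof.
move=> bV; rewrite !mulrDr mulrN -!scalerAr mulr1 bV [b * (V * b1)]mulrA bV.
by rewrite !mulrA.
Qed.

Lemma lend_mul_lin4 (F : fieldType) (B : algType F) (g : lend (oner_neq0 B))
    (V x1 x2 x3 x4 : B) (a1 a2 a3 a4 : F) :
  g (V * (a1 *: x1 + a2 *: x2 + a3 *: x3 + a4 *: x4))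
  = a1 *: g (V * x1) + a2 *: g (V * x2) + a3 *: g (V * x3) + a4 *: g (V * x4).
Proof. by rewrite !mulrDr !lendD -!scalerAr !lendZ. Qed.

Section RhoRelations.
Variables (F : fieldType) (B : algType F) (q c : F).
Hypothesis q_neq0 : q != 0.
Hypothesis q_nroot : forall n, (0 < n)%N -> q ^+ n != 1.
Local Notation E := (lend (oner_neq0 B)).
Local Notation u := (q ^+ 2).
Local Notation S := {poly {poly {poly F}}}.
Let gam : F := c * q ^+ 2 / (q - q^-1).

(** f builds the ladder and g lowers it; its last rung is the Serre element of f and V. *)
Lemma rho_relation_left p (f g V Z K2 : B) :
  g * f = u *: (f * g) + gam *: Z + K2 ->
  GRing.comm Z f -> GRing.comm Z g -> GRing.comm Z V ->
  K2 * f = u ^+ 2 *: (f * K2) -> K2 * V = (q ^- p) ^+ 2 *: (V * K2) ->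
  g * V = q ^- p *: (V * g) -> qserre q p.+1 f V = 0 ->
  rho_relation q p c (f + g) Z V.
Proof.
move=> gf Zf Zg ZV Kf KV gV sV.
apply: rho_relation_asc => //; first exact: commrD.
move=> phi pC pX pY pZ _; set G := gam *: Z.
have Gc x : GRing.comm Z x -> GRing.comm G x.
  by rewrite /GRing.comm /G -scalerAl -scalerAr => ->.
have Lgf : lmul g * lmul f = u *: (lmul f * lmul g) + lmul G + lmul K2.
  by rewrite -!lmulM gf !lmulD lmulZ.
have Rfg : rmul f * rmul g = u *: (rmul g * rmul f) + rmul G + rmul K2.
  by rewrite -!rmulM gf !rmulD rmulZ.
have KLf : lmul K2 * lmul f = u ^+ 2 *: (lmul f * lmul K2).
  by rewrite -!lmulM Kf lmulZ.
have KRf : rmul f * rmul K2 = u ^+ 2 *: (rmul K2 * rmul f).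
  by rewrite -!rmulM Kf rmulZ.
have pd : phi (poly3C F (gam / (1 - u)) * 'X%:P%:P) = (1 - u)^-1 *: lmul G.
  by rewrite rmorphM pC mulr_algl pZ lmulZ scalerA [_ * gam]mulrC.
have pd' k : phi (poly3C F (gam / (1 - u)) * 'X%:P%:P)
      (op_ladder u (q ^- p) (lmul f) (rmul f) V k)
    = (1 - u)^-1 *: lmul G (op_ladder u (q ^- p) (lmul f) (rmul f) V k).
  by rewrite pd.
rewrite /asc3 (op_ladder_asc (sqB1_neq0 q_nroot) Lgf Rfg (lmul_rmulC g f)
  (commr_sym (lmul_rmulC f g)) (lmulC (Gc _ Zf)) (lmul_rmulC G f)
  (commr_sym (lmul_rmulC f G)) (rmulC (Gc _ Zf)) KLf (lmul_rmulC K2 f) KRf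
  (commr_sym (lmul_rmulC f K2)) gV (Gc _ ZV) KV _ pC _ _ pd').
- by rewrite op_ladder_lmul -qserre_qad.
- by rewrite pX lmulD.
- by rewrite pY rmulD.
Qed.

(** With the sides exchanged the Serre polynomial is read backwards; the symmetry of the binomials
    leaves only the sign. *)
Lemma qserre_op_ladder_right p (g V : B) :
  op_ladder u (q ^- p) (rmul g) (lmul g) V p.+1
  = (-1) ^+ p.+1 *: qserre q p.+1 g V.
Proof.
have lad n i j : ladder q (q ^- p) (fun i j => g ^+ j * V * g ^+ i) n i j
    = g ^+ j * op_ladder u (q ^- p) (rmul g) (lmul g) V n * g ^+ i.
  elim: n i j => //= n IHn i j; rewrite !IHn mulrBr mulrBl exprM.
  by rewrite -scalerAr -scalerAl [g ^+ i.+1]exprS [g ^+ j.+1]exprSr !mulrA.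
have := lad p.+1 0%N 0%N; rewrite expr0 mul1r mulr1 => <-.
rewrite (@ladderE F q q^-1) ?divff // /qserre scaler_sumr.
rewrite [RHS](reindex_inj rev_ord_inj) /=; apply: eq_bigr => l _.
have lp : (l <= p.+1)%N by rewrite -ltnS.
rewrite !add0n subSS (subKn lp) scalerA; congr (_ *: _).
have -> : q ^- p * q^-1 * q ^+ p.+1 = 1.
  by rewrite exprSr -mulrA [q^-1 * _]mulrC mulfK // mulVf // expf_neq0.
rewrite expr1n mulr1 -/(gauss q q^-1 p.+1 l) -(qbinom_gauss q_neq0 q_nroot lp).
rewrite mulrA; congr (_ * _).
  rewrite -exprD -signr_odd -[in RHS]signr_odd; congr (_ ^+ nat_of_bool _).
  by rewrite oddD oddB //; case: (odd l); case: (odd _).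
by rewrite /qbinom (subKn lp); congr (_ / _); rewrite mulrC.
Qed.

(** Now g builds the ladder and f lowers it, with left and right exchanged. This yields [asc] with x
    and y interchanged, which [asc_sym] undoes. *)
Lemma rho_relation_right p (f g V Z K2 : B) :
  g * f = u *: (f * g) + gam *: Z + K2 ->
  GRing.comm Z f -> GRing.comm Z g -> GRing.comm Z V ->
  g * K2 = u ^+ 2 *: (K2 * g) -> V * K2 = (q ^- p) ^+ 2 *: (K2 * V) ->
  V * f = q ^- p *: (f * V) -> qserre q p.+1 g V = 0 ->
  rho_relation q p c (f + g) Z V.
Proof.
move=> gf Zf Zg ZV Kg KV fV sV.
apply: rho_relation_asc => //; first exact: commrD.
move=> phi pC pX pY pZ _; set G := gam *: Z.
have Gc x : GRing.comm Z x -> GRing.comm G x.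
  by rewrite /GRing.comm /G -scalerAl -scalerAr => ->.
have Lgf : rmul f * rmul g = u *: (rmul g * rmul f) + rmul G + rmul K2.
  by rewrite -!rmulM gf !rmulD rmulZ.
have Rfg : lmul g * lmul f = u *: (lmul f * lmul g) + lmul G + lmul K2.
  by rewrite -!lmulM gf !lmulD lmulZ.
have KLf : rmul K2 * rmul g = u ^+ 2 *: (rmul g * rmul K2).
  by rewrite -!rmulM Kg rmulZ.
have KRf : lmul g * lmul K2 = u ^+ 2 *: (lmul K2 * lmul g).
  by rewrite -!lmulM Kg lmulZ.
have KV' : rmul K2 V = (q ^- p) ^+ 2 *: lmul K2 V by [].
have pd k : phi (poly3C F (gam / (1 - u)) * 'X%:P%:P)
      (op_ladder u (q ^- p) (rmul g) (lmul g) V k)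
    = (1 - u)^-1 *: rmul G (op_ladder u (q ^- p) (rmul g) (lmul g) V k).
  rewrite rmorphM pC mulr_algl pZ lend_appZ.
  rewrite (op_ladder_G u (q ^- p) (rmulC (Gc _ Zg)) (commr_sym (lmul_rmulC g G))
    (lmul_rmulC G g) (lmulC (Gc _ Zg)) (esym (Gc _ ZV))).
  by rewrite lmulZ lend_appZ scalerA mulrC.
have qK : poly3C F q * poly3C F q^-1 = 1 by rewrite -rmorphM divff ?rmorph1.
have tq : poly3C F (q ^- p) * poly3C F q ^+ p.+1 = poly3C F q.
  rewrite -(rmorphXn (poly3C F)) -(rmorphM (poly3C F)); congr (poly3C F _).
  by rewrite exprSr mulrA mulVf ?mul1r // expf_neq0.
have := asc_sym (poly3C F (gam / (1 - u)) * 'X%:P%:P) qK 'X 'X%:P tq.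
rewrite -(rmorphXn (poly3C F)) /asc3 => ->; rewrite (rmorphM phi) lend_appM.
rewrite (op_ladder_asc (sqB1_neq0 q_nroot) Lgf Rfg (commr_sym (lmul_rmulC g f))
  (lmul_rmulC f g) (rmulC (Gc _ Zg)) (commr_sym (lmul_rmulC g G))
  (lmul_rmulC G g) (lmulC (Gc _ Zg)) KLf (commr_sym (lmul_rmulC g K2)) KRf
  (lmul_rmulC K2 g) fV (esym (Gc _ ZV)) KV' _ pC _ _ pd).
- by rewrite qserre_op_ladder_right sV scaler0 lend0.
- by rewrite pY addrC rmulD addrC.
- by rewrite pX addrC lmulD addrC.
Qed.

(** * Torus elements V: reduction by a Casimir element *)

Section Torus.
Variables (f y k k' : B) (gma s z0 : F).
Hypotheses (kf : k * f = u *: (f * k)) (yk : y * k = u *: (k * y)).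
Hypothesis yf : y * f = u *: (f * y) + gma *: (1 - k * k).
Hypotheses (kK : k * k' = 1) (k'K : k' * k = 1).
Hypothesis gmaE : gam * z0 = gma.
Let b : B := f + (y + s *: k).
Let A2 : F := (u - 1)^-1.

Fact u_neq0 : u != 0. Proof. exact: expf_neq0. Qed.
Fact uB1_neq0 : u - 1 != 0. Proof. by rewrite subr_eq0 q_nroot. Qed.

(** Normally ordered quadratic expressions; equality is then checked coefficient by coefficient. *)
Definition lc7 (a1 a2 a3 a4 a5 a6 a7 : F) : B :=
  a1 *: (f * f) + a2 *: (f * y) + a3 *: (y * y) + a4 *: (f * k) + a5 *: (y * k)
  + a6 *: (k * k) + a7 *: 1.

Lemma ky : k * y = u^-1 *: (y * k).
Proof. by rewrite yk scalerA mulVf ?u_neq0 // scale1r. Qed.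

Lemma mul_lin3 a1 a2 a3 b1 b2 b3 :
  (a1 *: f + a2 *: y + a3 *: k) * (b1 *: f + b2 *: y + b3 *: k)
  = lc7 (a1 * b1) (a1 * b2 + u * a2 * b1) (a2 * b2) (a1 * b3 + u * a3 * b1)
      (a2 * b3 + u^-1 * a3 * b2) (a3 * b3 - gma * a2 * b1) (gma * a2 * b1).
Proof.
rewrite !mulrDl !mulrDr -!scalerAl -!scalerAr kf ky yf /lc7; lmod_ring.
Qed.

Lemma lc7D a1 a2 a3 a4 a5 a6 a7 b1 b2 b3 b4 b5 b6 b7 :
  lc7 a1 a2 a3 a4 a5 a6 a7 + lc7 b1 b2 b3 b4 b5 b6 b7
  = lc7 (a1 + b1) (a2 + b2) (a3 + b3) (a4 + b4) (a5 + b5) (a6 + b6) (a7 + b7).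
Proof. rewrite /lc7; lmod_ring. Qed.

Lemma lc7Z e a1 a2 a3 a4 a5 a6 a7 :
  e *: lc7 a1 a2 a3 a4 a5 a6 a7
  = lc7 (e * a1) (e * a2) (e * a3) (e * a4) (e * a5) (e * a6) (e * a7).
Proof. rewrite /lc7; lmod_ring. Qed.

(* k times the Casimir element of the algebra generated by f, y and k. *)
Definition casimir_k : B := lc7 0 1 0 0 0 (gma * A2 * u^-1) (gma * A2).

Definition casimir : B := casimir_k * k'.

Lemma fk' : k' * f = u^-1 *: (f * k').
Proof.
have fk : f * k = u^-1 *: (k * f) by rewrite kf scalerA mulVf ?u_neq0 // scale1r.
transitivity (k' * (f * k) * k'); first by rewrite -!mulrA kK mulr1.
by rewrite fk -scalerAr -scalerAl mulrA k'K mul1r.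
Qed.

Lemma yk' : k' * y = u *: (y * k').
Proof.
transitivity (k' * (y * k) * k'); first by rewrite -!mulrA kK mulr1.
by rewrite yk -scalerAr -scalerAl mulrA k'K mul1r.
Qed.

Lemma casimir_kE : casimir_k = f * y + (gma * A2) *: 1 + (gma * A2 * u^-1) *: (k * k).
Proof. rewrite /casimir_k /lc7; lmod_ring. Qed.

(** These are the commutation factors of k itself, so that dividing by k gives an element commuting
    with f and y. *)
Lemma casimir_k_comm : casimir_k * f = u *: (f * casimir_k)
  /\ y * casimir_k = u *: (casimir_k * y).
Proof.
have Hu : sqzC B u * sqzC B u^-1 = 1 by rewrite -rmorphM divff ?rmorph1 ?u_neq0.
have HA : sqzC B u * sqzC B A2 = 1 + sqzC B A2.
  rewrite -rmorphM -(rmorph1 (sqzC B)) -rmorphD; congr sqzC.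
  by rewrite /A2; field; rewrite uB1_neq0.
have T1 : f * y * f = u *: (f * (f * y)) + gma *: (f - f * (k * k)).
  by rewrite -mulrA yf mulrDr -!scalerAr mulrBr mulr1.
have T2 : k * k * f = u *: (u *: (f * (k * k))).
  by rewrite -mulrA kf -scalerAr [k * (f * k)]mulrA kf -scalerAl -mulrA.
have T3 : y * (f * y) = u *: (f * y * y) + gma *: (y - k * k * y).
  by rewrite mulrA yf mulrDl -!scalerAl mulrBl mul1r.
have T4 : y * (k * k) = u *: (u *: (k * k * y)).
  by rewrite [y * (k * k)]mulrA yk -scalerAl -[k * y * k]mulrA yk -scalerAr [k * (k * y)]mulrA.
rewrite casimir_kE !mulrDl !mulrDr -!scalerAl -!scalerAr !mul1r !mulr1.
rewrite T1 T2 T3 T4; move: Hu HA; set U := sqzC B u; set e := sqzC B A2.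
set U' := sqzC B u^-1 => Hu HA.
have red (G m0 m1 m2 : sqzext B) :
    U * m0 + G * (m1 - m2) + (G * e * m1 + G * e * U' * (U * (U * m2)))
    = U * (m0 + G * e * m1 + G * e * U' * m2).
  transitivity (U * m0 + G * (1 + e) * m1 + (G * (U * e) * (U * U') - G) * m2).
    by ring.
  rewrite HA Hu.
  transitivity (U * m0 + G * (U * e) * m1 + G * e * (U * U') * m2); last by ring.
  by rewrite HA Hu; ring.
have UE : sqzC B q * sqzC B q = U by rewrite /U expr2 sqzCM.
split; apply: sqzV_inj; rewrite !(sqzVD, sqzVN, sqzVZ, sqzCM) -/U' -/e !UE.
  by rewrite -red; ring.
by rewrite -red; ring.
Qed.

Lemma casimir_comm :
  [/\ GRing.comm casimir f, GRing.comm casimir y & GRing.comm casimir k].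
Proof.
have [Df yD] := casimir_k_comm.
have Dk : casimir_k * k = k * casimir_k.
  rewrite casimir_kE !mulrDl !mulrDr -!scalerAl -!scalerAr mul1r mulr1 mulrA.
  by rewrite -[f * y * k]mulrA yk -scalerAr mulrA kf -scalerAl !mulrA.
split.
- rewrite /GRing.comm /casimir -mulrA fk' -scalerAr !mulrA Df -scalerAl scalerA.
  by rewrite mulVf ?u_neq0 // scale1r.
- rewrite /GRing.comm /casimir -mulrA yk' -scalerAr [RHS]mulrA yD -scalerAl mulrA.
  by [].
- by rewrite /GRing.comm /casimir -mulrA k'K mulr1 mulrA -Dk -mulrA kK mulr1.
Qed.

(** The quadratic factor of [asc] acts on V as right multiplication by the left-hand side. The
    right-hand side is arranged so that the remaining factor kills V times each summand. *)
Lemma torus_quad (l l' : F) : l * l' = 1 -> (l == u) || (l ^+ 2 != u ^+ 2) ->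
  let b1 := l *: f + l' *: y + s *: k in
  exists A alpha beta Bc, (l = u -> Bc = 0) /\
    b1 * b1 - (l' + l) *: (b1 * b) + b * b
      + ((l' - l) ^+ 2 * (gma / (1 - u))) *: 1
    = A *: casimir_k + Bc *: (k * k) + alpha *: (b1 * k) + beta *: (k * b).
Proof.
move=> ll hl b1.
have [A [alpha [beta [Bc [hB [e2 e4 e5 e6 e7]]]]]] :=
  torus_scalars gma s u_neq0 uB1_neq0 ll hl.
exists A, alpha, beta, Bc; split=> //.
have bE : b = 1 *: f + 1 *: y + s *: k by rewrite !scale1r /b addrA.
have kE : k = 0 *: f + 0 *: y + 1 *: k by rewrite !scale0r scale1r !add0r.
rewrite -scaleNr /b1 bE; have -> : k * (1 *: f + 1 *: y + s *: k)
  = (0 *: f + 0 *: y + 1 *: k) * (1 *: f + 1 *: y + s *: k) by rewrite -kE.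
have -> : (l *: f + l' *: y + s *: k) * k
  = (l *: f + l' *: y + s *: k) * (0 *: f + 0 *: y + 1 *: k) by rewrite -kE.
have -> : k * k = lc7 0 0 0 0 0 1 0 by rewrite /lc7 !scale0r !add0r scale1r addr0.
have -> : 1 = lc7 0 0 0 0 0 0 1 by rewrite /lc7 !scale0r !add0r scale1r.
rewrite /casimir_k !mul_lin3 !lc7Z !lc7D /A2.
have l1 : l * l - l' * l - l * l + 1 = 0 by rewrite [l' * l]mulrC ll; ring.
have l2 : l' * l' - l' * l' - l * l' + 1 = 0 by rewrite ll; ring.
move: u e2 e4 e5 e6 e7 => U e2 e4 e5 e6 e7; congr lc7.
- by transitivity (l * l - l' * l - l * l + 1); [ring|rewrite l1; ring].
- by rewrite -[A]mulr1 -{}e2; ring.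
- by transitivity (l' * l' - l' * l' - l * l' + 1); [ring|rewrite l2; ring].
- by transitivity (alpha * l + U * beta); [rewrite -e4|]; ring.
- by transitivity (alpha * l' + U^-1 * beta); [rewrite -e5|]; ring.
- transitivity (A * (gma * (U - 1)^-1 * U^-1) + Bc + alpha * s + beta * s); last by ring.
  by rewrite -e6; ring.
- by transitivity (A * (gma * (U - 1)^-1)); [rewrite -e7|]; ring.
Qed.
(** For V = K_j^-1 one has r = -a_ij / 2, so evenness of a_ij keeps these powers of u integral. *)
Definition torus_weight (r : nat) (V : B) : Prop :=
  [/\ f * V = u ^+ r *: (V * f), y * V = u ^- r *: (V * y) & GRing.comm k V].

Lemma torus_weightS r V : torus_weight r.+1 V -> torus_weight r (V * k).
Proof.
case=> fV yV kV; split; last by rewrite /GRing.comm mulrA kV.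
  rewrite mulrA fV -scalerAl -!mulrA kf -!scalerAr !scalerA exprSr.
  by [].
rewrite mulrA yV -scalerAl -!mulrA yk -!scalerAr !scalerA; congr (_ *: _).
by rewrite [u ^+ r.+1]exprS invfM mulrAC mulVf ?mul1r // u_neq0.
Qed.

Local Notation PC := (poly3C F).
Let dS : S := PC (gam / (1 - u)) * ('X%:P)%:P.
Let tas r : S := asc (PC u) dS (PC (q ^- (2 * r))) 'X 'X%:P (2 * r).+1.

Lemma tasS r : tas r.+1 =
  ('X ^+ 2 - (PC (q ^- (2 * r.+1)) + PC (q ^+ (2 * r.+1))) * 'X * 'X%:P + 'X%:P ^+ 2
   + (PC (q ^- (2 * r.+1)) - PC (q ^+ (2 * r.+1))) ^+ 2 * dS) * tas r.
Proof.
have qK : PC q * PC q^-1 = 1 by rewrite -rmorphM divff ?rmorph1.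
have tq : PC (q ^- (2 * r.+1)) * PC q ^+ (2 * r.+1).+1 = PC q.
  rewrite -(rmorphXn PC) -(rmorphM PC); congr (PC _).
  by rewrite exprSr mulrA mulVf ?mul1r // expf_neq0.
have e : ((2 * r.+1).+1 = (2 * r).+1.+2)%N by lia.
have e' : (2 * r.+1 = (2 * r).+2)%N by lia.
have := asc_factorq dS qK 'X 'X%:P (m := (2 * r).+1) (t := PC (q ^- (2 * r.+1))).
rewrite -e => /(_ tq).
rewrite -(rmorphXn PC) /tas => ->; rewrite -e' (rmorphXn PC (2 * r.+1) q).
congr (_ * asc _ _ _ _ _ _).
rewrite -(rmorphM PC); congr (PC _); rewrite e' !exprS !invfM -!mulrA.
by field; rewrite q_neq0 expf_neq0.
Qed.

(** Induction on r: splitting off a quadratic factor replaces V by V k, of weight one less, up to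
    multiplications by b and by the Casimir element, which commute with phi. *)
Lemma torus_vanish (phi : {rmorphism S -> E}) r V :
  (forall a, phi (PC a) = a%:A) -> phi 'X = lmul b -> phi 'X%:P = rmul b ->
  phi ('X%:P)%:P = lmul (z0%:A) ->
  (forall T, GRing.comm T (lmul b) -> GRing.comm T (rmul b) ->
     GRing.comm T (lmul z0%:A) -> forall p, GRing.comm T (phi p)) ->
  torus_weight r V -> phi (tas r) V = 0.
Proof.
move=> pC pX pY pZ pT; elim/ltn_ind: r V => -[|r] IHr V [fV yV kV].
  have bV : b * V = V * b.
    rewrite mulrDl mulrDl mulrDr mulrDr fV yV expr0 invr1 !scale1r.
    by rewrite -scalerAl -scalerAr kV.
  rewrite /tas muln0 asc1 expr0 invr1 (rmorph1 PC) mul1r (rmorphB phi) pX pY.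
  by rewrite lend_appD lend_appN lmulE rmulE bV subrr.
have qu n : q ^+ (2 * n) = u ^+ n by rewrite exprM.
set l := u ^+ r.+1 in fV; set l' := u ^- r.+1 in yV.
have ll : l * l' = 1 by rewrite divff // expf_neq0 // u_neq0.
have hl : (l == u) || (l ^+ 2 != u ^+ 2).
  case: r @l @l' {IHr fV yV ll} => [|r] l l'; first by rewrite /l expr1 eqxx.
  apply/orP; right; rewrite /l -!exprM.
  have -> : (2 * (r.+2 * 2) = 2 * 2 + 4 * r.+1)%N by lia.
  rewrite exprD -subr_eq0 -[X in _ - X]mulr1 -mulrBr mulf_neq0 ?expf_neq0 //.
  by rewrite subr_eq0 q_nroot.
have zc T : GRing.comm T (lmul z0%:A).
  by apply: lendP => x; rewrite !lend_appM !lmulE !mulr_algl lendZ.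
have phiV0 r' W : (r' < r.+1)%N -> torus_weight r' W -> phi (tas r') W = 0.
  by move=> rr hW; apply: IHr.
have wk := torus_weightS (And3 fV yV kV).
have vk : phi (tas r) (V * k) = 0 by apply: phiV0.
have [cf cy ck] := casimir_comm.
have cb : GRing.comm casimir b.
  by apply: commrD => //; apply: commrD => //; rewrite /GRing.comm -scalerAr -scalerAl ck.
pose b1 := l *: f + l' *: y + s *: k.
have bV : b * V = V * b1.
  rewrite /b /b1 !mulrDl !mulrDr fV yV -!scalerAr -scalerAl kV addrA.
  by [].
have [A [alpha [beta [Bc [hB hQ]]]]] := torus_quad ll hl.
rewrite tasS mulrC (rmorphM phi) lend_appM.
set RS := (X in phi X V).
have -> : phi RS V = V * (b1 * b1 - (l' + l) *: (b1 * b) + b * b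
      + ((l' - l) ^+ 2 * (gma / (1 - u))) *: 1).
  rewrite /RS !qu -/l -/l' (eval_quadric _ _ _ _ pC pX pY pZ).
  rewrite -/b1 (quadric_intertwine _ _ bV) -gmaE.
  by rewrite (mulrAC gam (1 - u)^-1 z0).
rewrite hQ lend_mul_lin4.
have r1 : phi (tas r) (V * casimir_k) = 0.
  have -> : V * casimir_k = rmul casimir (V * k).
    by rewrite rmulE -mulrA -ck /casimir -mulrA k'K mulr1.
  rewrite -lend_appM -(pT (rmul casimir)) ?lend_appM ?vk ?lend0 //.
    exact: commr_sym (lmul_rmulC _ _).
  exact: rmulC.
have r2 : phi (tas r) (V * (b1 * k)) = 0.
  rewrite mulrA -bV -mulrA -lmulE -lend_appM -(pT (lmul b)) ?lend_appM ?vk ?lend0 //.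
  exact: lmul_rmulC.
have r3 : phi (tas r) (V * (k * b)) = 0.
  rewrite mulrA -rmulE -lend_appM -(pT (rmul b)) ?lend_appM ?vk ?lend0 //.
  exact: commr_sym (lmul_rmulC _ _).
(* V k^2 has dropped by two weights, so one more quadratic factor is split off. For r = 0 there is
   none left, but then l = u and Bc = 0. *)
have r4 : Bc *: phi (tas r) (V * (k * k)) = 0.
  case: r @l @l' {IHr} phiV0 wk hB {fV yV ll hl bV b1 hQ vk RS r1 r2 r3} => [|r] l l' phiV0 wk hB.
    by rewrite hB ?scale0r // /l expr1.
  rewrite tasS (rmorphM phi) lend_appM mulrA (phiV0 r) ?lend0 ?scaler0 //.
  exact: torus_weightS.
by rewrite r1 r2 r3 r4 !scaler0 !addr0.
Qed.

Lemma rho_relation_torus r V :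
  torus_weight r V -> rho_relation q (2 * r) c b z0%:A V.
Proof.
move=> hV; apply: rho_relation_asc => // [|phi pC pX pY pZ pT].
  by rewrite /GRing.comm mulr_algl mulr_algr.
exact: torus_vanish.
Qed.
End Torus.
End RhoRelations.

(** * Non-vanishing of E_i *)

Section SerreCommutation.
Variables (F : fieldType) (B : algType F) (x : F) (p : nat).
Hypothesis x_neq0 : x != 0.
Hypothesis x_nroot : forall n, (0 < n)%N -> x ^+ n != 1.
Local Notation u := (x ^+ 2).
Local Notation t := (x ^- p).

Lemma qad_eigen (m : F) (f V : B) n : f * V = m *: (V * f) ->
  qad u t f V n = (\prod_(r < n) (m - t * u ^+ r)) *: (V * f ^+ n).
Proof.
move=> fV; elim: n => [|n IHn]; first by rewrite big_ord0 scale1r mulr1.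
rewrite /= IHn big_ord_recr /= -scalerAr mulrA fV -!scalerAl -!mulrA -exprS -exprSr.
by rewrite !scalerA -scalerBl; congr (_ *: _); ring.
Qed.

(** m = t kills the first and m = x^p = t u^p the last factor of the product in [qad_eigen]. *)
Lemma qserre_eigen (m : F) (f V : B) :
  (m == t) || (m == x ^+ p) -> f * V = m *: (V * f) -> qserre x p.+1 f V = 0.
Proof.
move=> hm fV; rewrite qserre_qad // (qad_eigen _ fV).
suff -> : \prod_(r < p.+1) (m - t * u ^+ r) = 0 by rewrite scale0r.
case/orP: hm => /eqP ->.
  by rewrite big_ord_recl expr0 mulr1 subrr mul0r.
rewrite big_ord_recr /= -exprM mul2n -addnn exprD mulKf ?subrr ?mulr0 //.
exact: expf_neq0.
Qed.

Lemma qserreBr (f V W : B) : qserre x p.+1 f (V - W) = qserre x p.+1 f V - qserre x p.+1 f W.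
Proof.
by rewrite /qserre -sumrB; apply: eq_bigr => l _; rewrite mulrBr mulrBl scalerBr.
Qed.

Lemma qserreZr c (f V : B) : qserre x p.+1 f (c *: V) = c *: qserre x p.+1 f V.
Proof.
rewrite /qserre scaler_sumr; apply: eq_bigr => l _.
by rewrite -scalerAr -scalerAl !scalerA mulrC.
Qed.

Lemma qserre_commutator (e f V : B) : GRing.comm e f ->
  e * qserre x p.+1 f V - qserre x p.+1 f V * e = qserre x p.+1 f (e * V - V * e).
Proof.
move=> ef; rewrite qserreBr /qserre mulr_sumr mulr_suml.
congr (_ - _); apply: eq_bigr => l _; rewrite -?scalerAr -?scalerAl; congr (_ *: _).
  by rewrite !mulrA (commrX _ ef).
by rewrite -!mulrA (commrX _ ef).
Qed.

(** The commutator of e with each q-commutator is a multiple of the preceding one times K. At the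
    last step the multiple is the sum of d (1/m_r - m_r), which cancels because m_r m_(p-r) = 1. *)
Lemma qserre_comm_opposite (d : F) (e f V K K' : B) :
  e * f - f * e = d *: (K - K') -> GRing.comm e V ->
  K * f = x ^- 2 *: (f * K) -> K' * f = x ^+ 2 *: (f * K') ->
  K * V = x ^+ p *: (V * K) -> K' * V = t *: (V * K') ->
  GRing.comm e (qserre x p.+1 f V).
Proof.
move=> ef eV Kf Kf' KV KV'; rewrite qserre_qad //.
pose v n := qad u t f V n; pose m n := t * u ^+ n.
have vS n : v n.+1 = f * v n - m n *: (v n * f) by [].
have vE n : v n = qad u t f V n by [].
have mE n : m n = t * u ^+ n by [].
have m0 n : m n != 0 by rewrite mE mulf_neq0 ?invr_eq0 ?expf_neq0.
have mS n : m n.+1 = u * m n by rewrite !mE exprS mulrCA.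
have v0 : v 0%N = V by [].
have mt : m 0%N = t by rewrite mE expr0 mulr1.
rewrite -vE; clearbody v m.
have mV n : (m n.+1)^-1 = x ^- 2 * (m n)^-1 by rewrite mS invfM.
have Kv n : K * v n = (m n)^-1 *: (v n * K).
  elim: n => [|n IHn]; first by rewrite mt invrK v0.
  rewrite vS mulrBr mulrBl -!scalerAr -!scalerAl !mulrA Kf IHn -!scalerAl -!mulrA Kf.
  by rewrite IHn -!scalerAr mV !mulrA; lmod_ring.
have Kv' n : K' * v n = m n *: (v n * K').
  elim: n => [|n IHn]; first by rewrite mt v0.
  rewrite vS mulrBr mulrBl -!scalerAr -!scalerAl !mulrA Kf' IHn -!scalerAl -!mulrA Kf'.
  by rewrite IHn -!scalerAr mS !mulrA; lmod_ring.
have main n : e * v n.+1 - v n.+1 * e =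
    (\sum_(r < n.+1) d * ((m r)^-1 - m r)) *: (v n * K).
  elim: n => [|n IHn].
    rewrite big_ord1 vS v0 mulrBr mulrBl -scalerAr -scalerAl.
    have e1 : e * f = f * e + d *: (K - K') by rewrite -ef addrC subrK.
    rewrite mulrA e1 mulrDl [e * (V * f)]mulrA eV -[V * e * f]mulrA e1 mulrDr.
    rewrite -!scalerAl -!scalerAr mulrBl mulrBr KV KV' -[f * V * e]mulrA -eV mt invrK.
    rewrite -[f * e * V]mulrA -[V * f * e]mulrA; lmod_ring.
  rewrite big_ord_recr /=; set cc := \sum_(r < n.+1) _ in IHn *.
  have e1 : e * f = f * e + d *: (K - K') by rewrite -ef addrC subrK.
  have e2 : e * v n.+1 = v n.+1 * e + cc *: (v n * K) by rewrite -IHn addrC subrK.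
  rewrite [v n.+2]vS mulrBr mulrBl -scalerAr -scalerAl.
  rewrite mulrA e1 mulrDl [e * (v n.+1 * f)]mulrA e2 mulrDl.
  rewrite -[v n.+1 * e * f]mulrA e1 mulrDr -[f * e * _]mulrA e2 mulrDr.
  rewrite -!scalerAl -!scalerAr mulrBl mulrBr Kv Kv' -[v n * K * f]mulrA Kf.
  rewrite -!scalerAr !mulrA.
  have -> : f * v n * K = v n.+1 * K + m n *: (v n * f * K).
    by rewrite vS mulrBl -scalerAl subrK.
  have -> : x ^- 2 = m n / m n.+1 by apply: (mulIf (m0 n.+1)); rewrite divfK // mS mulKf // expf_neq0.
  have k1 : m n.+1 * (m n / m n.+1) = m n by rewrite mulrCA divff ?mulr1.
  move: k1; set b := m n / m n.+1 => k1; rewrite -{1}k1; clearbody b.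
  lmod_ring.
have mm r : (r < p.+1)%N -> (m (p - r)%N)^-1 = m r.
  rewrite ltnS => rp; apply: (mulIf (m0 (p - r)%N)); rewrite mulVf // !mE mulrACA.
  rewrite -exprD (subnKC rp) -exprM mul2n -addnn exprD mulrACA.
  by rewrite mulVf ?mulr1 // expf_neq0.
apply/eqP; rewrite -subr_eq0 main -mulr_sumr sumrB [X in X - _](reindex_inj rev_ord_inj).
under [X in X - _]eq_bigr => r _ do rewrite /= subSS mm //.
by rewrite subrr mulr0 scale0r.
Qed.
End SerreCommutation.

Section NontrivialRepresentation.
Variables (F : fieldType) (q : F) (n : nat) (A : 'M[int]_n) (eps : 'I_n -> nat).
Hypothesis q_neq0 : q != 0.
Hypothesis q_nroot : forall m, (0 < m)%N -> q ^+ m != 1.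
Hypothesis hA : symmetrizable_GCM A eps.
Local Notation qi := (qi q eps).

Lemma qi_neq0 i : qi i != 0. Proof. exact: expf_neq0. Qed.

Lemma qi_nroot i m : (0 < m)%N -> qi i ^+ m != 1.
Proof. by move=> m0; rewrite -exprM q_nroot // muln_gt0 (gcm_eps_gt0 hA). Qed.

Lemma gcm_offdiagE i j : i != j -> A i j = - (`|A i j|%N)%:Z.
Proof. by move=> /(gcm_offdiag hA); lia. Qed.

Lemma gcm_serre_degree i j : i != j -> `|1 - A i j|%N = (`|A i j|%N).+1.
Proof. by move=> /(gcm_offdiag hA); lia. Qed.

Lemma qi_sym i j : qi i ^ A i j = qi j ^ A j i.
Proof. by rewrite /Defs.qi !exprnP !exprz_exp (gcm_sym hA). Qed.

Definition wordfun := seq 'I_n -> F^o.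
Implicit Types (g : wordfun) (w : seq 'I_n).

Fact vac_neq0 : ((fun w => (w == [::])%:R) : wordfun) != 0.
Proof.
apply/negP => /eqP/(congr1 (fun g : wordfun => g [::])) /= /eqP.
by rewrite oner_eq0.
Qed.
Local Notation E := (lend vac_neq0).
Let vac : wordfun := fun w => (w == [::])%:R.

(** The eigenvalue of K_k on words. The leading q_k is its value on [vac], chosen so that E_k F_k
    fixes [vac]. *)
Definition kap (k : 'I_n) w : F := qi k * \prod_(l <- w) qi k ^ (- A k l).
Definition kbr (k : 'I_n) w : F := (kap k w - (kap k w)^-1) / (qi k - (qi k)^-1).

Lemma kap_cons k l w : kap k (l :: w) = qi k ^ (- A k l) * kap k w.
Proof. by rewrite /kap big_cons mulrCA. Qed.

Lemma kap_neq0 k w : kap k w != 0.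
Proof.
elim: w => [|l w IHw]; first by rewrite /kap big_nil mulr1 qi_neq0.
by rewrite kap_cons mulf_neq0 // expfz_neq0 ?qi_neq0.
Qed.

(* A lowest weight action of U_q on functions of words in I, in which E_k     *)
(* shifts by the letter k and kills the vacuum vac. The Serre relations of    *)
(* the E_k are only verified on the submodule generated by vac.               *)
Definition efun k g : wordfun := fun w => g (k :: w).
Fixpoint ffun_ k g w : F :=
  if w is l :: w' then
    ffun_ k (efun l g) w' + (k == l)%:R * kbr k w' * g w'
  else 0.
Definition kfun k g : wordfun := fun w => kap k w * g w.
Definition kvfun k g : wordfun := fun w => (kap k w)^-1 * g w.

Fact efun_linear k : linear (efun k). Proof. by []. Qed.
Fact kfun_linear k : linear (kfun k).
Proof.
by move=> c g h; apply/funext => w; rewrite /kfun mulrDr; congr (_ + _);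
  apply: mulrCA.
Qed.
Fact kvfun_linear k : linear (kvfun k).
Proof.
by move=> c g h; apply/funext => w; rewrite /kvfun mulrDr; congr (_ + _);
  apply: mulrCA.
Qed.
Fact ffun_linear k : linear (ffun_ k : wordfun -> wordfun).
Proof.
move=> c g h; apply/funext => w; elim: w g h => [|l w IHw] g h.
  by rewrite /= -[RHS]/(c * 0 + 0) mulr0 addr0.
rewrite /= -[efun l _]/(c *: efun l g + efun l h) IHw.
rewrite -[LHS]/(c * ffun_ k (efun l g) w + ffun_ k (efun l h) w
  + (k == l)%:R * kbr k w * (c * g w + h w)).
rewrite -[RHS]/(c * (ffun_ k (efun l g) w + (k == l)%:R * kbr k w * g w)
  + (ffun_ k (efun l h) w + (k == l)%:R * kbr k w * h w)).
by ring.
Qed.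

Definition rep_op (x : gen n) : E :=
  match x with
  | GE k => Lend _ (@efun_linear k)
  | GF k => Lend _ (@ffun_linear k)
  | GK k => Lend _ (@kfun_linear k)
  | GKV k => Lend _ (@kvfun_linear k)
  end.
Local Notation e k := (rep_op (GE k)).
Local Notation f k := (rep_op (GF k)).
Local Notation K k := (rep_op (GK k)).
Local Notation KV k := (rep_op (GKV k)).

Lemma rep_KK' k : K k * KV k = 1 /\ KV k * K k = 1.
Proof.
by split; apply: lendP => g; apply/funext => w;
  rewrite lend_appM /= /kfun /kvfun mulrA ?mulfV ?mulVf ?kap_neq0 ?mul1r.
Qed.

Lemma rep_KKC i j : GRing.comm (K i) (K j).
Proof. by apply: lendP => g; apply/funext => w; apply: mulrCA. Qed.

Lemma rep_KE i j : K i * e j = qi i ^ A i j *: (e j * K i).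
Proof.
apply: lendP => g; apply/funext => w; rewrite !lend_appM lend_appZ lend_appM.
rewrite -[RHS]/(qi i ^ A i j * (kap i (j :: w) * g (j :: w))) kap_cons.
by rewrite !mulrA -expfzDr ?qi_neq0 // subrr expr0z mul1r.
Qed.

Lemma rep_KF i j : K i * f j = qi i ^ (- A i j) *: (f j * K i).
Proof.
apply: lendP => g; apply/funext => w; rewrite !lend_appM lend_appZ lend_appM.
rewrite -[LHS]/(kap i w * ffun_ j g w) -[RHS]/(qi i ^ (- A i j) * ffun_ j (kfun i g) w).
elim: w g => [|l w IHw] g /=; first by rewrite !mulr0.
have -> : efun l (kfun i g) = qi i ^ (- A i l) *: kfun i (efun l g).
  by apply/funext => w'; rewrite /efun /kfun kap_cons -mulrA.
have -> : ffun_ j (qi i ^ (- A i l) *: kfun i (efun l g)) w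
    = qi i ^ (- A i l) * ffun_ j (kfun i (efun l g)) w.
  by rewrite -[ffun_ j _]/(f j _) lendZ.
rewrite kap_cons.
transitivity (qi i ^ (- A i l) * (kap i w * ffun_ j (efun l g) w)
   + qi i ^ (- A i l) * kap i w * ((j == l)%:R * kbr j w * g w)).
  by rewrite mulrDr; congr (_ + _); apply/esym/mulrA.
rewrite IHw -[kfun i g w]/(kap i w * g w) mulrDr; congr (_ + _).
  by rewrite mulrCA.
have [->|_] := eqVneq j l; last by rewrite !mul0r !mulr0.
by rewrite !mul1r -mulrA; congr (_ * _); apply: mulrCA.
Qed.

Lemma rep_EF i j : e i * f j - f j * e i
  = ((i == j)%:R / (qi i - (qi i)^-1)) *: (K i - KV i).
Proof.
apply: lendP => g; apply/funext => w.
rewrite lend_appD lend_appN !lend_appM lend_appZ lend_appD lend_appN.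
rewrite -[LHS]/(ffun_ j (efun i g) w + (j == i)%:R * kbr j w * g w - ffun_ j (efun i g) w).
rewrite -[RHS]/(((i == j)%:R / (qi i - (qi i)^-1)) * (kap i w * g w - (kap i w)^-1 * g w)).
rewrite addrAC subrr add0r [j == i]eq_sym; have [->|_] := eqVneq i j.
  by rewrite !mul1r -mulrBl [RHS]mulrA; congr (_ * _); apply: mulrC.
by rewrite !mul0r.
Qed.

Lemma rep_KVF i j : KV i * f j = qi i ^ (A i j) *: (f j * KV i).
Proof.
have [k1 k2] := rep_KK' i.
have fK : f j * K i = qi i ^ (A i j) *: (K i * f j).
  by rewrite rep_KF scalerA -expfzDr ?qi_neq0 // subrr expr0z scale1r.
transitivity (KV i * (f j * K i) * KV i); first by rewrite -!mulrA k1 mulr1.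
by rewrite fK -scalerAr -scalerAl mulrA k2 mul1r.
Qed.

Lemma rep_KVE i j : KV i * e j = qi i ^ (- A i j) *: (e j * KV i).
Proof.
have [k1 k2] := rep_KK' i.
have eK : e j * K i = qi i ^ (- A i j) *: (K i * e j).
  by rewrite rep_KE scalerA -expfzDr ?qi_neq0 // addNr expr0z scale1r.
transitivity (KV i * (e j * K i) * KV i); first by rewrite -!mulrA k1 mulr1.
by rewrite eK -scalerAr -scalerAl mulrA k2 mul1r.
Qed.

Lemma qi_exp i j : i != j ->
  qi i ^ (A i j) = qi i ^- `|A i j|%N /\ qi i ^ (- A i j) = qi i ^+ `|A i j|%N.
Proof.
by move=> /gcm_offdiagE h; split; rewrite {1}h ?opprK // -exprnN.
Qed.

(** Covers both halves of the algebra. For k = j the commutator is the Serre element of b_i and kk_j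
    - kk'_j, killed by [qserre_eigen]. *)
Lemma qserre_opposite_comm (B : algType F) (a b : 'I_n -> B) (kk kk' : 'I_n -> B)
    (d : 'I_n -> F) i j k :
  (forall i j, a i * b j - b j * a i = ((i == j)%:R * d i) *: (kk i - kk' i)) ->
  (forall i j, kk i * b j = qi i ^ (- A i j) *: (b j * kk i)) ->
  (forall i j, kk' i * b j = qi i ^ (A i j) *: (b j * kk' i)) ->
  i != j -> GRing.comm (a k) (qserre (qi i) `|1 - A i j|%N (b i) (b j)).
Proof.
move=> ab kb kb' ij; rewrite gcm_serre_degree //.
have ab0 r l : r != l -> GRing.comm (a r) (b l).
  by move=> /negbTE rl; apply/eqP; rewrite -subr_eq0 ab rl mul0r scale0r.
have [e1 e2] := qi_exp ij.
have [ki|ki] := eqVneq k i.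
  rewrite ki; apply: (@qserre_comm_opposite _ _ _ _ (qi_neq0 i) (@qi_nroot i) (d i)
    _ _ _ (kk i) (kk' i)).
  - by rewrite ab eqxx mul1r.
  - exact: ab0.
  - by rewrite kb (gcm_diag hA).
  - by rewrite kb' (gcm_diag hA).
  - by rewrite kb e2.
  - by rewrite kb' e1.
apply/eqP; rewrite -subr_eq0 (qserre_commutator _ _ _ (ab0 _ _ ki)).
rewrite ab qserreZr qserreBr; have [kj|kj] := eqVneq k j; last by rewrite mul0r scale0r.
rewrite kj; have bk : b i * kk j = qi i ^- `|A i j|%N *: (kk j * b i).
  by rewrite kb scalerA -e1 (qi_sym i j) -expfzDr ?qi_neq0 // subrr expr0z scale1r.
have bk' : b i * kk' j = qi i ^+ `|A i j|%N *: (kk' j * b i).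
  rewrite kb' scalerA -e2 (_ : qi i ^ (- A i j) = qi j ^ (- A j i)).
    by rewrite -expfzDr ?qi_neq0 // addNr expr0z scale1r.
  by rewrite -!invr_expz qi_sym.
have x0 := qi_neq0 i; have xn := @qi_nroot i.
rewrite (@qserre_eigen _ _ _ _ x0 xn _ _ _ _ bk) ?eqxx //.
rewrite (@qserre_eigen _ _ _ _ x0 xn _ _ _ _ bk') ?eqxx ?orbT //.
by rewrite subrr scaler0.
Qed.


(** The value of a function at k :: w is that of its E_k-image at w. As the Serre element commutes
    with all E_k, only the empty word matters, where images of F_k vanish. *)
Lemma rep_SerreF i j : i != j ->
  qserre (qi i) `|1 - A i j|%N (f i) (f j) = 0.
Proof.
move=> ij; set S := qserre _ _ _ _.
have Se k : GRing.comm (e k) S.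
  exact: (@qserre_opposite_comm E (fun k => e k) (fun k => f k) (fun k => K k)
    (fun k => KV k) (fun k => (qi k - (qi k)^-1)^-1) i j k rep_EF rep_KF rep_KVF ij).
have S0 x : S x [::] = 0.
  rewrite /S /qserre lend_app_sum.
  rewrite (big_morph (fun g : wordfun => g [::]) (id1 := 0) (op1 := +%R)) // big1 // => l _.
  rewrite lend_appZ !lend_appM; set y := (f i ^+ l) x.
  have z m : ((f i ^+ m) (f j y)) [::] = 0.
    by case: m => [|m]; rewrite ?expr0 ?exprS.
  exact: etrans (congr1 (fun a => _ * a) (z _)) (mulr0 _).
apply: lendP => x; apply/funext => w; elim: w x => [|k w IHw] x; first exact: S0.
by rewrite -[LHS]/(e k (S x) w) -lend_appM Se lend_appM IHw.
Qed.

Definition fword w : wordfun := foldr (fun k => f k) vac w.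

Lemma fword_cons k w : fword (k :: w) = f k (fword w). Proof. by []. Qed.

Inductive lowest_submodule : wordfun -> Prop :=
| lowest0 : lowest_submodule 0
| lowestD c w v : lowest_submodule v ->
    lowest_submodule (c *: fword w + v).

Lemma lowest_add v v' :
  lowest_submodule v -> lowest_submodule v' -> lowest_submodule (v + v').
Proof.
elim=> [|c w {}v _ IHv] hv'; first by rewrite add0r.
by rewrite -addrA; apply: lowestD; apply: IHv.
Qed.

Lemma lowest_scale c v : lowest_submodule v -> lowest_submodule (c *: v).
Proof.
elim=> [|a w {}v _ IHv]; first by rewrite scaler0; apply: lowest0.
by rewrite scalerDr scalerA; apply: lowestD.
Qed.

Lemma lowest_lin (T : E) :
  (forall w, lowest_submodule (T (fword w))) ->
  forall v, lowest_submodule v -> lowest_submodule (T v).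
Proof.
move=> Tw v; elim=> [|a w {}v _ IHv]; first by rewrite lend0; apply: lowest0.
by rewrite lendD lendZ; apply: lowest_add => //; apply: lowest_scale.
Qed.

Lemma lowest_word w : lowest_submodule (fword w).
Proof.
by rewrite -[fword w]scale1r -[_ *: _]addr0; apply: lowestD; apply: lowest0.
Qed.

Lemma rep_e_vac k : e k vac = 0.
Proof. exact/funext. Qed.

Lemma lowest_op (x : gen n) v : lowest_submodule v -> lowest_submodule (rep_op x v).
Proof.
have Kw k w : exists a b, K k (fword w) = a *: fword w
    /\ KV k (fword w) = b *: fword w.
  elim: w => [|l w [a [b [IH1 IH2]]]].
    exists (kap k [::]), (kap k [::])^-1.
    by split; apply/funext => -[|l w] //; rewrite -[LHS]/(_ * 0) -[RHS]/(_ * 0) !mulr0.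
  exists (qi k ^ (- A k l) * a), (qi k ^ A k l * b); rewrite fword_cons; split.
    by rewrite -lend_appM rep_KF lend_appZ lend_appM IH1 lendZ scalerA.
  by rewrite -lend_appM rep_KVF lend_appZ lend_appM IH2 lendZ scalerA.
move: v; case: x => k; apply: lowest_lin => w.
- elim: w => [|l w IHw]; first by rewrite rep_e_vac; apply: lowest0.
  have ef : e k * f l = f l * e k + ((k == l)%:R / (qi k - (qi k)^-1)) *: (K k - KV k).
    by rewrite -rep_EF addrC subrK.
  rewrite fword_cons -lend_appM ef lend_appD lend_appM lend_appZ lend_appD lend_appN.
  apply: lowest_add.
    by apply: (lowest_lin (T := f l)) => // w'; apply: (lowest_word (l :: w')).
  have [a [b [-> ->]]] := Kw k w; rewrite -scaleNr.
  by apply/lowest_scale/lowest_add; apply/lowest_scale/lowest_word.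
- exact: (lowest_word (k :: w)).
- by have [a [b [-> _]]] := Kw k w; apply/lowest_scale/lowest_word.
- by have [a [b [_ ->]]] := Kw k w; apply/lowest_scale/lowest_word.
Qed.

(** This Serre element commutes with all F_k and kills [vac], hence kills everything generated from
    [vac] by the F_k. *)
Lemma rep_SerreE i j v : i != j -> lowest_submodule v ->
  qserre (qi i) `|1 - A i j|%N (e i) (e j) v = 0.
Proof.
move=> ij; set S := qserre _ _ _ _.
have Sf k : GRing.comm (f k) S.
  apply: (@qserre_opposite_comm E (fun k => f k) (fun k => e k) (fun k => KV k)
    (fun k => K k) (fun k => (qi k - (qi k)^-1)^-1) i j k _ rep_KVE rep_KE ij) => r l.
  rewrite -opprB rep_EF eq_sym -scalerN opprB.
  by have [->|] := eqVneq l r; rewrite ?mul0r ?scale0r.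
elim=> [|c w {}v _ IHv]; first exact: lend0.
rewrite lendD lendZ {}IHv addr0.
suff -> : S (fword w) = 0 by rewrite scaler0.
elim: w => [|k w IHw]; last by rewrite fword_cons -lend_appM -Sf lend_appM IHw lend0.
rewrite /S /qserre lend_app_sum big1 // => l _; rewrite lend_appZ !lend_appM.
suff -> : e j ((e i ^+ l) vac) = 0 by rewrite lend0 scaler0.
by case: (l : nat) => [|m]; rewrite ?expr0 ?exprSr ?lend_appM rep_e_vac ?lend0.
Qed.

Definition rep_monom (m : {fmonom gen n}) : E := \prod_(g <- (m : seq (gen n))) rep_op g.

Fact rep_monom_mmorphism : mmorphism rep_monom.
Proof.
split=> [m m'|]; first by rewrite /rep_monom fmM big_cat.
by rewrite /rep_monom fm1 big_nil.
Qed.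

HB.instance Definition _ :=
  monalg.isMultiplicative.Build {fmonom gen n} E rep_monom rep_monom_mmorphism.

Definition rep_eval_fun (x : {malg F[{fmonom gen n}]}) : E :=
  mmap (in_alg E) rep_monom x.

Fact rep_eval_zmod : zmod_morphism rep_eval_fun.
Proof. by move=> x y; rewrite /rep_eval_fun raddfB. Qed.
Fact rep_eval_monoid : monoid_morphism rep_eval_fun.
Proof.
have [|h1 h2] := @commr_mmap_is_multiplicative _ _ _ (in_alg E) rep_monom.
  by move=> g m m'; rewrite /GRing.comm /= mulr_algl mulr_algr.
by split.
Qed.
HB.instance Definition _ := GRing.isZmodMorphism.Build _ _ rep_eval_fun rep_eval_zmod.
HB.instance Definition _ :=
  GRing.isMonoidMorphism.Build _ _ rep_eval_fun rep_eval_monoid.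

Definition rep_eval : {rmorphism {malg F[{fmonom gen n}]} -> E} := rep_eval_fun.

Lemma in_algM c (T : E) : in_alg E c * T = c *: T.
Proof. exact: mulr_algl. Qed.

Lemma rep_eval_gen (x : gen n) : rep_eval (free_gen F x) = rep_op x.
Proof.
by rewrite /rep_eval /free_gen /= /rep_eval_fun mmapU in_algM scale1r /rep_monom
  fmU big_seq1.
Qed.

Lemma rep_evalZ c x : rep_eval (c *: x) = c *: rep_eval x.
Proof. by rewrite /rep_eval /= /rep_eval_fun mmapZ in_algM. Qed.

Lemma rep_eval_lowest x v : lowest_submodule v -> lowest_submodule (rep_eval x v).
Proof.
move=> hv; rewrite /rep_eval /= /rep_eval_fun mmapE lend_app_sum.
elim/big_ind: _ => [|a b|m _]; [exact: lowest0|exact: lowest_add|].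
rewrite in_algM lend_appZ; apply: lowest_scale; rewrite /rep_monom.
elim: (m : seq _) => [|g s IHs]; first by rewrite big_nil.
by rewrite big_cons lend_appM; apply: lowest_op.
Qed.

Lemma rep_rel (B : lalgType F) (ev : {rmorphism B -> E}) (x : gen n -> B) r v :
  (forall c y, ev (c *: y) = c *: ev y) -> (forall y, ev (x y) = rep_op y) ->
  Uq_rel q A eps x r -> lowest_submodule v -> ev r v = 0.
Proof.
move=> evZ evx.
have qs y N a b : ev (qserre y N a b) = qserre y N (ev a) (ev b).
  rewrite /qserre rmorph_sum; apply: eq_bigr => l _.
  by rewrite evZ !rmorphM !rmorphXn.
case=> [i|i|i j|i j|i j|i j|i j ij|i j ij] hv.
- by rewrite rmorphB rmorphM rmorph1 !evx (rep_KK' i).1 subrr.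
- by rewrite rmorphB rmorphM rmorph1 !evx (rep_KK' i).2 subrr.
- by rewrite rmorphB !rmorphM !evx rep_KKC subrr.
- by rewrite rmorphB evZ !rmorphM !evx rep_KE subrr.
- by rewrite rmorphB evZ !rmorphM !evx rep_KF subrr.
- by rewrite !rmorphB evZ !rmorphM rmorphB !evx rep_EF subrr.
- by rewrite qs !evx rep_SerreE.
- by rewrite qs !evx rep_SerreF.
Qed.

(** The defining ideal acts by zero on the submodule generated by [vac], whereas E_i F_i [vac] takes
    the value 1 at the empty word. *)
Lemma UE_neq0 i : UE q A eps i != 0.
Proof.
apply/negP => /eqP; rewrite /UE /Ugen /Uq Uq_presentation.unlock /=.
rewrite -(rmorph0 (quot_pi (@free_alg_scalerAr F (gen n)) (@Uq_proper F q n A eps))).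
move=> /quot_eqP/ideal_ofP; rewrite subr0 => hE.
suff ev0 x v : ideal_span (Uq_rel q A eps (@free_gen F (gen n))) x ->
    lowest_submodule v -> rep_eval x v = 0.
  have := ev0 _ _ hE (lowest_word [:: i]); rewrite rep_eval_gen.
  move=> /(congr1 (fun g : wordfun => g [::])).
  rewrite -[LHS]/(0 + (i == i)%:R * kbr i [::] * 1) eqxx add0r mul1r mulr1.
  have d0 := qB_neq0 (qi_neq0 i) (@qi_nroot i).
  by rewrite /kbr /kap big_nil mulr1 (divff d0) => /eqP; rewrite oner_eq0.
move=> hx hv; elim: hx => [|{}x a s b _ IHx rs]; first by rewrite rmorph0.
rewrite rmorphD !rmorphM lend_appD !lend_appM IHx add0r.
by rewrite (rep_rel rep_evalZ rep_eval_gen rs) ?lend0 //; apply: rep_eval_lowest.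
Qed.
End NontrivialRepresentation.

(** * Weights and the adjoint action *)

Lemma expr_twist (F : fieldType) (B : algType F) (y z : B) (c : F) N :
  y * z = c *: (z * y) -> y ^+ N * z = c ^+ N *: (z * y ^+ N).
Proof.
move=> yz; elim: N => [|N IHN]; first by rewrite mul1r mulr1 scale1r.
rewrite [in LHS]exprS -[LHS]mulrA IHN -scalerAr [y * _]mulrA yz -scalerAl scalerA.
by rewrite -exprSr -[z * y * _]mulrA -exprS.
Qed.

Section Weights.
Variables (F : fieldType) (q : F) (n : nat) (A : 'M[int]_n) (eps : 'I_n -> nat).
Hypothesis q_neq0 : q != 0.
Hypothesis q_nroot : forall m, (0 < m)%N -> q ^+ m != 1.
Hypothesis hA : symmetrizable_GCM A eps.
Local Notation qi := (qi q eps).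
Local Notation U := (Uq q A eps).
Local Notation E := (UE q A eps).
Local Notation Fg := (UF q A eps).
Local Notation K := (UK q A eps).
Local Notation K' := (UKV q A eps).
Local Notation qn0 := (qi_neq0 eps q_neq0).

Lemma UKK' i : K i * K' i = 1.
Proof. by apply/subr0_eq/Uq_relations/rel_KKV. Qed.
Lemma UK'K i : K' i * K i = 1.
Proof. by apply/subr0_eq/Uq_relations/rel_KVK. Qed.
Lemma UKC i j : GRing.comm (K i) (K j).
Proof. by apply/subr0_eq/Uq_relations/rel_KK. Qed.
Lemma UKE i j : K i * E j = qi i ^ A i j *: (E j * K i).
Proof. by apply/subr0_eq/Uq_relations/rel_KE. Qed.
Lemma UKF i j : K i * Fg j = qi i ^ (- A i j) *: (Fg j * K i).
Proof. by apply/subr0_eq/Uq_relations/rel_KF. Qed.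
Lemma UEF i j : E i * Fg j - Fg j * E i
  = ((i == j)%:R / (qi i - (qi i)^-1)) *: (K i - K' i).
Proof. by apply/subr0_eq/Uq_relations/rel_EF. Qed.
Lemma UEFC i j : i != j -> GRing.comm (E i) (Fg j).
Proof.
by move=> /negbTE ij; apply/eqP; rewrite -subr_eq0 UEF ij mul0r scale0r.
Qed.
Lemma USerreE i j : i != j -> qserre (qi i) `|1 - A i j|%N (E i) (E j) = 0.
Proof. by move=> ij; apply/Uq_relations/rel_SerreE. Qed.
Lemma USerreF i j : i != j -> qserre (qi i) `|1 - A i j|%N (Fg i) (Fg j) = 0.
Proof. by move=> ij; apply/Uq_relations/rel_SerreF. Qed.

Lemma UK'_comm i (x : U) c : K i * x = c *: (x * K i) -> c != 0 ->
  K' i * x = c^-1 *: (x * K' i).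
Proof.
move=> Kx c0; have xK : x * K i = c^-1 *: (K i * x).
  by rewrite Kx scalerA mulVf // scale1r.
transitivity (K' i * (x * K i) * K' i); first by rewrite -!mulrA UKK' mulr1.
by rewrite xK -scalerAr -scalerAl mulrA UK'K mul1r.
Qed.

Lemma UKK'C i j : GRing.comm (K i) (K' j).
Proof.
have := @UK'_comm j (K i) 1; rewrite scale1r invr1 scale1r => h.
by apply/esym/h; rewrite ?oner_neq0 // UKC.
Qed.

Lemma UK'C i j : GRing.comm (K' i) (K' j).
Proof.
have := @UK'_comm i (K' j) 1; rewrite scale1r invr1 scale1r => h.
by apply/h; rewrite ?oner_neq0 // UKK'C.
Qed.

Local Notation Q := 'rV[int]_n.
Implicit Types (mu nu : Q) (i j k l : 'I_n).

(* The value mu(h_k). *)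
Definition hp k mu : int := \sum_j mu 0 j * A k j.

Lemma pairing_simple k mu : pairing A (simple k) mu = hp k mu.
Proof.
have z i : i != k -> \sum_j (simple k) 0 i * mu 0 j * A i j = 0.
  by move=> ik; rewrite big1 // => j _; rewrite /simple mxE eqxx (negbTE ik) !mul0r.
rewrite /pairing (bigD1 k) //= [X in _ + X]big1 // addr0 /hp.
by apply: eq_bigr => j _; rewrite /simple mxE !eqxx mul1r.
Qed.

Lemma hpD k mu nu : hp k (mu + nu) = hp k mu + hp k nu.
Proof. by rewrite /hp -big_split; apply: eq_bigr => j _; rewrite mxE mulrDl. Qed.
Lemma hpN k mu : hp k (- mu) = - hp k mu.
Proof. by rewrite /hp -sumrN; apply: eq_bigr => j _; rewrite mxE mulNr. Qed.
Lemma hpB k mu nu : hp k (mu - nu) = hp k mu - hp k nu.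
Proof. by rewrite hpD hpN. Qed.
Lemma hpZ k (a : int) mu : hp k (a *: mu) = a * hp k mu.
Proof. by rewrite /hp mulr_sumr; apply: eq_bigr => j _; rewrite mxE mulrA. Qed.
Lemma hp_simple k l : hp k (simple l) = A k l.
Proof.
rewrite /hp (bigD1 l) //= big1 ?addr0 => [|j jl]; first by rewrite mxE !eqxx mul1r.
by rewrite mxE eqxx (negbTE jl) mul0r.
Qed.

Lemma reflE i mu : refl A i mu = mu - hp i mu *: simple i.
Proof. by rewrite /refl pairing_simple. Qed.

Lemma hp_refl k i mu : hp k (refl A i mu) = hp k mu - hp i mu * A k i.
Proof. by rewrite reflE hpB hpZ hp_simple. Qed.

Lemma reflD i mu nu : refl A i (mu + nu) = refl A i mu + refl A i nu.
Proof. by rewrite !reflE hpD scalerDl opprD addrACA. Qed.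

Lemma reflZ i (a : int) mu : refl A i (a *: mu) = a *: refl A i mu.
Proof. by rewrite !reflE hpZ scalerBr scalerA. Qed.

Lemma reflK i : involutive (refl A i).
Proof.
move=> mu; rewrite !reflE hpB hpZ hp_simple (gcm_diag hA).
rewrite -addrA -opprD -scalerDl.
by have -> : hp i mu + (hp i mu - hp i mu * 2) = 0; [ring | rewrite scale0r subr0].
Qed.

(** Only the values mu(h_k) enter, so for singular A a nonzero element has many weights;
    [has_weight_inj] recovers just these values. *)
Definition has_weight (x : U) mu := forall k, K k * x = qi k ^ hp k mu *: (x * K k).

Lemma has_weightM x y mu nu :
  has_weight x mu -> has_weight y nu -> has_weight (x * y) (mu + nu).
Proof.
move=> hx hy k.
rewrite mulrA hx -scalerAl -[x * K k * y]mulrA hy -scalerAr scalerA mulrA hpD.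
by rewrite expfzDr // qn0.
Qed.

Lemma has_weightD x y mu : has_weight x mu -> has_weight y mu -> has_weight (x + y) mu.
Proof. by move=> hx hy k; rewrite mulrDr hx hy mulrDl scalerDr. Qed.

Lemma has_weightZ c x mu : has_weight x mu -> has_weight (c *: x) mu.
Proof. by move=> hx k; rewrite -scalerAr hx -scalerAl !scalerA mulrC. Qed.

Lemma has_weightN x mu : has_weight x mu -> has_weight (- x) mu.
Proof. by move=> hx; rewrite -scaleN1r; apply: has_weightZ. Qed.

Lemma has_weight0 mu : has_weight 0 mu.
Proof. by move=> k; rewrite mulr0 mul0r scaler0. Qed.

Lemma has_weightE i : has_weight (E i) (simple i).
Proof. by move=> k; rewrite hp_simple UKE. Qed.

Lemma has_weightF i : has_weight (Fg i) (- simple i).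
Proof. by move=> k; rewrite hpN hp_simple UKF. Qed.

Lemma hp0 k : hp k 0 = 0.
Proof. by rewrite /hp big1 // => j _; rewrite mxE mul0r. Qed.

Lemma has_weightK i : has_weight (K i) 0.
Proof. by move=> k; rewrite hp0 expr0z scale1r UKC. Qed.

Lemma has_weightK' i : has_weight (K' i) 0.
Proof. by move=> k; rewrite hp0 expr0z scale1r UKK'C. Qed.

Lemma has_weight_K' x mu k : has_weight x mu ->
  K' k * x = qi k ^ (- hp k mu) *: (x * K' k).
Proof.
move=> hx; rewrite (UK'_comm (hx k)) ?expfz_neq0 ?qn0 //.
by rewrite invr_expz.
Qed.

Lemma has_weight_inj x mu nu : x != 0 -> has_weight x mu -> has_weight x nu ->
  forall k, hp k mu = hp k nu.
Proof.
move=> x0 h1 h2 k; have xK0 : x * K k != 0.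
  apply: contraNneq x0 => /(congr1 (fun y => y * K' k)).
  by rewrite -mulrA UKK' mulr1 mul0r => ->.
have e : (qi k ^ hp k mu - qi k ^ hp k nu) *: (x * K k) = 0.
  by rewrite scalerBl -h1 -h2 subrr.
move/eqP: e; rewrite scaler_eq0 (negbTE xK0) orbF subr_eq0 => /eqP e.
have : qi k ^ (hp k mu - hp k nu) = 1.
  by rewrite expfzDr ?qn0 // e -expfzDr ?qn0 // subrr expr0z.
have nr := @qi_nroot F q n A eps q_nroot hA k.
case E0: (hp k mu - hp k nu) => [[|m]|m] /eqP.
- by move=> _; apply/eqP; rewrite -subr_eq0 E0.
- by rewrite -exprnP (negbTE (nr _ _)).
- by rewrite NegzE -exprnN invr_eq1 (negbTE (nr _ _)).
Qed.

Lemma UKpowV i (m : int) : UKpow q A eps i m * UKpow q A eps i (- m) = 1.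
Proof.
have pw N : K i ^+ N * K' i ^+ N = 1.
  elim: N => [|N IHN]; first by rewrite mulr1.
  by rewrite exprSr exprS mulrA -[_ * K i * K' i]mulrA UKK' mulr1.
have pw' N : K' i ^+ N * K i ^+ N = 1.
  elim: N => [|N IHN]; first by rewrite mulr1.
  by rewrite exprSr exprS mulrA -[_ * K' i * K i]mulrA UK'K mulr1.
case: m => [[|m]|m] /=; first by rewrite mulr1.
  exact: pw m.+1.
exact: pw' m.+1.
Qed.

Lemma UKpow_comm k l a b : GRing.comm (UKpow q A eps k a) (UKpow q A eps l b).
Proof.
case: a b => a [] b /=; apply: commrX; apply/commr_sym/commrX/commr_sym.
- exact: UKC.
- exact: UKK'C.
- exact/commr_sym/UKK'C.
- exact: UK'C.
Qed.

Lemma UKroot_refl i k : UKroot q A eps (refl A i (simple k))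
  = if k == i then K' i else K k * UKpow q A eps i (- A i k).
Proof.
have cd l : (refl A i (simple k)) 0 l = (l == k)%:R - A i k * (l == i)%:R.
  by rewrite reflE hp_simple /simple !mxE !eqxx.
have sp (f g : 'I_n -> U) (s : seq 'I_n) : (forall l l', GRing.comm (g l) (f l')) ->
    \prod_(l <- s) (f l * g l) = \prod_(l <- s) f l * \prod_(l <- s) g l.
  move=> fg; elim: s => [|l s IHs]; first by rewrite !big_nil mulr1.
  rewrite !big_cons IHs !mulrA; congr (_ * _); rewrite -!mulrA; congr (_ * _).
  by apply: commr_prod => l' _; apply: fg.
rewrite /UKroot; have [ki|ki] := eqVneq k i.
  transitivity (\prod_l (if l == i then K' i else 1)).
    apply: eq_bigr => l _. rewrite cd ki (gcm_diag hA); case: eqP => [->|_].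
      by rewrite mulr1 /= expr1.
    by rewrite mulr0 subr0.
  by rewrite -big_mkcond big_pred1_eq.
transitivity (\prod_l ((if l == k then K k else 1)
    * (if l == i then UKpow q A eps i (- A i k) else 1))).
  apply: eq_bigr => l _; rewrite cd; have [->|lk] := eqVneq l k.
    by rewrite (negbTE ki) mulr0 subr0 mulr1 /= expr1.
  by case: eqP => [->|_]; rewrite mul1r ?mulr1 ?mulr0 sub0r ?oppr0.
rewrite sp; first by rewrite -!big_mkcond !big_pred1_eq.
move=> l l'; case: (l == i); case: (l' == k); rewrite /GRing.comm ?mulr1 ?mul1r //.
exact: (@UKpow_comm i k (- A i k) 1).
Qed.

Lemma lrmorphZ (T : {lrmorphism U -> U}) c x : T (c *: x) = c *: T x.
Proof. exact: linearZ. Qed.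

Section Lusztig.
Variables (i : 'I_n) (T : {lrmorphism U -> U}).
Hypothesis hT : is_lusztig i T.

Lemma lusztigK k : T (K k)
  = if k == i then K' i else K k * UKpow q A eps i (- A i k).
Proof. by case: hT => _ /(_ k) [_ _ ->]; rewrite UKroot_refl. Qed.

(** T_i(K_i) = K_i^-1 settles k = i first; for other k this removes the power of K_i in T_i(K_k) =
    K_k K_i^(-a_ik). *)
Lemma lusztig_weight x mu : has_weight x mu -> has_weight (T x) (refl A i mu).
Proof.
move=> hx; have Tk k : T (K k) * T x = qi k ^ hp k mu *: (T x * T (K k)).
  by transitivity (T (K k * x)); [rewrite rmorphM | rewrite hx lrmorphZ rmorphM].
have ii : K i * T x = qi i ^ hp i (refl A i mu) *: (T x * K i).
  have := Tk i; rewrite lusztigK eqxx => h.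
  have K'x : T x * K' i = qi i ^ (- hp i mu) *: (K' i * T x).
    by rewrite h scalerA -expfzDr ?qn0 // addNr expr0z scale1r.
  transitivity (K i * (T x * K' i) * K i); first by rewrite -!mulrA UK'K mulr1.
  rewrite K'x -scalerAr -scalerAl mulrA UKK' mul1r hp_refl (gcm_diag hA).
  by congr (_ ^ _ *: _); ring.
move=> k; have [->//|ki] := eqVneq k i.
have := Tk k; rewrite lusztigK (negbTE ki) => h.
set P := UKpow q A eps i (- A i k); set P' := UKpow q A eps i (A i k).
have PP' : P * P' = 1 by rewrite -[P'](congr1 _ (opprK _)) UKpowV.
have P'x : P' * T x = qi i ^ (A i k * hp i (refl A i mu)) *: (T x * P').
  rewrite /P'; case: (A i k) => m /=.
    by rewrite (expr_twist _ ii) exprnP exprz_exp [hp i _ * _]mulrC.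
  have ii' := UK'_comm ii; rewrite (expr_twist _ (ii' _)) ?expfz_neq0 ?qn0 //.
  by rewrite invr_expz exprnP exprz_exp; congr (_ ^ _ *: _); rewrite NegzE; ring.
transitivity ((K k * P) * (P' * T x)).
  by rewrite -mulrA [P * _]mulrA PP' mul1r.
rewrite P'x -scalerAr mulrA h -scalerAl scalerA -!mulrA [P * P'](PP') mulr1.
congr (_ *: _).
have -> : qi i ^ (A i k * hp i (refl A i mu)) = qi k ^ (A k i * hp i (refl A i mu)).
  by rewrite -!exprz_exp (qi_sym q hA).
by rewrite -expfzDr ?qn0 //; congr (_ ^ _); rewrite !hp_refl (gcm_diag hA); ring.
Qed.
End Lusztig.

Lemma T_word_weight (T : 'I_n -> {lrmorphism U -> U}) (w : seq 'I_n) x mu :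
  (forall i, is_lusztig i (T i)) ->
  has_weight x mu -> has_weight (T_word T w x) (wact A w mu).
Proof.
by move=> hT hx; elim: w => [|k w IHw] //=; apply: (lusztig_weight (hT k)).
Qed.
End Weights.

(** * Integrable actions of quantum sl_2 *)

Section SlTwo.
Variables (F : fieldType) (x : F) (U : lmodType F) (e f : U -> U) (P : int -> U -> Prop).
Hypothesis x_neq0 : x != 0.
Hypothesis x_nroot : forall m, (0 < m)%N -> x ^+ m != 1.
Hypothesis eZ : forall c u, e (c *: u) = c *: e u.
Hypothesis fD : forall u v, f (u + v) = f u + f v.
Hypothesis fZ : forall c u, f (c *: u) = c *: f u.
Hypothesis Pe : forall m u, P m u -> P (m + 2) (e u).
Hypothesis Pf : forall m u, P m u -> P (m - 2) (f u).
Hypothesis ef : forall m u, P m u ->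
  e (f u) = f (e u) + ((x ^ m - x ^ (- m)) / (x - x^-1)) *: u.

Let f0 : f 0 = 0. Proof. by have := fZ 0 0; rewrite !scale0r. Qed.
Let e0 : e 0 = 0. Proof. by have := eZ 0 0; rewrite !scale0r. Qed.
Let iterf0 k : iter k f 0 = 0. Proof. by elim: k => //= k ->. Qed.

Lemma sl2_commutator m u s : P m u -> e (iter s.+1 f u) = iter s.+1 f (e u)
  + ((x ^+ s.+1 - x ^- s.+1) / (x - x^-1) * ((x ^ (m - s%:Z) - x ^ (s%:Z - m)) / (x - x^-1)))
    *: iter s f u.
Proof.
have d0 := qB_neq0 x_neq0 x_nroot.
move=> hu; have Ps t : P (m - 2 * t%:Z) (iter t f u).
  elim: t => [|t IHt] /=; first by rewrite mulr0 subr0.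
  by rewrite (_ : _ - _ = m - 2 * t%:Z - 2); [apply: Pf | lia].
elim: s => [|s IHs].
  by rewrite [LHS](ef hu) /= expr1 (divff d0) mul1r subr0 sub0r.
rewrite [LHS](ef (Ps s.+1)) [in LHS]IHs fD fZ -addrA -iterS -scalerDl.
congr (_ + _ *: _).
have e1 : x ^ (m - 2 * s.+1%:Z) = x ^ m * (x ^ s * x ^ s * x * x)^-1.
  rewrite expfzDr // -invr_expz; congr (_ * _^-1).
  by rewrite -!exprnP -!exprD -!exprSr; congr (_ ^+ _); lia.
have e1' : x ^ (- (m - 2 * s.+1%:Z)) = (x ^ m * (x ^ s * x ^ s * x * x)^-1)^-1.
  by rewrite -e1 invr_expz.
have e2 t : x ^ (m - t%:Z) = x ^ m * (x ^ t)^-1 by rewrite expfzDr // invr_expz.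
have e2' t : x ^ (t%:Z - m) = x ^ t * (x ^ m)^-1 by rewrite expfzDr // invr_expz.
rewrite e1' e1 !e2 !e2'.
rewrite -!(exprnP x) !exprSr.
have X0 : x ^ m != 0 by rewrite expfz_neq0.
have Y0 : x ^+ s != 0 by rewrite expf_neq0.
move: (x ^ m) (x ^+ s) X0 Y0 => X Y X0 Y0.
have E (d a1 a2 a3 a4 a5 : F) : d != 0 -> a1 * a2 + a3 * d = a4 * a5 ->
    a1 / d * (a2 / d) + a3 / d = a4 / d * (a5 / d).
  by move=> d'0 h; transitivity ((a1 * a2 + a3 * d) / d ^+ 2); [|rewrite h]; field.
by apply: E => //; field; rewrite X0 Y0 x_neq0.
Qed.

(** By the commutator formula f^(m+2) kills e u, so induction on N gives e u = 0. Then [s+1][m-s] <>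
    0 for s < m strips off the powers of f one by one. *)
Lemma sl2_inj m N u : P m%:Z u -> iter N e u = 0 -> iter m f u = 0 -> u = 0.
Proof.
elim: N m u => [|N IHN] m u hu //; rewrite iterSr => eu fu.
have eu0 : e u = 0.
  apply: (IHN m.+2) => //; first by have := Pe hu; rewrite -PoszD addn2.
  have := sl2_commutator m.+1 hu; rewrite !iterS fu f0 f0 e0 scaler0 addr0.
  by rewrite -!iterS => <-.
suff step s : (s < m)%N -> iter s.+1 f u = 0 -> iter s f u = 0.
  have /(_ m (leqnn m)) : forall s, (s <= m)%N -> iter (m - s) f u = 0.
    elim=> [|s IHs] sm; first by rewrite subn0.
    by apply: step; [lia | rewrite -subSn // subSS IHs // ltnW].
  by rewrite subnn.
move=> sm fs; have := sl2_commutator s hu; rewrite fs e0 eu0 iterf0 add0r.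
move/esym/eqP; rewrite scaler_eq0 => /orP[|/eqP //].
have nz k : (0 < k)%N -> (x ^+ k - x ^- k) / (x - x^-1) != 0.
  move=> k0; exact: (qint_neq0 x_neq0 x_nroot k0).
rewrite mulf_eq0 (negbTE (nz _ _)) //= => /eqP h.
have ms : (0 < m - s)%N by rewrite subn_gt0.
have e1 : m%:Z - s%:Z = (m - s)%N by lia.
have e2 : s%:Z - m%:Z = - (m - s)%N%:Z by lia.
by move: h (nz _ ms); rewrite e1 e2 -exprnN => ->; rewrite eqxx.
Qed.
End SlTwo.

Section TwistedCommutators.
Variables (F : fieldType) (B : algType F).
Implicit Types (e f k x y : B).

Definition twisted_ade e k (k' : B) x : B := e * x - k * x * k' * e.
Definition twisted_adf f k x : B := (f * x - x * f) * k.

Lemma twisted_adeD e k k' x y :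
  twisted_ade e k k' (x + y) = twisted_ade e k k' x + twisted_ade e k k' y.
Proof. by rewrite /twisted_ade addrACA -opprD !mulrDr !mulrDl. Qed.
Lemma twisted_adeZ e k k' c x : twisted_ade e k k' (c *: x) = c *: twisted_ade e k k' x.
Proof. by rewrite /twisted_ade -!scalerAr -!scalerAl -scalerBr. Qed.
Lemma twisted_adfD f k x y :
  twisted_adf f k (x + y) = twisted_adf f k x + twisted_adf f k y.
Proof. by rewrite /twisted_adf -mulrDl addrACA -opprD mulrDr [(x + y) * f]mulrDl. Qed.
Lemma twisted_adfZ f k c x : twisted_adf f k (c *: x) = c *: twisted_adf f k x.
Proof. by rewrite /twisted_adf -!scalerAr -!scalerAl -scalerBr -scalerAl. Qed.

(** The commutator of ad(E_k) with ad(F_l), where the element l plays K_l; the final disjunction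
    treats distinct and equal indices together. *)
Lemma twisted_ade_adf e f k k' l c c' a a' d x :
  k' * k = 1 -> l * e = a *: (e * l) -> e * f - f * e = d *: (k - k') ->
  k * x = c *: (x * k) -> k' * x = c' *: (x * k') -> a' * a = c -> d = 0 \/ l = k ->
  e * ((f * x - x * f) * l) - a' *: (((f * x - x * f) * l) * e)
  = (f * (e * x - c *: (x * e)) - (e * x - c *: (x * e)) * f) * l + (d * (c - c')) *: x.
Proof.
move=> k'k le ef kx k'x aa dl.
have h1 : (f * x - x * f) * l * e = a *: ((f * x - x * f) * e * l).
  by rewrite -[LHS]mulrA le -scalerAr mulrA.
rewrite h1 scalerA aa.
have EFx : e * f * x = f * e * x + d *: ((k - k') * x).
  by rewrite scalerAl -ef -mulrDl addrC subrK.
have xEF : x * e * f = x * f * e + d *: (x * (k - k')).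
  by rewrite scalerAr -ef mulrBr !mulrA addrC subrK.
have -> : (d * (c - c')) *: x = (d *: ((c *: (x * k) - c' *: (x * k')) - c *: (x * (k - k')))) * l.
  case: dl => [->|->]; first by rewrite mul0r !scale0r mul0r.
  have -> : c *: (x * k) - c' *: (x * k') - c *: (x * (k - k')) = (c - c') *: (x * k').
    by rewrite mulrBr; lmod_ring.
  by rewrite scalerA -scalerAl -mulrA k'k mulr1.
have -> : e * ((f * x - x * f) * l) = (e * f * x - e * x * f) * l.
  by rewrite mulrA mulrBr !mulrA.
rewrite scalerAl -mulrBl -mulrDl; congr (_ * _).
have -> : f * (e * x - c *: (x * e)) = f * e * x - c *: (f * x * e).
  by rewrite mulrBr -scalerAr !mulrA.
have -> : (e * x - c *: (x * e)) * f = e * x * f - c *: (x * e * f).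
  by rewrite mulrBl -scalerAl.
have kkx : (k - k') * x = c *: (x * k) - c' *: (x * k') by rewrite mulrBl kx k'x.
rewrite EFx kkx xEF (mulrBl e (f * x)).
by lmod_ring.
Qed.
End TwistedCommutators.

Section Adjoint.
Variables (F : fieldType) (q : F) (n : nat) (A : 'M[int]_n) (eps : 'I_n -> nat).
Hypothesis q_neq0 : q != 0.
Hypothesis q_nroot : forall m, (0 < m)%N -> q ^+ m != 1.
Hypothesis hA : symmetrizable_GCM A eps.
Local Notation qi := (qi q eps).
Local Notation U := (Uq q A eps).
Local Notation E := (UE q A eps).
Local Notation Fg := (UF q A eps).
Local Notation K := (UK q A eps).
Local Notation K' := (UKV q A eps).
Local Notation qn0 := (qi_neq0 eps q_neq0).
Local Notation Q := 'rV[int]_n.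
Local Notation hp := (hp A).
Implicit Types (mu nu : Q) (i j k l : 'I_n) (x y : U).

Definition ade k x : U := twisted_ade (E k) (K k) (K' k) x.
Definition adf k x : U := twisted_adf (Fg k) (K k) x.
Definition adw (w : seq 'I_n) x : U := foldr ade x w.

Lemma ad_adw w x : ad (map (@GE n) w) x = adw w x.
Proof.
rewrite /ad; elim: w => [|k w IHw].
  by rewrite big_seq1 /word /antipode !big_nil mul1r mulr1.
rewrite map_cons /= -IHw cats0 big_cat !big_map /ade /twisted_ade; congr (_ + _).
  rewrite mulr_sumr; apply: eq_bigr => p _.
  by rewrite /word big_cons -!mulrA.
rewrite mulr_sumr !mulr_suml -sumrN; apply: eq_bigr => p _.
rewrite /word big_cons /antipode rev_cons -cats1 big_cat big_seq1 /=.
by rewrite !mulrN !mulrA.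
Qed.

Lemma adeD k x y : ade k (x + y) = ade k x + ade k y.
Proof. exact: twisted_adeD. Qed.
Lemma adeZ k c x : ade k (c *: x) = c *: ade k x.
Proof. exact: twisted_adeZ. Qed.
Lemma adfD k x y : adf k (x + y) = adf k x + adf k y.
Proof. exact: twisted_adfD. Qed.
Lemma adfZ k c x : adf k (c *: x) = c *: adf k x.
Proof. exact: twisted_adfZ. Qed.

Lemma has_weight_conj k x mu : has_weight x mu -> K k * x * K' k = qi k ^ hp k mu *: x.
Proof. by move=> hx; rewrite hx -scalerAl -mulrA UKK' mulr1. Qed.

Lemma adeE k x mu : has_weight x mu ->
  ade k x = E k * x - qi k ^ hp k mu *: (x * E k).
Proof. by move=> hx; rewrite /ade /twisted_ade (has_weight_conj k hx) -scalerAl. Qed.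

Lemma ade_weight k x mu : has_weight x mu -> has_weight (ade k x) (mu + simple k).
Proof.
move=> hx; rewrite (adeE k hx); apply: has_weightD.
  by rewrite addrC; apply: (has_weightM q_neq0) => //; apply: has_weightE.
apply/has_weightN/has_weightZ/(has_weightM q_neq0) => //; exact: has_weightE.
Qed.

Lemma adf_weight k x mu : has_weight x mu -> has_weight (adf k x) (mu - simple k).
Proof.
move=> hx; rewrite -[mu - _]addr0; apply: (has_weightM q_neq0); last exact: has_weightK.
apply: has_weightD; first by rewrite addrC; apply: (has_weightM q_neq0) => //; apply: has_weightF.
apply/has_weightN/(has_weightM q_neq0) => //; exact: has_weightF.
Qed.

Lemma ade_adf k l x mu : has_weight x mu -> ade k (adf l x) = adf l (ade k x)
  + (k == l)%:R *: (((qi k ^ hp k mu - qi k ^ (- hp k mu)) / (qi k - (qi k)^-1)) *: x).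
Proof.
move=> hx; rewrite (adeE k (adf_weight l hx)) (adeE k hx) /adf /twisted_adf hpB hp_simple.
rewrite (@twisted_ade_adf F U (E k) (Fg l) (K k) (K' k) (K l) (qi k ^ hp k mu)
  (qi k ^ (- hp k mu)) (qi k ^ A k l) _ ((k == l)%:R / (qi k - (qi k)^-1)) x).
- by rewrite scalerA -mulrA; congr (_ + (_ * _) *: _); rewrite mulrC.
- exact: UK'K.
- by rewrite UKE (qi_sym q hA).
- exact: UEF.
- exact: hx.
- by rewrite (has_weight_K' q_neq0 k hx).
- by rewrite -expfzDr ?qn0 // subrK.
- by have [->|_] := eqVneq k l; [right | left; rewrite mul0r].
Qed.

Lemma adfE0 k i : k != i -> adf k (E i) = 0.
Proof. by move=> ki; rewrite /adf /twisted_adf -(UEFC q A eps) ?subrr ?mul0r // eq_sym. Qed.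
End Adjoint.

(** * Integrability of the adjoint action *)

Lemma natzS N : N.+1%:Z = N%:Z + 1.
Proof. by rewrite -addn1 PoszD. Qed.

Lemma twisted_adeM (F : fieldType) (B : algType F) (e k k' x y : B) c :
  k' * k = 1 -> k * x * k' = c *: x ->
  twisted_ade e k k' (x * y) = twisted_ade e k k' x * y + c *: (x * twisted_ade e k k' y).
Proof.
move=> k'k kx; rewrite /twisted_ade scalerAl -kx.
have -> : k * (x * y) * k' * e = k * x * k' * (k * y * k' * e).
  by rewrite -!mulrA; do 2 congr (_ * _); rewrite [RHS]mulrA k'k mul1r.
by rewrite mulrBl mulrBr !mulrA addrA subrK.
Qed.

Section Integrability.
Variables (F : fieldType) (q : F) (n : nat) (A : 'M[int]_n) (eps : 'I_n -> nat).
Hypothesis q_neq0 : q != 0.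
Hypothesis q_nroot : forall m, (0 < m)%N -> q ^+ m != 1.
Hypothesis hA : symmetrizable_GCM A eps.
Variable X : {set 'I_n}.
Local Notation qi := (qi q eps).
Local Notation U := (Uq q A eps).
Local Notation E := (UE q A eps).
Local Notation qn0 := (qi_neq0 eps q_neq0).
Local Notation Q := 'rV[int]_n.
Local Notation hp := (hp A).
Implicit Types (mu nu : Q) (i j k l : 'I_n) (x y : U) (w : seq 'I_n).

Lemma adeM k x y mu : has_weight x mu ->
  ade k (x * y) = ade k x * y + qi k ^ hp k mu *: (x * ade k y).
Proof.
by move=> hx; apply: twisted_adeM; [apply: UK'K | apply: has_weight_conj].
Qed.

Let ade0 k : ade k (0 : U) = 0.
Proof. by have := adeZ k 0 (0 : U); rewrite !scale0r. Qed.
Let adf0 k : adf k (0 : U) = 0.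
Proof. by have := adfZ k 0 (0 : U); rewrite !scale0r. Qed.

Definition ad_nil k x : Prop := exists N, iter N (ade k) x = 0.

Lemma iter_adeD k N x y : iter N (ade k) (x + y) = iter N (ade k) x + iter N (ade k) y.
Proof. by elim: N => //= N ->; rewrite adeD. Qed.
Lemma iter_adeZ k N c x : iter N (ade k) (c *: x) = c *: iter N (ade k) x.
Proof. by elim: N => //= N ->; rewrite adeZ. Qed.
Lemma iter_ade0 k N : iter N (ade k) (0 : U) = 0.
Proof. by elim: N => //= N ->. Qed.

Lemma ad_nilD k x y : ad_nil k x -> ad_nil k y -> ad_nil k (x + y).
Proof.
move=> [N hN] [M hM]; exists (N + M)%N.
by rewrite iter_adeD [in X in _ + X]iterD hM iter_ade0 addr0 addnC iterD hN iter_ade0.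
Qed.

Lemma ad_nilZ k c x : ad_nil k x -> ad_nil k (c *: x).
Proof. by move=> [N hN]; exists N; rewrite iter_adeZ hN scaler0. Qed.

Lemma ad_nilM k x y mu : has_weight x mu -> ad_nil k x -> ad_nil k y -> ad_nil k (x * y).
Proof.
move=> hx [N hN] [M hM]; exists (N + M)%N; move: {2}(N + M)%N (erefl (N + M)%N) => s.
elim: s N M x y mu hx hN hM => [|s IHs] N M x y mu hx hN hM Ns.
  have [N0 M0] : N = 0%N /\ M = 0%N by lia.
  by move: hN; rewrite N0 M0 /= => ->; rewrite mul0r.
case: N hN Ns => [|N] hN Ns; first by rewrite [x]hN mul0r iter_ade0.
rewrite addSn iterSr (adeM k y hx) iter_adeD iter_adeZ.
rewrite (IHs N M _ y (mu + simple k)) ?add0r; last 4 first.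
- exact: ade_weight.
- by rewrite -iterSr.
- by [].
- by lia.
case: M hM Ns => [|M] hM Ns; first by rewrite [y]hM ade0 mulr0 iter_ade0 scaler0.
rewrite addnS -addSn (IHs N.+1 M _ _ mu) ?scaler0 //; first by rewrite -iterSr.
by lia.
Qed.

(** The adjoint powers are the q-commutators of [qad], so the Serre relation says that ad(E_k) is
    nilpotent on E_l. *)
Lemma iter_ade_gen k l N : k != l ->
  iter N (ade k) (E l) = qad (qi k ^+ 2) (qi k ^- `|A k l|%N) (E k) (E l) N /\
  has_weight (iter N (ade k) (E l)) (simple l + N%:Z *: simple k).
Proof.
move=> kl; elim: N => [|N [IH1 IH2]].
  by split=> //; rewrite scale0r addr0; apply: has_weightE.
rewrite iterS; split; last first.
  by rewrite natzS scalerDl scale1r addrA; apply: ade_weight.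
rewrite (adeE k IH2) IH1 /=; congr (_ - _ *: _).
rewrite hpD hpZ !hp_simple (gcm_diag hA) expfzDr ?qn0 // (qi_exp q_neq0 hA kl).1.
by congr (_ * _); have -> : N%:Z * 2 = (2 * N)%N by [lia]; rewrite -exprnP exprM.
Qed.

Lemma ad_nil_gen k l : k != l -> ad_nil k (E l).
Proof.
move=> kl; exists (`|A k l|%N).+1; rewrite (iter_ade_gen _ kl).1.
rewrite -(qserre_qad _ (qn0 k) (@qi_nroot _ q n A eps q_nroot hA k)).
by rewrite -(gcm_serre_degree q_neq0 hA kl) USerreE.
Qed.

Variable i : 'I_n.
Hypothesis iX : i \notin X.

Definition word_weight w : Q := \sum_(k <- w) simple k.

Lemma word_weight_cons k w : word_weight (k :: w) = simple k + word_weight w.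
Proof. exact: big_cons. Qed.

Lemma word_weight_ge0 w k : 0 <= word_weight w 0 k.
Proof.
elim: w => [|l w IHw]; first by rewrite /word_weight big_nil mxE.
by rewrite word_weight_cons mxE addr_ge0 // /simple mxE; case: (_ && _).
Qed.

Lemma adw_weight w j : has_weight (adw w (E j)) (simple j + word_weight w).
Proof.
elim: w => [|k w IHw]; first by rewrite /word_weight big_nil addr0; apply: has_weightE.
by rewrite word_weight_cons [simple k + _]addrC addrA; apply: ade_weight.
Qed.

(** Graded by honest lattice vectors rather than by [has_weight], since [ad_span_eq0] needs
    coordinates of mu. *)
Inductive ad_span : Q -> U -> Prop :=
| ad_span0 mu : ad_span mu 0
| ad_spanD c w mu x : {subset w <= X} -> mu = simple i + word_weight w ->
    ad_span mu x -> ad_span mu (c *: adw w (E i) + x).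

Lemma ad_span_add mu x y : ad_span mu x -> ad_span mu y -> ad_span mu (x + y).
Proof.
elim=> [{}mu|c w {}mu {}x wX mE _ IHx] hy; first by rewrite add0r.
by rewrite -addrA; apply: ad_spanD => //; apply: IHx.
Qed.

Lemma ad_span_scale mu c x : ad_span mu x -> ad_span mu (c *: x).
Proof.
elim=> [{}mu|a w {}mu {}x wX mE _ IHx]; first by rewrite scaler0; apply: ad_span0.
by rewrite scalerDr scalerA; apply: ad_spanD.
Qed.

Lemma ad_span_word w : {subset w <= X} ->
  ad_span (simple i + word_weight w) (adw w (E i)).
Proof.
move=> wX; rewrite -[adw w _]scale1r -[_ *: _]addr0.
by apply: ad_spanD => //; apply: ad_span0.
Qed.

Lemma ad_span_weight mu x : ad_span mu x -> has_weight x mu.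
Proof.
elim=> [{}mu|c w {}mu {}x wX -> _ IHx]; first exact: has_weight0.
by apply: has_weightD => //; apply/has_weightZ/adw_weight.
Qed.

Lemma ad_span_ade k mu x : k \in X -> ad_span mu x -> ad_span (mu + simple k) (ade k x).
Proof.
move=> kX; elim=> [{}mu|c w {}mu {}x wX -> _ IHx]; first by rewrite ade0; apply: ad_span0.
rewrite adeD adeZ; apply: ad_span_add => //; apply: ad_span_scale.
rewrite -addrA [_ + simple k]addrC -word_weight_cons; apply: (ad_span_word (w := k :: w)).
by move=> l; rewrite inE => /orP[/eqP ->|/wX].
Qed.

(** ad(F_k) kills E_i for k in X, and its commutators with the ad(E_l) are scalar on weight
    vectors. *)
Lemma ad_span_adf_word k w : k \in X -> {subset w <= X} ->
  ad_span (simple i + word_weight w - simple k) (adf k (adw w (E i))).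
Proof.
move=> kX; elim: w => [|l w IHw] wX.
  rewrite /= adfE0; last by apply: contraNneq iX => <-.
  exact: ad_span0.
have wX' : {subset w <= X} by move=> r rw; apply: wX; rewrite inE rw orbT.
have lX : l \in X by apply: wX; rewrite inE eqxx.
have := ade_adf q_neq0 hA l k (adw_weight w i); set c := (_ / _) => h.
have -> : adf k (adw (l :: w) (E i))
    = ade l (adf k (adw w (E i))) + (- ((l == k)%:R * c)) *: adw w (E i).
  by rewrite h scaleNr scalerA addrK.
rewrite word_weight_cons; apply: ad_span_add.
  rewrite (_ : _ - _ = simple i + word_weight w - simple k + simple l).
    by apply: ad_span_ade => //; apply: IHw.
  by apply/rowP => r; rewrite !mxE; ring.
have [<-|_] := eqVneq l k; last by rewrite mul0r oppr0 scale0r; apply: ad_span0.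
rewrite (_ : _ - _ = simple i + word_weight w); first exact/ad_span_scale/ad_span_word.
by apply/rowP => r; rewrite !mxE; ring.
Qed.

Lemma ad_span_adf k mu x : k \in X -> ad_span mu x -> ad_span (mu - simple k) (adf k x).
Proof.
move=> kX; elim=> [{}mu|c w {}mu {}x wX -> _ IHx]; first by rewrite adf0; apply: ad_span0.
rewrite adfD adfZ; apply: ad_span_add => //; apply: ad_span_scale.
exact: ad_span_adf_word.
Qed.

Lemma ad_span_iter_ade k mu x N : k \in X -> ad_span mu x ->
  ad_span (mu + N%:Z *: simple k) (iter N (ade k) x).
Proof.
move=> kX hx; elim: N => [|N IHN]; first by rewrite scale0r addr0.
by rewrite natzS scalerDl scale1r addrA; apply: ad_span_ade.
Qed.

Lemma ad_span_iter_adf k mu x N : k \in X -> ad_span mu x ->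
  ad_span (mu - N%:Z *: simple k) (iter N (adf k) x).
Proof.
move=> kX hx; elim: N => [|N IHN]; first by rewrite scale0r subr0.
by rewrite natzS scalerDl scale1r opprD addrA; apply: ad_span_adf.
Qed.

Lemma ad_span_eq0 k mu x : (mu - simple i) 0 k < 0 -> ad_span mu x -> x = 0.
Proof.
move=> neg hx; elim: hx neg => // c w {}mu {}x _ mE _ _.
by rewrite mE addrAC subrr add0r Order.TotalTheory.ltNge word_weight_ge0.
Qed.

Lemma ad_span_ade_nil k mu x : k \in X -> ad_span mu x -> ad_nil k x.
Proof.
move=> kX; elim=> [{}mu|c w {}mu {}x wX _ _ IHx]; first by exists 0%N.
apply: ad_nilD => //; apply: ad_nilZ; elim: w wX => [|l w IHw] wX.
  by apply: ad_nil_gen; apply: contraNneq iX => <-.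
have {}IHw : ad_nil k (adw w (E i)) by apply: IHw => r rw; apply: wX; rewrite inE rw orbT.
rewrite /=; have [<-|kl] := eqVneq k l.
  by have [N hN] := IHw; exists N; rewrite -iterSr iterS hN ade0.
rewrite (adeE l (adw_weight w i)) -scaleNr; apply: ad_nilD.
  by apply: (ad_nilM (has_weightE _ _ _ l)) => //; apply: ad_nil_gen.
by apply: ad_nilZ; apply: (ad_nilM (adw_weight w i)) => //; apply: ad_nil_gen.
Qed.

Lemma ad_span_adf_nil k mu x : k \in X -> ad_span mu x -> exists N, iter N (adf k) x = 0.
Proof.
move=> kX hx; pose m := (mu - simple i) 0 k; exists `|m|.+1%N.
apply: (ad_span_eq0 (k := k)) (ad_span_iter_adf _ kX hx).
have -> : (mu - `|m|.+1%:Z *: simple k - simple i) 0 k = m - `|m|.+1%:Z.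
  by rewrite /m /simple !mxE !eqxx /=; ring.
lia.
Qed.

(** y is the image of x under the power of ad(F_k) or ad(E_k) that reflects its weight, nonzero by
    [sl2_inj]. For negative weights e and f trade places and P is negated. *)
Lemma ad_span_refl k mu x : k \in X -> ad_span mu x -> x != 0 ->
  exists2 y, y != 0 & ad_span (refl A k mu) y.
Proof.
move=> kX hx x0; have xn := @qi_nroot _ q n A eps q_nroot hA k.
pose P (m : int) y := exists2 nu, ad_span nu y & m = hp k nu.
rewrite reflE; have [m0|m0] : 0 <= hp k mu \/ hp k mu < 0 by lia.
  have mE : hp k mu = `|hp k mu|%N by lia.
  exists (iter `|hp k mu|%N (adf k) x); last by rewrite {1}mE; apply: ad_span_iter_adf.
  apply: contraNneq x0 => fx; have [N eN] := ad_span_ade_nil kX hx; apply/eqP.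
  apply: (@sl2_inj _ (qi k) U (ade k) (adf k) P (qn0 k) xn) eN fx.
  - exact: adeZ.
  - exact: adfD.
  - exact: adfZ.
  - move=> _ y [nu hy ->]; exists (nu + simple k); first exact: ad_span_ade.
    by rewrite hpD hp_simple (gcm_diag hA).
  - move=> _ y [nu hy ->]; exists (nu - simple k); first exact: ad_span_adf.
    by rewrite hpB hp_simple (gcm_diag hA).
  - move=> _ y [nu hy ->].
    by rewrite (ade_adf q_neq0 hA k k (ad_span_weight hy)) eqxx scale1r.
  - by exists mu.
have mE : hp k mu = - `|hp k mu|%N%:Z by lia.
exists (iter `|hp k mu|%N (ade k) x).
  apply: contraNneq x0 => ex; have [N fN] := ad_span_adf_nil kX hx; apply/eqP.
  apply: (@sl2_inj _ (qi k) U (adf k) (ade k) (fun m => P (- m)) (qn0 k) xn) fN ex.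
  - exact: adfZ.
  - exact: adeD.
  - exact: adeZ.
  - move=> m y [nu hy mE']; exists (nu - simple k); first exact: ad_span_adf.
    by rewrite hpB hp_simple (gcm_diag hA) -mE'; ring.
  - move=> m y [nu hy mE']; exists (nu + simple k); first exact: ad_span_ade.
    by rewrite hpD hp_simple (gcm_diag hA) -mE'; ring.
  - move=> m y [nu hy mE'].
    rewrite (ade_adf q_neq0 hA k k (ad_span_weight hy)) eqxx scale1r -mE' opprK.
    by rewrite -addrA -scalerDl -mulrDl addrA subrK subrr mul0r scale0r addr0.
  - by exists mu => //; rewrite -mE.
by rewrite {1}mE scaleNr opprK; apply: ad_span_iter_ade.
Qed.

Lemma ad_span_wact w mu x : {subset w <= X} -> ad_span mu x -> x != 0 ->
  exists2 y, y != 0 & ad_span (wact A w mu) y.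
Proof.
move=> wX hx x0; elim: w wX => [|k w IHw] wX; first by exists x.
have [|y y0 hy] := IHw; first by move=> r rw; apply: wX; rewrite inE rw orbT.
by apply: (ad_span_refl _ hy y0); apply: wX; rewrite inE eqxx.
Qed.
End Integrability.

(** * The action of W_X on the root lattice *)

Section RootLattice.
Variables (n : nat) (A : 'M[int]_n) (eps : 'I_n -> nat).
Hypothesis hA : symmetrizable_GCM A eps.
Variables (X : {set 'I_n}) (tau : 'S_n) (w : seq 'I_n).
Hypothesis wX : {subset w <= X}.
Hypothesis hX : admissible_pair A X tau w.
Local Notation Q := 'rV[int]_n.
Local Notation hp := (hp A).
Implicit Types (mu nu b d : Q) (i j k l : 'I_n) (s : seq 'I_n).

Definition supported d : Prop := forall k, k \notin X -> d 0 k = 0.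

Lemma supportedD d b : supported d -> supported b -> supported (d + b).
Proof. by move=> hd hb k kX; rewrite mxE hd // hb. Qed.
Lemma supportedZ (a : int) d : supported d -> supported (a *: d).
Proof. by move=> hd k kX; rewrite mxE hd // mulr0. Qed.
Lemma supportedB d b : supported d -> supported b -> supported (d - b).
Proof. by move=> hd hb k kX; rewrite !mxE hd // hb. Qed.
Lemma supported_simple k : k \in X -> supported (simple k).
Proof. by move=> kX l lX; rewrite /simple mxE eqxx; case: eqP => // e; rewrite e kX in lX. Qed.

Lemma wactD s mu nu : wact A s (mu + nu) = wact A s mu + wact A s nu.
Proof. by elim: s => //= k s ->; rewrite reflD. Qed.
Lemma wactZ s (a : int) mu : wact A s (a *: mu) = a *: wact A s mu.
Proof. by elim: s => //= k s ->; rewrite reflZ. Qed.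
Lemma wact_cat s s' mu : wact A (s ++ s') mu = wact A s (wact A s' mu).
Proof. exact: foldr_cat. Qed.
Lemma wact_rev s mu : wact A (rev s) (wact A s mu) = mu.
Proof.
elim: s => //= k s IHs; rewrite rev_cons -cats1 wact_cat /= (reflK hA); exact: IHs.
Qed.

Lemma wact_supported s b : {subset s <= X} -> supported (wact A s b - b).
Proof.
elim: s => [|k s IHs] sX; first by rewrite subrr => l _; rewrite mxE.
have -> : wact A (k :: s) b - b = wact A s b - b - hp k (wact A s b) *: simple k.
  by rewrite /= reflE addrAC.
apply: supportedB; last by apply/supportedZ/supported_simple/sX; rewrite inE eqxx.
by apply: IHs => r rs; apply: sX; rewrite inE rs orbT.
Qed.

Lemma wact_id s d : {subset s <= X} -> (forall k, k \in X -> hp k d = 0) ->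
  wact A s d = d.
Proof.
move=> sX d0; elim: s sX => //= k s IHs sX.
rewrite IHs => [|r rs]; last by apply: sX; rewrite inE rs orbT.
by rewrite reflE d0 ?scale0r ?subr0 // sX // inE eqxx.
Qed.

(* The average over the finite group W_X kills the roots in X and fixes d. *)
Lemma hp_nondegenerate d : supported d -> (forall k, k \in X -> hp k d = 0) -> d = 0.
Proof.
move=> dX d0; have /finite_seqP[s0 sE] := adm_finite hX.
pose s := undup s0; have sP f : f \in s = (f \in s0) by rewrite mem_undup.
have sW f : f \in s -> exists2 s', {subset s' <= X} & f = wact A s'.
  by rewrite sP => fs; have : weyl A X f by rewrite sE.
have Ws s' : {subset s' <= X} -> wact A s' \in s.
  by move=> s'X; rewrite sP; have : weyl A X (wact A s') by [exists s']; rewrite sE.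
pose S b := \sum_(f <- s) f b.
have Srefl k b : k \in X -> S (refl A k b) = S b.
  move=> kX; pose r (f : Q -> Q) := f \o refl A k.
  have rK : involutive r by move=> f; apply/funext => c; rewrite /r /= (reflK hA).
  have rs f : f \in s -> r f \in s.
    move=> /sW[s' s'X ->]; have -> : r (wact A s') = wact A (s' ++ [:: k]).
      by apply/funext => c; rewrite wact_cat.
    by apply: Ws => l; rewrite mem_cat inE => /orP[/s'X|/eqP ->].
  have ps : perm_eq (map r s) s.
    apply: uniq_perm; rewrite ?undup_uniq // ?(map_inj_uniq (inv_inj rK)) ?undup_uniq //.
    move=> f; apply/mapP/idP => [[g gs ->]|fs]; first exact: rs.
    by exists (r f); [apply: rs | rewrite rK].
  by rewrite /S -[RHS](perm_big _ ps) big_map.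
have SD b c : S (b + c) = S b + S c.
  rewrite /S -big_split; apply: eq_big_seq => f /sW[s' _ ->].
  exact: wactD.
have SZ a b : S (a *: b) = a *: S b.
  rewrite /S scaler_sumr; apply: eq_big_seq => f /sW[s' _ ->].
  exact: wactZ.
have Ss k : k \in X -> S (simple k) = 0.
  move=> kX; have := Srefl k (simple k) kX.
  rewrite reflE hp_simple (gcm_diag hA) -scaleNr SD SZ => e.
  move: (S _) e => v /rowP e; apply/rowP => l; move: (e l); rewrite !mxE => /eqP.
  by rewrite -subr_eq0 addrAC subrr add0r mulf_eq0 => /eqP.
have : S d = 0.
  rewrite [d]row_sum_delta (big_morph S SD (_ : S 0 = 0)); last first.
    by have := SZ 0 0; rewrite !scale0r.
  apply: big1 => k _; rewrite SZ; have [kX|kX] := boolP (k \in X).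
    by rewrite [S _](Ss k kX) scaler0.
  by rewrite dX // scale0r.
have -> : S d = (size s)%:Z *: d.
  rewrite /S (eq_big_seq (fun _ => d)) => [|f /sW[s' s'X ->]]; last exact: wact_id.
  by rewrite big_const_seq count_predT iter_addr_0 -scaler_nat natz.
have s1 : (0 < size s)%N.
  have W0 : wact A [::] \in s by apply: Ws.
  by rewrite lt0n size_eq0; apply: contraTneq W0 => ->.
move=> /rowP e; apply/rowP => k; have := e k; rewrite !mxE => /eqP.
by rewrite mulf_eq0 => /orP[/eqP h|/eqP //]; move: s1; lia.
Qed.

Lemma pairingE h b : pairing A h b = \sum_k h 0 k * hp k b.
Proof.
by apply: eq_bigr => k _; rewrite mulr_sumr; apply: eq_bigr => j _; rewrite mulrA.
Qed.

Lemma pairingDl h h' b : pairing A (h + h') b = pairing A h b + pairing A h' b.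
Proof. by rewrite !pairingE -big_split; apply: eq_bigr => k _; rewrite mxE mulrDl. Qed.
Lemma pairingNl h b : pairing A (- h) b = - pairing A h b.
Proof. by rewrite !pairingE -sumrN; apply: eq_bigr => k _; rewrite mxE mulNr. Qed.
Lemma pairingZl (a : int) h b : pairing A (a *: h) b = a * pairing A h b.
Proof. by rewrite !pairingE mulr_sumr; apply: eq_bigr => k _; rewrite mxE mulrA. Qed.
Lemma pairing_reflr h i b :
  pairing A h (refl A i b) = pairing A h b - hp i b * pairing A h (simple i).
Proof.
rewrite !pairingE mulr_sumr -sumrB; apply: eq_bigr => k _.
by rewrite hp_refl hp_simple; ring.
Qed.

Lemma pairing_corefl h i b : pairing A (corefl A i h) b = pairing A h (refl A i b).
Proof.
by rewrite pairing_reflr /corefl pairingDl pairingNl pairingZl pairing_simple [hp i b * _]mulrC.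
Qed.

Lemma coreflK i : involutive (corefl A i).
Proof.
move=> h; rewrite {1}/corefl pairing_corefl pairing_reflr hp_simple (gcm_diag hA) /corefl.
set P := pairing A h _; have -> : P - 2 * P = - P by ring.
by rewrite scaleNr opprK subrK.
Qed.

Lemma pairing_wact s h b : pairing A h (wact A s b) = pairing A (wcoact A (rev s) h) b.
Proof.
elim: s h => //= k s IHs h; rewrite -pairing_corefl IHs rev_cons -cats1.
by rewrite {2}/wcoact foldr_cat.
Qed.

Lemma wcoact_rev s h : wcoact A (rev s) (wcoact A s h) = h.
Proof.
elim: s => //= k s IHs; rewrite rev_cons -cats1 {1}/wcoact foldr_cat /= coreflK.
exact: IHs.
Qed.

Lemma wcoactN s h : wcoact A s (- h) = - wcoact A s h.
Proof.
by elim: s => //= k s ->; rewrite /corefl pairingNl scaleNr opprD.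
Qed.

Lemma tau_stable k : k \in X -> tau k \in X.
Proof.
move=> kX; have : tau k \in [set tau x | x in X]%SET by apply: imset_f.
by rewrite (adm_stable hX).
Qed.

Lemma tau_notin k : k \notin X -> tau k \notin X.
Proof. by apply: contra => /tau_stable; rewrite (adm_invol hX). Qed.

(** Moves w to the coroot side, where admissibility gives h_k = - w h_(tau k). *)
Lemma hp_wact k b : k \in X -> hp k (wact A w b) = - hp (tau k) b.
Proof.
move=> kX; rewrite -pairing_simple pairing_wact.
have := adm_coroot hX (tau_stable kX); rewrite (adm_invol hX) => ->.
by rewrite wcoactN wcoact_rev pairingNl pairing_simple.
Qed.

Lemma wact_rev_simple k : k \in X -> wact A (rev w) (simple k) = - simple (tau k).
Proof.
move=> kX; have := adm_root hX (tau_stable kX); rewrite (adm_invol hX) => ->.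
by rewrite -scaleN1r wactZ wact_rev scaleN1r.
Qed.

(** The difference is supported on X and, by [hp_wact] used twice, pairs to 0 with the coroots of
    X. *)
Lemma wact_involutive b : wact A w (wact A w b) = b.
Proof.
apply/subr0_eq/hp_nondegenerate => [|k kX]; last first.
  by rewrite hpB !hp_wact ?tau_stable // (adm_invol hX) opprK subrr.
rewrite -[_ - b](subrKA (wact A w b)) ; apply: supportedD; exact: wact_supported.
Qed.

Definition tau_act b : Q := \row_j b 0 (tau j).

Lemma tau_act_simple j : tau_act (simple j) = simple (tau j).
Proof.
apply/rowP => k; rewrite /simple !mxE !eqxx /=; congr (_%:R); congr nat_of_bool.
by apply/eqP/eqP => [<-|->]; rewrite (adm_invol hX).
Qed.

Lemma hp_tau_act k b : hp k (tau_act b) = hp (tau k) b.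
Proof.
rewrite /(hp) (reindex_inj (@perm_inj _ tau)); apply: eq_bigr => j _.
by rewrite mxE (adm_invol hX) -(adm_diagram hX (tau k)) (adm_invol hX).
Qed.

Lemma tau_actB b d : tau_act (b - d) = tau_act b - tau_act d.
Proof. by apply/rowP => k; rewrite !mxE. Qed.

Lemma supported_tau_act d : supported d -> supported (tau_act d).
Proof. by move=> hd k kX; rewrite mxE hd // tau_notin. Qed.

Lemma wact_tau_act b : wact A w (tau_act b) = tau_act (wact A w b).
Proof.
apply/subr0_eq/hp_nondegenerate => [|k kX]; last first.
  by rewrite hpB hp_tau_act !hp_wact ?tau_stable // hp_tau_act subrr.
have -> : wact A w (tau_act b) - tau_act (wact A w b)
    = (wact A w (tau_act b) - tau_act b) - tau_act (wact A w b - b).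
  by rewrite tau_actB opprB addrA subrK.
by apply: supportedB; [|apply: supported_tau_act]; apply: wact_supported.
Qed.

(* The form determined by (alpha_k, d) = eps_k d(h_k). *)
Definition bil b d : int := \sum_k b 0 k * ((eps k)%:Z * hp k d).

Lemma bilC b d : bil b d = bil d b.
Proof.
have E c e : bil c e = \sum_k \sum_j c 0 k * ((eps k)%:Z * (e 0 j * A k j)).
  by apply: eq_bigr => k _; rewrite -!mulr_sumr.
rewrite !E exchange_big; apply: eq_bigr => k _; apply: eq_bigr => j _.
have := gcm_sym hA j k => e.
transitivity (b 0 j * d 0 k * ((eps j)%:Z * A j k)); first by ring.
by rewrite e; ring.
Qed.

Lemma bil_simple k d : bil (simple k) d = (eps k)%:Z * hp k d.
Proof.
rewrite /bil (bigD1 k) //= big1 ?addr0 => [|j jk]; first by rewrite mxE !eqxx mul1r.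
by rewrite mxE eqxx (negbTE jk) mul0r.
Qed.

Lemma bilB b b' d : bil (b - b') d = bil b d - bil b' d.
Proof. by rewrite -sumrB; apply: eq_bigr => k _; rewrite !mxE mulrBl. Qed.
Lemma bilZ (a : int) b d : bil (a *: b) d = a * bil b d.
Proof. by rewrite /bil mulr_sumr; apply: eq_bigr => k _; rewrite mxE -mulrA. Qed.

Lemma bil_refl k b d : bil (refl A k b) (refl A k d) = bil b d.
Proof.
rewrite !reflE bilB bilZ ![bil _ (_ - _)]bilC !bilB !bilZ ![bil (simple k) _]bil_simple.
rewrite [bil _ (simple k)]bilC bil_simple hp_simple (gcm_diag hA) [bil d b]bilC.
by ring.
Qed.

Lemma bil_wact b d s : bil (wact A s b) (wact A s d) = bil b d.
Proof. by elim: s => //= k s IHs; rewrite bil_refl. Qed.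

(* Both eps and eps o tau symmetrize A, so their ratio is constant; it is 1 at i. *)
Lemma eps_tau i k : tau i = i -> eps (tau k) = eps k.
Proof.
move=> ti; pose J := [set k | eps (tau k) == eps k]%SET.
have [JT|JT] := eqVneq J finset.setT.
  by apply/eqP; have := finset.in_setT k; rewrite -JT inE.
have iJ : i \in J by rewrite inE ti.
have J0 : J != finset.set0 by apply/set0Pn; exists i.
have [l [m [lJ mJ /eqP lm]]] := gcm_indecomposable hA J0 JT.
have ml : A m l != 0 by apply/eqP => /(gcm_zero hA).
case/negP: mJ; move: lJ; rewrite !inE => /eqP el; apply/eqP.
have e1 := gcm_sym hA l m; have := gcm_sym hA (tau l) (tau m).
rewrite !(adm_diagram hX) el e1 => /(mulIf ml) [->]//.
Qed.

Lemma bil_tau_act i b d : tau i = i -> bil (tau_act b) (tau_act d) = bil b d.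
Proof.
move=> ti; rewrite /bil (reindex_inj (@perm_inj _ tau)); apply: eq_bigr => k _.
by rewrite hp_tau_act mxE !(adm_invol hX) (eps_tau k ti).
Qed.

(** That is, (alpha_i, w tau alpha_j) = (alpha_j, w alpha_i), by invariance of the form under w and
    tau. It supplies the common factor b in [qserre_twist]. *)
Lemma hp_wact_sym i j : tau i = i ->
  (eps i)%:Z * hp i (wact A w (simple (tau j))) = (eps j)%:Z * hp j (wact A w (simple i)).
Proof.
move=> ti; rewrite -!bil_simple -tau_act_simple wact_tau_act.
have {1}-> : simple i = tau_act (simple i) by rewrite tau_act_simple ti.
by rewrite (bil_tau_act _ _ ti) -(bil_wact _ _ w) wact_involutive bilC.
Qed.

Lemma wact_simple_fixed i : tau i = i ->
  wact A w (simple i) = simple i <-> (forall k, k \in X -> A k i = 0).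
Proof.
move=> ti; split=> [e k kX|h]; last by apply: wact_id => // k kX; rewrite hp_simple h.
have := hp_wact (simple i) kX; rewrite e !hp_simple -{2}ti (adm_diagram hX); lia.
Qed.

Lemma hp_wact_orthogonal j b : (forall k, k \in X -> A j k = 0) ->
  hp j (wact A w b) = hp j b.
Proof.
move=> h; apply/eqP; rewrite -subr_eq0 -hpB; apply/eqP/big1 => k _.
have [kX|kX] := boolP (k \in X); first by rewrite h ?mulr0.
by rewrite (wact_supported _ wX) ?mul0r.
Qed.
End RootLattice.

(** * Quantum symmetric pairs *)

Section TwistedAdjointAction.
Variables (F : fieldType) (B : algType F).
Implicit Types (e f k l x y z : B).

Lemma twisted_ade_comm e k (k' : B) y z c c' chi :
  e * y = y * e -> k * y = c *: (y * k) -> k' * y = c' *: (y * k') -> c * c' = 1 ->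
  z * y = chi *: (y * z) ->
  twisted_ade e k k' z * y = chi *: (y * twisted_ade e k k' z).
Proof.
move=> ey ky k'y cc zy; rewrite /twisted_ade mulrBl mulrBr scalerBr; congr (_ - _).
  by rewrite -mulrA zy -scalerAr mulrA ey !mulrA.
rewrite -[k * z * k' * e * y]mulrA ey.
have -> : k * z * k' * (y * e) = k * (z * (k' * y)) * e by rewrite !mulrA.
rewrite k'y -scalerAr [z * _]mulrA zy -!scalerAl -!scalerAr.
have -> : k * (y * z * k') = (k * y) * z * k' by rewrite !mulrA.
rewrite ky -!scalerAl !scalerA !mulrA; congr (_ *: _).
by rewrite -[RHS]mulr1 -cc; ring.
Qed.

(** The factor l absorbs the powers of q from the conjugations, so that x -> [x, f] l commutes with
    ad(e). *)
Lemma twisted_ade_bracket e k (k' : B) f l x a b :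
  a * b = 1 -> e * f = f * e -> k * f = b *: (f * k) -> f * k' = b *: (k' * f) ->
  l * e = a *: (e * l) -> l * k' = k' * l ->
  (twisted_ade e k k' x * f - f * twisted_ade e k k' x) * l
  = twisted_ade e k k' ((x * f - f * x) * l).
Proof.
move=> ab ef kf k'f le lk'.
have b0 : b != 0 by apply: contra_eq_neq ab => ->; rewrite mulr0 eq_sym oner_eq0.
have k'f' : k' * f = b^-1 *: (f * k') by rewrite k'f scalerA mulVf // scale1r.
have kf' : f * k = b^-1 *: (k * f) by rewrite kf scalerA mulVf // scale1r.
have el : e * l = b *: (l * e) by rewrite le scalerA mulrC ab scale1r.
have h1 : k * x * k' * e * f = b^-1 *: (k * (x * f) * k' * e).
  rewrite -[LHS]mulrA ef.
  have -> : k * x * k' * (f * e) = k * x * (k' * f) * e by rewrite !mulrA.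
  by rewrite k'f' -scalerAr -scalerAl !mulrA.
have h2 : f * (k * x * k' * e) = b^-1 *: (k * (f * x) * k' * e).
  by rewrite !mulrA kf' -!scalerAl.
have h3 z : k * z * k' * e * l = b *: (k * (z * l) * k' * e).
  rewrite -[LHS]mulrA el -scalerAr; congr (_ *: _).
  have -> : k * z * k' * (l * e) = k * z * (k' * l) * e by rewrite !mulrA.
  by rewrite -lk' !mulrA.
rewrite /twisted_ade !mulrBl !mulrBr !mulrBl h1 h2 -!scalerAl !h3 !scalerA mulVf // !scale1r.
by rewrite !mulrA ef; lmod_ring.
Qed.

Lemma qserre_morph (C : algType F) (phi : {rmorphism B -> C})
    (phiZ : forall c x, phi (c *: x) = c *: phi x) q N x y :
  phi (qserre q N x y) = qserre q N (phi x) (phi y).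
Proof.
rewrite /qserre rmorph_sum; apply: eq_bigr => l _.
by rewrite phiZ !rmorphM !rmorphXn.
Qed.

Lemma qserreZ q N x y a b :
  qserre q N (a *: x) (b *: y) = (a ^+ N * b) *: qserre q N x y.
Proof.
rewrite /qserre scaler_sumr; apply: eq_bigr => l _.
rewrite !exprZn -!scalerAl -!scalerAr -!scalerAl !scalerA; congr (_ *: _).
have -> : a ^+ N = a ^+ (N - l) * a ^+ l by rewrite -exprD subnK // -ltnS.
by ring.
Qed.

(** Moving k and l to the right costs a^(N(N-1)/2) b^N in every summand; this is independent of r
    because both mixed commutations have the same b. *)
Lemma qserre_twist q N x y k l a b :
  k * x = a *: (x * k) -> k * y = b *: (y * k) -> l * x = b *: (x * l) -> k * l = l * k ->
  qserre q N x y = 0 -> qserre q N (x * k) (y * l) = 0.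
Proof.
move=> kx ky lx kl S0.
pose g m := \prod_(0 <= r < m) a ^+ r.
have gS m : g m.+1 = g m * a ^+ m by rewrite /g big_nat_recr.
have twist' (z u : B) c m : z * u = c *: (u * z) -> z * u ^+ m = c ^+ m *: (u ^+ m * z).
  move=> zu; elim: m => [|m IHm]; first by rewrite mul1r mulr1 scale1r.
  rewrite [in LHS]exprSr [LHS]mulrA IHm -scalerAl -[_ * z * u]mulrA zu -scalerAr scalerA.
  by rewrite -exprSr [u ^+ m * _]mulrA -exprSr.
have gE m : (x * k) ^+ m = g m *: (x ^+ m * k ^+ m).
  elim: m => [|m IHm]; first by rewrite /g big_geq // scale1r mulr1.
  rewrite exprSr IHm -scalerAl -mulrA [k ^+ m * _]mulrA (expr_twist _ kx) gS.
  by rewrite -scalerAl -scalerAr scalerA [x ^+ m.+1]exprSr [k ^+ m.+1]exprSr !mulrA.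
have gD m m' : g (m + m')%N = g m * g m' * a ^+ (m * m').
  elim: m' => [|m' IHm']; first by rewrite addn0 muln0 mulr1 /g [X in _ * X]big_geq // mulr1.
  by rewrite addnS !gS IHm' mulnS !exprD; ring.
suff -> : qserre q N (x * k) (y * l) = (g N * b ^+ N) *: (qserre q N x y * (k ^+ N * l)).
  by rewrite S0 mul0r scaler0.
rewrite /qserre mulr_suml scaler_sumr; apply: eq_bigr => r _.
have rN : (r <= N)%N by rewrite -ltnS.
have -> : g N * b ^+ N = g (N - r + r)%N * b ^+ (N - r + r) by rewrite subnK.
have -> : k ^+ N = k ^+ (N - r + r) by rewrite subnK.
set c := (-1) ^+ r * _; rewrite -scalerAl [RHS]scalerA [_ * c]mulrC -[RHS]scalerA.
congr (c *: _); clear c.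
have kl' m : GRing.comm l (k ^+ m) by apply: commrX.
move: (nat_of_ord r) (N - r)%N => m h; rewrite !gE gD !exprD.
transitivity ((g h * g m) *: (x ^+ h * (k ^+ h * y) * (l * x ^+ m) * k ^+ m)).
  by rewrite -!(scalerAl, scalerAr) !scalerA !mulrA; congr (_ *: _); ring.
rewrite (expr_twist _ ky) (twist' _ _ _ _ lx).
transitivity ((g h * g m * (b ^+ h * b ^+ m))
    *: (x ^+ h * y * (k ^+ h * x ^+ m) * l * k ^+ m)).
  by rewrite -!(scalerAl, scalerAr) !scalerA !mulrA; congr (_ *: _); ring.
rewrite (twist' _ _ _ _ (expr_twist h kx)) -exprM -!(scalerAl, scalerAr) !scalerA.
rewrite -[_ * l * _]mulrA kl' !mulrA; congr (_ *: _); ring.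
Qed.
End TwistedAdjointAction.

Section QuantumSymmetricPair.
Variables (F : fieldType) (q : F) (n : nat) (A : 'M[int]_n) (eps : 'I_n -> nat).
Hypothesis q_neq0 : q != 0.
Hypothesis q_nroot : forall m, (0 < m)%N -> q ^+ m != 1.
Hypothesis hA : symmetrizable_GCM A eps.
Variables (X : {set 'I_n}) (tau : 'S_n) (w : seq 'I_n).
Hypothesis wX : {subset w <= X}.
Hypothesis hX : admissible_pair A X tau w.
Local Notation qi := (qi q eps).
Local Notation U := (Uq q A eps).
Local Notation E := (UE q A eps).
Local Notation Fg := (UF q A eps).
Local Notation K := (UK q A eps).
Local Notation K' := (UKV q A eps).
Local Notation qn0 := (qi_neq0 eps q_neq0).
Local Notation hp := (hp A).
Variables (T : 'I_n -> {lrmorphism U -> U}) (theta : U -> U).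
Hypothesis hT : forall i, is_lusztig i (T i).
Variables (Zp : 'I_n -> seq 'I_n) (a v : 'I_n -> F).
Hypothesis hZ : kolb_data X tau (T_word T w) theta Zp a v.
Implicit Types (i j k l : 'I_n) (x y : U) (s : seq 'I_n).

Lemma T_word0 s : T_word T s 0 = 0.
Proof. by elim: s => //= k s ->; rewrite rmorph0. Qed.

Lemma T_word_inj s : injective (T_word T s).
Proof.
elim: s => [|k s IHs] x y //= e; apply: IHs.
by have [/bij_inj Ti _] := hT k; apply: Ti.
Qed.

Lemma T_word_qserre s z N x y :
  T_word T s (qserre z N x y) = qserre z N (T_word T s x) (T_word T s y).
Proof.
elim: s => //= k s ->.
by apply: (@qserre_morph _ _ _ (T k)) => c u; apply: lrmorphZ.
Qed.

(* This is ad(Z_i^+)(E_i), a multiple of T_(w_X)(E_i). *)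
Definition kolb_u i : U := adw (Zp i) (E i).

Lemma kolb_a_neq0 i : i \notin X -> a i != 0.
Proof.
move=> iX; have := UE_neq0 q_neq0 q_nroot hA i; apply: contraNneq => a0.
apply/eqP; apply: (@T_word_inj w).
by rewrite (kolb_T hZ iX) a0 scale0r T_word0.
Qed.

Lemma T_kolb_u i : i \notin X -> T_word T w (E i) = a i *: kolb_u i.
Proof. by move=> iX; rewrite (kolb_T hZ iX) ad_adw. Qed.

Lemma kolb_u_neq0 i : i \notin X -> kolb_u i != 0.
Proof.
move=> iX; have := UE_neq0 q_neq0 q_nroot hA i; apply: contraNneq => u0.
apply/eqP; apply: (@T_word_inj w).
by rewrite (T_kolb_u iX) u0 scaler0 T_word0.
Qed.

Lemma kolb_u_weight i : i \notin X -> has_weight (kolb_u i) (wact A w (simple i)).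
Proof.
move=> iX; have -> : kolb_u i = (a i)^-1 *: T_word T w (E i).
  by rewrite (T_kolb_u iX) scalerA mulVf ?kolb_a_neq0 // scale1r.
by apply/has_weightZ/(T_word_weight q_neq0 hA _ hT)/has_weightE.
Qed.

Lemma supported_word_weight s : {subset s <= X} -> supported X (word_weight s).
Proof.
elim: s => [|k s IHs] sX; first by rewrite /word_weight big_nil => l _; rewrite mxE.
rewrite word_weight_cons; apply: supportedD.
  by apply/supported_simple/sX; rewrite inE eqxx.
by apply: IHs => r rs; apply: sX; rewrite inE rs orbT.
Qed.

(** Both sides are weights of the nonzero [kolb_u i], so their pairings agree; their difference is
    supported on X, where pairings suffice. *)
Lemma kolb_word_weight i : i \notin X ->
  wact A w (simple i) = simple i + word_weight (Zp i).
Proof.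
move=> iX; have e := has_weight_inj q_neq0 q_nroot hA (kolb_u_neq0 iX)
  (kolb_u_weight iX) (adw_weight A eps q_neq0 (Zp i) i).
apply/subr0_eq/(hp_nondegenerate hA hX) => [|k _]; last by rewrite hpB e subrr.
rewrite opprD addrA; apply: supportedB; first exact: wact_supported.
exact/supported_word_weight/(kolb_in hZ iX).
Qed.

Lemma kolb_word_nil i : i \notin X ->
  wact A w (simple i) = simple i -> Zp i = [::].
Proof.
move=> iX; rewrite (kolb_word_weight iX) => /eqP; rewrite -subr_eq0 addrAC subrr add0r.
case: (Zp i) => // k s /eqP/rowP/(_ k); rewrite word_weight_cons !mxE !eqxx /=.
have := word_weight_ge0 s k; lia.
Qed.

(* A nonzero value would have weight w (alpha_i - alpha_(tau k)), whereas the *)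
(* weights of the submodule generated by E_i are W_X-stable and lie in        *)
(* alpha_i + sum_X N alpha_l.                                                 *)
Lemma ade_kolb_u i k : i \notin X -> k \in X -> ade k (kolb_u i) = 0.
Proof.
move=> iX kX; have [//|u0] := eqVneq (ade k (kolb_u i)) 0.
have hu := ad_span_ade kX (ad_span_word q A eps i (kolb_in hZ iX)).
have rwX : {subset rev w <= X} by move=> l; rewrite mem_rev; apply: wX.
have [y y0 hy] := ad_span_wact q_neq0 q_nroot hA iX rwX hu u0.
move: y0; rewrite (ad_span_eq0 (k := tau k) _ hy) ?eqxx //.
rewrite -(kolb_word_weight iX) wactD (wact_rev hA) (wact_rev_simple hA hX kX).
by rewrite addrAC subrr add0r /simple !mxE !eqxx.
Qed.

Lemma EF_comm k j : k \in X -> j \notin X -> E k * Fg j = Fg j * E k.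
Proof. by move=> kX jX; apply: UEFC; apply: contraNneq jX => <-. Qed.

Lemma adw_comm s x y mu chi : (forall k, k \in s -> E k * y = y * E k) ->
  has_weight y mu -> x * y = chi *: (y * x) -> adw s x * y = chi *: (y * adw s x).
Proof.
move=> sy hy xy; elim: s sy => //= k s IHs sy.
apply: (twisted_ade_comm (c := qi k ^ hp k mu) (c' := qi k ^ (- hp k mu))).
- by apply: sy; rewrite inE eqxx.
- exact: hy.
- exact: (has_weight_K' q_neq0 k hy).
- by rewrite -expfzDr ?qn0 // subrr.
- by apply: IHs => l ls; apply: sy; rewrite inE ls orbT.
Qed.

Lemma kolb_u_comm_F i j : i \notin X -> j \notin X -> i != j ->
  kolb_u i * Fg j = Fg j * kolb_u i.
Proof.
move=> iX jX ij; rewrite -[RHS]scale1r.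
apply: (adw_comm (mu := - simple j)) => [k /(kolb_in hZ iX) kX||].
- exact: EF_comm.
- exact: has_weightF.
- by rewrite scale1r; apply: UEFC.
Qed.

(* c_j theta_q(F_j K_j) K_j^-1 = - c_j v_j kolb_y j, see BgenE. *)
Definition kolb_y j : U := kolb_u (tau j) * K' j.

Lemma kolb_y_weight j : j \notin X -> has_weight (kolb_y j) (wact A w (simple (tau j))).
Proof.
move=> jX; rewrite -[wact _ _ _]addr0; apply: (has_weightM q_neq0); last exact: has_weightK'.
exact/kolb_u_weight/(tau_notin hX).
Qed.

(** [ade_kolb_u] is a q-commutation of E_k with [kolb_u (tau j)], of factor q_k^(-a_kj); the passage
    of E_k through K_j^-1 cancels it. *)
Lemma E_comm_kolb_y k j : k \in X -> j \notin X -> E k * kolb_y j = kolb_y j * E k.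
Proof.
move=> kX jX; have tjX := tau_notin hX jX.
have Eu : E k * kolb_u (tau j) = qi k ^ (- A k j) *: (kolb_u (tau j) * E k).
  have := ade_kolb_u tjX kX; rewrite (adeE k (kolb_u_weight tjX)) => /subr0_eq ->.
  by rewrite (hp_wact hA hX _ kX) hp_simple (adm_diagram hX).
have K'E : K' j * E k = qi k ^ (- A k j) *: (E k * K' j).
  rewrite (has_weight_K' q_neq0 j (has_weightE _ _ _ k)) hp_simple.
  by rewrite -!invr_expz (qi_sym q hA).
rewrite /kolb_y mulrA Eu -scalerAl -[kolb_u _ * _ * K' j]mulrA -[RHS]mulrA K'E.
by rewrite -scalerAr.
Qed.

(* calZ i = - v_i kolb_zeta i if tau i = i. *)
Definition kolb_zeta i : U := adw (Zp i) (K i ^+ 2) * K' i * K' i.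

(** ad(Z_i^+)(K_i^2) inherits the commutation factor of K_i^2, which the two K_i^-1 cancel. *)
Lemma kolb_zeta_comm i x mu : i \notin X -> has_weight x mu ->
  (forall k, k \in X -> E k * x = x * E k) -> GRing.comm (kolb_zeta i) x.
Proof.
move=> iX hx Ex; rewrite /GRing.comm /kolb_zeta; set c := qi i ^ hp i mu.
have c0 : c != 0 by rewrite expfz_neq0 ?qn0.
have h : adw (Zp i) (K i ^+ 2) * x = c ^+ 2 *: (x * adw (Zp i) (K i ^+ 2)).
  apply: (adw_comm (mu := mu)) => // [k /(kolb_in hZ iX)|]; first exact: Ex.
  by apply: expr_twist; apply: hx.
have K'x : K' i * x = c^-1 *: (x * K' i).
  by rewrite (has_weight_K' q_neq0 i hx) invr_expz.
rewrite -mulrA K'x -scalerAr -[_ * K' i * (x * _)]mulrA [K' i * (_ * _)]mulrA K'x.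
rewrite -scalerAl -scalerAr scalerA !mulrA h -!scalerAl scalerA !mulrA.
rewrite [X in X *: _](_ : _ = 1) ?scale1r //.
by field.
Qed.

Lemma ade1 k : ade k (1 : U) = 0.
Proof. by rewrite /ade /twisted_ade !mulr1 UKK' mul1r subrr. Qed.

Lemma adw1 s : adw s (1 : U) = (s == [::])%:R.
Proof.
case: s => //= k s; have : exists c : F, adw s (1 : U) = c *: 1.
  elim: s => [|l s [c IHs]]; first by exists 1; rewrite scale1r.
  by exists 0; rewrite /= IHs adeZ ade1 scaler0 scale0r.
by case=> c ->; rewrite adeZ ade1 scaler0.
Qed.

Lemma adwZ s c x : adw s (c *: x) = c *: adw s x.
Proof. by elim: s => //= k s ->; rewrite adeZ. Qed.
Lemma adwD s x y : adw s (x + y) = adw s x + adw s y.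
Proof. by elim: s => //= k s ->; rewrite adeD. Qed.

(** ad(Z_i^+) is pulled out of [E_i, F_i] K_i = (K_i^2 - 1) / (q_i - q_i^-1). The summand 1 survives
    only for the empty word: this is the origin of kappa. *)
Lemma kolb_u_bracket i : i \notin X ->
  (kolb_u i * Fg i - Fg i * kolb_u i) * K i
  = (qi i - (qi i)^-1)^-1 *: (adw (Zp i) (K i ^+ 2) - (Zp i == [::])%:R).
Proof.
move=> iX; transitivity (adw (Zp i) ((E i * Fg i - Fg i * E i) * K i)); last first.
  rewrite UEF eqxx mul1r -scalerAl mulrBl UK'K -expr2 adwZ; congr (_ *: _).
  by rewrite -scaleN1r adwD adwZ adw1 scaleN1r.
rewrite /kolb_u; have := kolb_in hZ iX; elim: (Zp i) => // k s IHs sX.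
have kX : k \in X by apply: sX; rewrite inE eqxx.
rewrite /= -IHs => [|r rs]; last by apply: sX; rewrite inE rs orbT.
apply: (@twisted_ade_bracket F U _ _ _ _ _ _ (qi k ^ A k i) (qi k ^ (- A k i))).
- by rewrite -expfzDr ?qn0 // subrr.
- exact: EF_comm.
- exact: UKF.
- rewrite (has_weight_K' q_neq0 k (has_weightF _ _ _ i)) hpN hp_simple opprK scalerA.
  by rewrite -expfzDr ?qn0 // addNr expr0z scale1r.
- by rewrite UKE (qi_sym q hA).
- exact: UKK'C.
Qed.

Lemma kolb_y_F i : i \notin X -> tau i = i ->
  kolb_y i * Fg i = qi i ^+ 2 *: (Fg i * kolb_y i)
   + (qi i ^+ 2 / (qi i - (qi i)^-1)) *:
       (kolb_zeta i - (Zp i == [::])%:R *: (K' i * K' i)).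
Proof.
move=> iX ti; rewrite /kolb_y ti /kolb_zeta.
have := kolb_u_bracket iX; set d := (_ - _)^-1; set W := adw _ (K i ^+ 2) => h.
have K'F : K' i * Fg i = qi i ^+ 2 *: (Fg i * K' i).
  by rewrite (has_weight_K' q_neq0 i (has_weightF _ _ _ i)) hpN hp_simple opprK (gcm_diag hA).
have uF : kolb_u i * Fg i = Fg i * kolb_u i + d *: (W * K' i - (Zp i == [::])%:R *: K' i).
  have : (kolb_u i * Fg i - Fg i * kolb_u i) * K i * K' i
      = d *: (W - (Zp i == [::])%:R) * K' i by rewrite h.
  rewrite -mulrA UKK' mulr1 -scalerAl mulrBl mulr_natl scaler_nat => <-.
  by rewrite addrC subrK.
rewrite -[LHS]mulrA K'F -scalerAr [kolb_u i * (_ * _)]mulrA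
  uF mulrDl -scalerAl mulrBl -scalerAl -!mulrA.
by rewrite scalerDr scalerA [in LHS]expr2 -[_ * _ * d]mulrA.
Qed.

Lemma qserre_kolb_y i j : i \notin X -> j \notin X -> i != j -> tau i = i ->
  qserre (qi i) `|1 - A i j|%N (kolb_y i) (kolb_y j) = 0.
Proof.
move=> iX jX ij ti; have tjX := tau_notin hX jX; have uw := kolb_u_weight.
have itj : i != tau j by apply: contra_neq ij => e; rewrite -(adm_invol hX j) -e ti.
have Aij : A i (tau j) = A i j by rewrite -{1}ti (adm_diagram hX).
have Su : qserre (qi i) `|1 - A i j|%N (kolb_u i) (kolb_u (tau j)) = 0.
  have := congr1 (T_word T w) (USerreE q A eps itj).
  rewrite T_word0 T_word_qserre !T_kolb_u // qserreZ Aij => /eqP.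
  by rewrite scaler_eq0 mulf_eq0 expf_eq0 !(negbTE (kolb_a_neq0 _)) ?andbF //= => /eqP.
rewrite /kolb_y ti; apply: (qserre_twist
   (a := qi i ^ (- hp i (wact A w (simple i))))
   (b := qi i ^ (- hp i (wact A w (simple (tau j)))))) => //.
- exact: (has_weight_K' q_neq0 i (uw _ iX)).
- exact: (has_weight_K' q_neq0 i (uw _ tjX)).
- rewrite (has_weight_K' q_neq0 j (uw _ iX)); congr (_ *: _).
  rewrite /Defs.qi !exprnP !exprz_exp; congr (_ ^ _).
  by rewrite !mulrN (hp_wact_sym hA wX hX j ti).
- exact: UK'C.
Qed.
End QuantumSymmetricPair.

Section TwistSquare.
Variables (F : fieldType) (B : algType F).

Lemma sqr_twistl (k x : B) (t a : F) : k * x = t *: (x * k) ->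
  (a *: (k * k)) * x = t ^+ 2 *: (x * (a *: (k * k))).
Proof.
move=> h; rewrite -[LHS]scalerAl -[k * k * x]mulrA h -!scalerAr.
by rewrite [k * (x * k)]mulrA h -!scalerAl -mulrA !scalerA; congr (_ *: _); ring.
Qed.

Lemma sqr_twistr (k x : B) (t a : F) : x * k = t *: (k * x) ->
  x * (a *: (k * k)) = t ^+ 2 *: ((a *: (k * k)) * x).
Proof.
move=> h; rewrite -[LHS]scalerAr [x * (k * k)]mulrA h -scalerAl -[k * x * k]mulrA h.
by rewrite -!(scalerAr, scalerAl) !scalerA mulrA; congr (_ *: _); ring.
Qed.
End TwistSquare.

(** * The relation for the three kinds of summands of B_j *)

Section RhoRelationCases.
Variables (F : fieldType) (B : algType F) (q c v s : F).
Hypothesis q_neq0 : q != 0.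
Hypothesis q_nroot : forall m, (0 < m)%N -> q ^+ m != 1.
Variables (f y k k' zeta : B) (e : bool).
Local Notation u := (q ^+ 2).
Local Notation dq := (q - q^-1).
Hypothesis yf : y * f = u *: (f * y) + (u / dq) *: (zeta - e%:R *: (k * k)).
Hypothesis kf : k * f = u *: (f * k).
Hypothesis se : s != 0 -> e.
Hypothesis yk : e -> y * k = u *: (k * y).
Hypotheses (zf : GRing.comm zeta f) (zy : GRing.comm zeta y).
Hypothesis zk : e -> GRing.comm zeta k.
Local Notation y' := (- (c * v) *: y).
Local Notation b := (f + (y' + s *: k)).
Local Notation Z := (- v *: zeta).

Lemma rho_relationD p bb ZZ (V W : B) : rho_relation q p c bb ZZ V ->
  rho_relation q p c bb ZZ W -> rho_relation q p c bb ZZ (V + W).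
Proof.
rewrite /rho_relation => hV hW.
have -> : qserre q p.+1 bb (V + W) = qserre q p.+1 bb V + qserre q p.+1 bb W.
  by rewrite /qserre -big_split; apply: eq_bigr => l _; rewrite mulrDr mulrDl scalerDr.
rewrite hV hW -big_split; apply: eq_bigr => m _; rewrite -big_split.
by apply: eq_bigr => m' _ /=; rewrite -scalerDr -mulrDl -mulrDr.
Qed.

Lemma rho_relationZ p bb ZZ (V : B) a : rho_relation q p c bb ZZ V ->
  rho_relation q p c bb ZZ (a *: V).
Proof.
rewrite /rho_relation qserreZr => ->; rewrite scaler_sumr; apply: eq_bigr => m _.
rewrite scaler_sumr; apply: eq_bigr => m' _.
by rewrite -scalerAr -scalerAl !scalerA mulrC.
Qed.

Let gam : F := c * u / dq.
Let K2 : B := (gam * v * e%:R) *: (k * k).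

Let commZ (x : B) a : GRing.comm zeta x -> GRing.comm Z (a *: x).
Proof. by rewrite /GRing.comm -!scalerAr -!scalerAl => ->; rewrite scalerA mulrC -scalerA. Qed.
Let commZ1 (x : B) : GRing.comm zeta x -> GRing.comm Z x.
Proof. by move/(commZ 1); rewrite scale1r. Qed.
Let commZk : GRing.comm Z (s *: k).
Proof.
have [->|/se/zk] := eqVneq s 0; last exact: commZ.
by rewrite scale0r /GRing.comm mulr0 mul0r.
Qed.

Let y'f : y' * f = u *: (f * y') + gam *: Z + K2.
Proof.
rewrite -scalerAl yf -scalerAr /K2 /gam.
by move: (f * y) zeta (k * k) (e%:R : F) => m0 m1 m2 r; lmod_ring.
Qed.

Let skf : (s *: k) * f = u *: (f * (s *: k)).
Proof. by rewrite -scalerAl kf -scalerAr !scalerA mulrC. Qed.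

Let y'sk : y' * (s *: k) = u *: ((s *: k) * y').
Proof.
have [->|/se/yk h] := eqVneq s 0; first by rewrite scale0r mulr0 mul0r scaler0.
by rewrite -!scalerAl -!scalerAr h !scalerA; congr (_ *: _); ring.
Qed.

(** The term s k is grouped with y', since k f = u f k. *)
Lemma rho_relation_lower p V :
  (e -> k * V = q ^- p *: (V * k)) -> y * V = q ^- p *: (V * y) ->
  GRing.comm zeta V -> qserre q p.+1 f V = 0 -> rho_relation q p c b Z V.
Proof.
move=> kV yV zV sV.
have skV : (s *: k) * V = q ^- p *: (V * (s *: k)).
  have [->|/se/kV h] := eqVneq s 0; first by rewrite scale0r mulr0 mul0r scaler0.
  by rewrite -scalerAl h -scalerAr !scalerA mulrC.
apply: (rho_relation_left q_neq0 q_nroot (K2 := K2)) => //.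
- by rewrite mulrDl y'f skf mulrDr scalerDr addrAC [u *: _ + _ + u *: _]addrAC.
- exact: commZ1.
- by apply: commrD; [apply: commZ | apply: commZk].
- exact: commZ1.
- exact: sqr_twistl.
- rewrite /K2; case: e kV => [/(_ isT)|_]; first exact: sqr_twistl.
  by rewrite mulr0n mulr0 scale0r !(mul0r, mulr0) scaler0.
- have y'V : y' * V = q ^- p *: (V * y') by rewrite -scalerAl yV -scalerAr !scalerA mulrC.
  by rewrite mulrDl mulrDr scalerDr skV y'V.
Qed.

(** Here s k is grouped with f, since y k = u k y whenever s <> 0. *)
Lemma rho_relation_upper p V :
  (e -> V * k = q ^- p *: (k * V)) -> V * f = q ^- p *: (f * V) ->
  GRing.comm zeta V -> qserre q p.+1 y V = 0 -> rho_relation q p c b Z V.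
Proof.
move=> Vk Vf zV sV; have Vsk : V * (s *: k) = q ^- p *: ((s *: k) * V).
  have [->|/se/Vk h] := eqVneq s 0; first by rewrite scale0r mulr0 mul0r scaler0.
  by rewrite -scalerAr h -scalerAl !scalerA mulrC.
rewrite addrCA [X in rho_relation _ _ _ X]addrC.
apply: (rho_relation_right q_neq0 q_nroot (K2 := K2)) => //.
- by rewrite mulrDr y'f y'sk mulrDl scalerDr addrAC [u *: _ + _ + u *: _]addrAC.
- by apply: commrD; [apply: commZ1 | apply: commZk].
- exact: commZ.
- exact: commZ1.
- rewrite /K2; case: e yk => [/(_ isT)|_]; last first.
    by rewrite mulr0n mulr0 scale0r !(mul0r, mulr0) scaler0.
  by move=> h; apply: sqr_twistr; rewrite -scalerAl h -scalerAr !scalerA mulrC.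
- rewrite /K2; case: e Vk => [/(_ isT)|_]; first exact: sqr_twistr.
  by rewrite mulr0n mulr0 scale0r !(mul0r, mulr0) scaler0.
- by rewrite mulrDr mulrDl scalerDr Vf Vsk.
- by rewrite -[V]scale1r qserreZ sV scaler0.
Qed.

(** [rho_relation_lower] would ask for k V = q^(-p) V k, whereas here k commutes with V. *)
Lemma rho_relation_cartan r V : e -> zeta = 1 -> k * k' = 1 -> k' * k = 1 ->
  f * V = u ^+ r *: (V * f) -> y * V = u ^- r *: (V * y) -> GRing.comm k V ->
  rho_relation q (2 * r) c b Z V.
Proof.
move=> he z1 kk' k'k fV yV kV; rewrite z1.
apply: (rho_relation_torus q_neq0 q_nroot s (gma := gam * - v) (k' := k')) => //.
- by rewrite -scalerAl yk // -scalerAr !scalerA mulrC.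
- rewrite -scalerAl yf z1 he -scalerAr /gam.
  by move: (f * y) (k * k) (1 : B) => m0 m1 m2; rewrite mulr1n; lmod_ring.
- by split=> //; rewrite -scalerAl yV -scalerAr !scalerA mulrC.
Qed.
End RhoRelationCases.

Section QuantumSymmetricPairRelation.
Variables (F : fieldType) (q : F) (n : nat) (A : 'M[int]_n) (eps : 'I_n -> nat).
Hypothesis q_neq0 : q != 0.
Hypothesis q_nroot : forall m, (0 < m)%N -> q ^+ m != 1.
Hypothesis hA : symmetrizable_GCM A eps.
Variables (X : {set 'I_n}) (tau : 'S_n) (w : seq 'I_n).
Hypothesis wX : {subset w <= X}.
Hypothesis hX : admissible_pair A X tau w.
Local Notation qi := (qi q eps).
Local Notation U := (Uq q A eps).
Local Notation E := (UE q A eps).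
Local Notation Fg := (UF q A eps).
Local Notation K := (UK q A eps).
Local Notation K' := (UKV q A eps).
Local Notation qn0 := (qi_neq0 eps q_neq0).
Local Notation hp := (hp A).
Variables (T : 'I_n -> {lrmorphism U -> U}) (theta : U -> U).
Hypothesis hT : forall i, is_lusztig i (T i).
Variables (Zp : 'I_n -> seq 'I_n) (a v : 'I_n -> F).
Hypothesis hZ : kolb_data X tau (T_word T w) theta Zp a v.
Variables (c s : 'I_n -> F).
Hypothesis hcs : qsp_parameters A eps X tau w c s.
Local Notation ky := (kolb_y q A eps tau Zp).
Local Notation kzeta := (kolb_zeta q A eps Zp).

Lemma BgenE j : j \notin X ->
  Bgen X theta c s j = Fg j + (- (c j * v j) *: ky j + s j *: K' j).
Proof.
move=> jX; rewrite /Bgen (negbTE jX) (kolb_theta hZ jX) ad_adw -addrA; congr (_ + (_ + _)).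
by rewrite -scaleN1r -!scalerAl !scalerA; congr (_ *: _); ring.
Qed.

Lemma calZE i : tau i = i -> calZ q A eps tau Zp v i = - v i *: kzeta i.
Proof. by move=> ti; rewrite /calZ ti ad_adw scaleNr. Qed.

Variables (i j : 'I_n).
Hypotheses (iX : i \notin X) (ti : tau i = i) (jX : j \notin X) (ij : i != j).
Local Notation p := `|A i j|%N.
Local Notation e := (Zp i == [::]).

Lemma qi_offdiag : qi i ^ A i j = qi i ^- p.
Proof. by rewrite {1}(gcm_offdiagE q_neq0 hA ij) -exprnN. Qed.

Lemma kolb_word_nilP : e -> wact A w (simple i) = simple i.
Proof.
move=> /eqP ei.
by rewrite (kolb_word_weight q_neq0 q_nroot hA wX hX hT hZ iX) ei /word_weight big_nil addr0.
Qed.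

Lemma ns_wact k : k \in I_ns A X tau -> wact A w (simple k) = simple k.
Proof.
rewrite inE => /and3P[kX /eqP tk /forall_inP hk].
apply/(wact_simple_fixed hA wX hX tk) => l lX; apply/(gcm_zero hA).
exact/eqP/hk.
Qed.

(** s_i <> 0 forces i into I_ns, where w fixes alpha_i, so that Z_i^+ has weight 0. *)
Lemma s_neq0_word_nil : s i != 0 -> e.
Proof.
move=> /(par_s hcs iX)[/ns_wact h _]; apply/eqP.
exact: (kolb_word_nil q_neq0 q_nroot hA wX hX hT hZ iX h).
Qed.

Let kf k l : K' k * Fg l = qi k ^ A k l *: (Fg l * K' k).
Proof. by rewrite (has_weight_K' q_neq0 k (has_weightF _ _ _ l)) hpN hp_simple opprK. Qed.

Let yw l : l \notin X -> has_weight (ky l) (wact A w (simple (tau l))).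
Proof. exact: (kolb_y_weight q_neq0 q_nroot hA hX hT hZ). Qed.

Let zcomm x mu : has_weight x mu -> (forall k, k \in X -> E k * x = x * E k) ->
  GRing.comm (kzeta i) x.
Proof. exact: (kolb_zeta_comm q_neq0 hZ iX). Qed.

Let zF l : l \notin X -> GRing.comm (kzeta i) (Fg l).
Proof.
move=> lX; apply: (zcomm (has_weightF _ _ _ l)) => k kX.
exact: (EF_comm _ _ _ kX lX).
Qed.

Let zY l : l \notin X -> GRing.comm (kzeta i) (ky l).
Proof.
move=> lX; apply: (zcomm (yw lX)) => k kX.
exact: (E_comm_kolb_y q_neq0 q_nroot hA wX hX hT hZ kX lX).
Qed.

Let zK l : (forall k, k \in X -> A l k = 0) -> GRing.comm (kzeta i) (K' l).
Proof.
move=> h; apply: (zcomm (has_weightK' _ _ _ l)) => k kX.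
by rewrite (has_weight_K' q_neq0 l (has_weightE _ _ _ k)) hp_simple h // oppr0 expr0z scale1r.
Qed.

Let yk l k : l \notin X -> ky l * K' k = qi k ^ hp k (wact A w (simple (tau l))) *: (K' k * ky l).
Proof.
move=> lX; rewrite (has_weight_K' q_neq0 k (yw lX)) scalerA -expfzDr ?qn0 // subrr.
by rewrite expr0z scale1r.
Qed.

Let ki0 : e -> forall k, k \in X -> A i k = 0.
Proof.
move=> /kolb_word_nilP/(wact_simple_fixed hA wX hX ti) h k kX.
by apply/(gcm_zero hA)/h.
Qed.

Let yki : e -> ky i * K' i = qi i ^+ 2 *: (K' i * ky i).
Proof. by move=> he; rewrite (yk i iX) ti (kolb_word_nilP he) hp_simple (gcm_diag hA). Qed.

Let kfi : K' i * Fg i = qi i ^+ 2 *: (Fg i * K' i).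
Proof. by rewrite kf (gcm_diag hA). Qed.

Let zki : e -> GRing.comm (kzeta i) (K' i).
Proof. by move=> /ki0 /zK. Qed.

Let qin := @qi_nroot F q n A eps q_nroot hA i.

Local Notation rr := (rho_relation (qi i) p (c i) (Bgen X theta c s i)
  (calZ q A eps tau Zp v i)).

Let lower V : (e -> K' i * V = qi i ^- p *: (V * K' i)) -> ky i * V = qi i ^- p *: (V * ky i) ->
  GRing.comm (kzeta i) V -> qserre (qi i) p.+1 (Fg i) V = 0 -> rr V.
Proof.
rewrite (calZE ti) (BgenE iX).
exact: (rho_relation_lower _ _ (qn0 i) qin (kolb_y_F q_neq0 hA hZ iX ti) kfi
  s_neq0_word_nil (zF iX) (zY iX) zki).
Qed.

Lemma rho_relation_F : rr (Fg j).
Proof.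
apply: lower.
- by move=> _; rewrite kf qi_offdiag.
- rewrite /kolb_y ti -[LHS]mulrA kf -[LHS]scalerAr [X in _ *: X = _]mulrA
    (kolb_u_comm_F q_neq0 hZ iX jX ij) -mulrA.
  by rewrite qi_offdiag.
- exact: zF.
- by rewrite -(gcm_serre_degree q_neq0 hA ij) USerreF.
Qed.

Let itj : i != tau j.
Proof. by apply: contra_neq ij => h; rewrite -(adm_invol hX j) -h ti. Qed.

Lemma rho_relation_Y : rr (ky j).
Proof.
rewrite (calZE ti) (BgenE iX).
apply: (rho_relation_upper _ _ (qn0 i) qin (kolb_y_F q_neq0 hA hZ iX ti) s_neq0_word_nil
  yki (zF iX) (zY iX) zki).
- move=> he; rewrite (yk i jX); congr (_ *: _); rewrite -qi_offdiag.
  have := hp_wact_sym hA wX hX j ti; rewrite (kolb_word_nilP he) hp_simple -(gcm_sym hA) => h.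
  by rewrite /Defs.qi !exprnP !exprz_exp h.
- rewrite /kolb_y -[LHS]mulrA kf -[LHS]scalerAr [X in _ *: X = _]mulrA.
  rewrite (kolb_u_comm_F q_neq0 hZ (tau_notin hX jX) iX); last by rewrite eq_sym itj.
  rewrite -mulrA.
  by rewrite -(qi_sym q hA) qi_offdiag.
- exact: zY.
- rewrite -(gcm_serre_degree q_neq0 hA ij).
  exact: (qserre_kolb_y q_neq0 q_nroot hA wX hX hT hZ iX jX ij ti).
Qed.

Lemma rho_relation_K' : s j != 0 -> rr (K' j).
Proof.
move=> /(par_s hcs jX)[jns par]; have := jns; rewrite inE => /and3P[_ /eqP tj /forall_inP hj].
have Ajk k : k \in X -> A j k = 0 by move=> /hj/eqP.
have zj := zK Ajk.
have fj : Fg i * K' j = qi i ^+ p *: (K' j * Fg i).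
  rewrite kf -(qi_sym q hA) qi_offdiag scalerA mulfV ?scale1r //.
  by rewrite expf_neq0 ?qn0.
have yj : ky i * K' j = qi i ^- p *: (K' j * ky i).
  rewrite (yk j iX) ti (hp_wact_orthogonal wX _ Ajk) hp_simple -(qi_sym q hA).
  by rewrite qi_offdiag.
have [he|he] := boolP e.
  have ins : i \in I_ns A X tau.
    by rewrite inE iX ti eqxx; apply/forall_inP => k kX; rewrite (ki0 he kX).
  (* The condition on s_j, applied to i in I_ns, makes a_ij even. *)
  have [k Aij] := par i ins ij; have pE : p = (2 * k.+1)%N by rewrite Aij; lia.
  rewrite (calZE ti) (BgenE iX) pE.
  apply: (rho_relation_cartan _ _ _ (k' := K i) (qn0 i) qin
    (kolb_y_F q_neq0 hA hZ iX ti) kfi yki) => //.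
  - by rewrite /kolb_zeta (eqP he) /= expr2 -[_ * K' i * K' i]mulrA mulrA -[_ * K i * K' i]mulrA
       UKK' mulr1 UKK'.
  - exact: UK'K.
  - exact: UKK'.
  - by rewrite fj pE exprM.
  - by rewrite yj pE exprM.
  - exact: UK'C.
(* With Z_i^+ nonempty both s_i and kappa vanish, so no commutation of K_i^-1 with V is required;
   the Serre element dies by the eigenvalue q_i^p. *)
apply: lower => //; first by rewrite (negbTE he).
by apply: (qserre_eigen (qn0 i) qin _ fj); rewrite eqxx orbT.
Qed.

Lemma rho_relation_B : rr (Bgen X theta c s j).
Proof.
rewrite [Bgen X theta c s j](BgenE jX); apply: rho_relationD; first exact: rho_relation_F.
apply: rho_relationD; first exact/rho_relationZ/rho_relation_Y.
have [->|sj] := eqVneq (s j) 0; last exact/rho_relationZ/rho_relation_K'.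
by rewrite scale0r -(scale0r (Fg j)); apply/rho_relationZ/rho_relation_F.
Qed.
End QuantumSymmetricPairRelation.

Lemma q_indet_neq0 (K : fieldType) : q_indet K != 0.
Proof. by rewrite /q_indet tofrac_eq0 polyX_eq0. Qed.

Lemma q_indet_nroot (K : fieldType) m : (0 < m)%N -> q_indet K ^+ m != 1.
Proof.
move=> m0; rewrite /q_indet -tofracXn -tofrac1 tofrac_eq.
apply/eqP => /(congr1 (fun p : {poly K} => size p)).
by rewrite size_polyXn size_poly1 => -[m0']; rewrite m0' in m0.
Qed.

Theorem theorem3p13
  (K : closedFieldType) (charK : [pchar K] =i pred0)
  (n : nat) (A : 'M[int]_n) (eps : 'I_n -> nat)
  (hA : symmetrizable_GCM A eps)
  (X : {set 'I_n}) (tau : 'S_n) (w : seq 'I_n)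
  (hw : longest_word A X w) (hX : admissible_pair A X tau w)
  (sqrtm1 : K) (hsqrtm1 : sqrtm1 ^+ 2 = - 1)
  (omega tauU psi Ad_s :
     {lrmorphism Uq (q_indet K) A eps -> Uq (q_indet K) A eps})
  (T : 'I_n -> {lrmorphism Uq (q_indet K) A eps -> Uq (q_indet K) A eps})
  (homega : is_omega omega) (htauU : is_diagram_auto tau tauU)
  (hpsi : is_psi psi) (hT : forall i, is_lusztig i (T i))
  (hAd_s : is_Ad_s (ratfun_const K) X tau sqrtm1 Ad_s)
  (c s : 'I_n -> {fraction {poly K}})
  (hcs : qsp_parameters A eps X tau w c s)
  (Zp : 'I_n -> seq 'I_n) (a v : 'I_n -> {fraction {poly K}})
  (hZ : kolb_data X tau (T_word T w) (theta_q Ad_s T w psi tauU omega) Zp a v)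
  (i j : 'I_n) (hi : i \notin X) (htaui : tau i = i)
  (hj : j \notin X) (hij : j != i) :
  let B := Bgen X (theta_q Ad_s T w psi tauU omega) c s in
  let Z := calZ (q_indet K) A eps tau Zp v i in
  let q_i := qi (q_indet K) eps i in
  qserre q_i `|1 - A i j|%N (B i) (B j) =
  \sum_(0 <= m < `|A i j|%N)
    \sum_(0 <= m' < `|A i j|%N - m)
      rho q_i (c i) (A i j) m m'
        *: (Z ^+ (`|1 - A i j|%N - m - m')./2 * B i ^+ m * B j * B i ^+ m').
Proof.
move=> B Z q_i; have q0 := q_indet_neq0 K; have qn := @q_indet_nroot K.
have wX : {subset w <= X} by case: hw => -[].
have ij : i != j by rewrite eq_sym.
have := rho_relation_B q0 qn hA wX hX hT hZ hcs hi htaui hj ij.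
rewrite /rho_relation -/B -/Z -/q_i => h.
rewrite (gcm_serre_degree q0 hA ij) h; apply: eq_bigr => m _; apply: eq_bigr => m' _.
by rewrite -(gcm_offdiagE q0 hA ij).
Qed.
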